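(* As $n\to\infty$, $$\prod_{\nu=1}^n|B_{2\nu}|\;\sim\;\mathcal{B}_1\left(\frac{n}{\pi e^{3/2}}\right)^{n(n+1)}(16\pi n)^{\frac n2}\,n^{\frac{11}{24}},$$ $$\prod_{\nu=1}^n\frac{|B_{2\nu}|}{2\nu}\;\sim\;\mathcal{B}_2\left(\frac{n}{\pi e^{3/2}}\right)^{n^2}\left(\frac{4n}{\pi e}\right)^{\frac n2}n^{-\frac1{24}},$$ with the constants $$\mathcal{B}_1=\mathcal{C}_2\,\mathcal{F}_2\,\mathcal{A}^2(2\pi)^{\frac14}=\mathcal{C}_2\,(2\pi)^{\frac12}\,2^{\frac5{24}}\,e^{\frac1{24}}\,\mathcal{A}^{-\frac12},$$ $$\mathcal{B}_2=\mathcal{C}_2\,\mathcal{F}_2\,\mathcal{A}^2(2\pi)^{-\frac14}=\mathcal{C}_2\,2^{\frac5{24}}\,e^{\frac1{24}}\,\mathcal{A}^{-\frac12}.$$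
   Context: $f\sim g$ means $f/g\to1$. $B_m$ are the Bernoulli numbers, $z/(e^z-1)=\sum_{m\ge0}B_mz^m/m!$. $\mathcal{A}$ is the Glaisher--Kinkelin constant, $\log\mathcal{A}=\frac1{12}-\zeta'(-1)$, $\zeta$ the Riemann zeta function. $\mathcal{C}_2=\prod_{\nu=1}^\infty\zeta(2\nu)$ (a convergent product). $\mathcal{F}_2>0$ is the (unique) real constant for which, as $n\to\infty$, $$\prod_{\nu=1}^n(2\nu)!\;\sim\;\mathcal{F}_2\,\mathcal{A}^2\,(2\pi)^{\frac14}\left(\frac{2n}{e^{3/2}}\right)^{n(n+1)}(4\pi n)^{\frac n2}\,n^{\frac{11}{24}}.$$ *)

(* Defs.v *)
From Stdlib Require Import Reals Factorial.
From Coquelicot Require Import Coquelicot.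
Open Scope R_scope.

Definition sim (f g : nat -> R) : Prop := is_lim_seq (fun n => f n / g n) 1.

(* prod1 f n = f 1 * f 2 * ... * f n *)
Fixpoint prod1 (f : nat -> R) (n : nat) : R :=
  match n with
  | O => 1
  | S m => prod1 f m * f (S m)
  end.

Definition Cexp (z : C) : C :=
  (exp (Re z) * cos (Im z), exp (Re z) * sin (Im z)).

Definition analytic_at (f : C -> C) (z0 : C) : Prop :=
  exists (a : nat -> C) (r : posreal), forall z : C,
    Cmod (z - z0)%C < r ->
    @is_pseries C_AbsRing C_NormedModule a (z - z0)%C (f z).

(* The analytic continuation to C \ {1} of the Dirichlet series
   sum_{k >= 1} k^(-s), Re s > 1, where k^(-s) = exp (- s ln k) and k = S n.
   This determines zeta everywhere except at the pole s = 1, where the value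
   is left arbitrary. *)
Definition is_riemann_zeta (zeta : C -> C) : Prop :=
  (forall s : C, 1 < Re s ->
     @is_series C_AbsRing C_NormedModule
       (fun n => Cexp (- s * RtoC (ln (INR (S n))))%C) (zeta s)) /\
  (forall s : C, s <> RtoC 1 -> analytic_at zeta s).

(* Generating function identity z / (e^z - 1) = sum_m B_m z^m / m! in a
   punctured neighbourhood of 0 (z = 0 is the removable singularity, where
   Stdlib's 0 / 0 is meaningless). *)
Definition is_bernoulli (B : nat -> R) : Prop :=
  exists r : posreal, forall z : R, z <> 0 -> Rabs z < r ->
    is_pseries (fun m => B m / INR (fact m)) z (z / (exp z - 1)).

(* zeta is real on the real line away from 1, so that taking real parts below
   only changes the type. *)
Definition glaisher (zeta : C -> C) : R :=
  exp (1 / 12 - Re (C_derive zeta (RtoC (-1)))).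

Definition C_2 (zeta : C -> C) : R :=
  real (Lim_seq (prod1 (fun v => Re (zeta (RtoC (INR (2 * v))))))).

Definition is_F_2 (zeta : C -> C) (F_2 : R) : Prop :=
  0 < F_2 /\
  sim (prod1 (fun v => INR (fact (2 * v))))
      (fun n => F_2 * glaisher zeta ^ 2 * Rpower (2 * PI) (1 / 4)
                * (2 * INR n / exp (3 / 2)) ^ (n * (n + 1))
                * Rpower (4 * PI * INR n) (INR n / 2)
                * Rpower (INR n) (11 / 24)).

(* Main.v *)
Require Import Defs.
From Stdlib Require Import Reals Arith Factorial Lra Lia Psatz Classical IndefiniteDescription.
From Coquelicot Require Import Coquelicot.
Open Scope R_scope.

(** Euler's formula |B_(2v)| = 2 (2v)! zeta(2v) / (2 pi)^(2v) ([bernoulli_zeta])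
    turns the product of the |B_(2v)| into the product of the (2v)!, whose
    growth defines F_2, times the product of the zeta(2v), which converges to
    C_2, times an explicit power ([prod_bernoulli]).  This is the first
    asymptotic formula; dividing by 2^n n! and using Stirling's formula gives
    the second.

    The closed forms of B_1 and B_2 amount to evaluating F_2.  The logarithm of
    the product of the (2v)! is an explicit combination of ln (2n)!, ln n! and
    H(2n), where H(n) is the sum of k ln k for k <= n ([ln_prod_even_fact]).
    As ln (2n)! enters with the factor n + 1/2, Stirling's formula is needed up
    to the term 1/(12 n) ([stirling_bounds], the constant coming from Wallis'
    product), and
      H(n) - (n^2/2 + n/2 + 1/12) ln n + n^2/4 --> ln A
    ([hyperlog_limit]) links H to the Glaisher constant.

    The last limit is where zeta'(-1) enters.  Euler-Maclaurin summation writes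
    (s - 1) zeta(s), for Re s >= 2, as a polynomial plus a sum of terms of order
    k^(-s-3), hence as a function Z defined for Re s >= -1.  Each term is a power
    series around a point s0 whose coefficients a_m have sum |a_m| r^m small, and
    such series can be summed coefficientwise ([wiener_sum]), so Z is analytic;
    this replaces Cauchy's theory.  By isolation of zeros along a polygonal path
    around the pole 1 ([identity_segment]), (s - 1) zeta(s) = Z(s) near -1, and
    differentiating the sum for Z termwise at -1 produces the sums H(n).

    Euler's formula follows from the partial fractions of the cotangent
    ([cot_partial_fractions]), obtained by iterating its duplication formula and
    passing to the limit by dominated convergence.  Expanding them gives x cot x
    as a power series in x^2 with coefficients -2 zeta(2j) / pi^(2j).  The series
    of cos and sin differ from those of cosh and sinh by the signs (-1)^n only, so
    these coefficients are, up to sign, those of y coth y, which come from the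
    generating function of the B_(2j). *)

(** * Finite sums and limits of complex sequences *)

Lemma INR_S_pos n : 0 < INR (S n).
Proof. apply lt_0_INR; lia. Qed.

Lemma INR_S_ge1 n : 1 <= INR (S n).
Proof. rewrite S_INR. pose proof (pos_INR n). lra. Qed.

Lemma is_lim_seq_inv_INR : is_lim_seq (fun n => / INR n) 0.
Proof. apply (is_lim_seq_inv _ p_infty); [apply is_lim_seq_INR|easy]. Qed.

Lemma exp_monotone x y : x <= y -> exp x <= exp y.
Proof. intros [H| ->]; [now apply Rlt_le, exp_increasing|apply Rle_refl]. Qed.

(** Sums over k < n: the empty sum is available, so that telescoping and
    splitting have no boundary cases. *)
Fixpoint rsum (f : nat -> R) (n : nat) : R :=
  match n with O => 0 | S m => rsum f m + f m end.

Fixpoint csum (f : nat -> C) (n : nat) : C :=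
  match n with O => RtoC 0 | S m => (csum f m + f m)%C end.

(** Convergence is measured by the modulus rather than by the product topology,
    so that real squeezing arguments apply; [is_series_csum] relates the two. *)
Definition Cconv (u : nat -> C) (l : C) : Prop :=
  is_lim_seq (fun n => Cmod (u n - l)) 0.

Lemma rsum_Sn f n : rsum f (S n) = rsum f n + f n.
Proof. reflexivity. Qed.

Lemma rsum_ext f g n : (forall k, (k < n)%nat -> f k = g k) -> rsum f n = rsum g n.
Proof.
  induction n as [|n IH]; simpl; intros H; [easy|].
  rewrite IH, H; [easy|lia|]. intros; apply H; lia.
Qed.

Lemma rsum_le f g n : (forall k, (k < n)%nat -> f k <= g k) -> rsum f n <= rsum g n.
Proof.
  induction n as [|n IH]; simpl; intros H; [lra|].
  apply Rplus_le_compat; [apply IH; intros|]; apply H; lia.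
Qed.

Lemma rsum_plus f g n : rsum (fun k => f k + g k) n = rsum f n + rsum g n.
Proof. induction n as [|n IH]; simpl; [ring|]. rewrite IH; ring. Qed.

Lemma rsum_scal c f n : rsum (fun k => c * f k) n = c * rsum f n.
Proof. induction n as [|n IH]; simpl; [ring|]. rewrite IH; ring. Qed.

Lemma rsum_pos f n : (forall k, (k < n)%nat -> 0 <= f k) -> 0 <= rsum f n.
Proof.
  induction n as [|n IH]; simpl; intros H; [lra|].
  apply Rplus_le_le_0_compat; [apply IH; intros|]; apply H; lia.
Qed.

Lemma rsum_add f m n : rsum f (m + n) = rsum f m + rsum (fun k => f (m + k)%nat) n.
Proof.
  induction n as [|n IH]; simpl.
  - rewrite Nat.add_0_r; ring.
  - rewrite Nat.add_succ_r; simpl. rewrite IH; ring.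
Qed.

Lemma rsum_S_l f n : rsum f (S n) = f O + rsum (fun k => f (S k)) n.
Proof. replace (S n) with (1 + n)%nat by lia. rewrite rsum_add. simpl. ring. Qed.

Lemma rsum_exchange (f : nat -> nat -> R) m n :
  rsum (fun i => rsum (f i) n) m = rsum (fun j => rsum (fun i => f i j) m) n.
Proof.
  induction m as [|m IH]; simpl.
  - induction n as [|n IH]; simpl; [easy|]. rewrite <- IH; ring.
  - rewrite IH. now rewrite <- rsum_plus.
Qed.

Lemma sum_n_rsum (f : nat -> R) n : sum_n f n = rsum f (S n).
Proof.
  induction n as [|n IH].
  - rewrite sum_O; simpl; ring.
  - rewrite sum_Sn, IH. reflexivity.
Qed.

Lemma is_series_rsum (f : nat -> R) (l : R) : is_series f l <-> is_lim_seq (rsum f) l.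
Proof.
  rewrite (is_lim_seq_incr_1 (rsum f)). split; intros H.
  - apply is_lim_seq_ext with (sum_n f); [|exact H].
    intros n; apply sum_n_rsum.
  - apply (is_lim_seq_ext _ (sum_n f)) in H; [exact H|].
    intros n; symmetry; apply sum_n_rsum.
Qed.

Lemma csum_Sn f n : csum f (S n) = (csum f n + f n)%C.
Proof. reflexivity. Qed.

Lemma csum_ext f g n : (forall k, (k < n)%nat -> f k = g k) -> csum f n = csum g n.
Proof.
  induction n as [|n IH]; simpl; intros H; [easy|].
  rewrite IH, H; [easy|lia|]. intros; apply H; lia.
Qed.

Lemma csum_plus f g n : csum (fun k => f k + g k)%C n = (csum f n + csum g n)%C.
Proof. induction n as [|n IH]; simpl; [ring|]. rewrite IH; ring. Qed.

Lemma csum_scal c f n : csum (fun k => c * f k)%C n = (c * csum f n)%C.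
Proof. induction n as [|n IH]; simpl; [ring|]. rewrite IH; ring. Qed.

Lemma csum_add f m n : csum f (m + n) = (csum f m + csum (fun k => f (m + k)%nat) n)%C.
Proof.
  induction n as [|n IH]; simpl.
  - rewrite Nat.add_0_r; ring.
  - rewrite Nat.add_succ_r; simpl. rewrite IH; ring.
Qed.

Lemma csum_S_l f n : csum f (S n) = (f O + csum (fun k => f (S k)) n)%C.
Proof. replace (S n) with (1 + n)%nat by lia. rewrite csum_add. simpl. ring. Qed.

Lemma csum_exchange (f : nat -> nat -> C) m n :
  csum (fun i => csum (f i) n) m = csum (fun j => csum (fun i => f i j) m) n.
Proof.
  induction m as [|m IH]; simpl.
  - induction n as [|n IH]; simpl; [easy|]. rewrite <- IH; ring.
  - rewrite IH. now rewrite <- csum_plus.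
Qed.

Lemma Cmod_csum f n : Cmod (csum f n) <= rsum (fun k => Cmod (f k)) n.
Proof.
  induction n as [|n IH]; simpl.
  - rewrite Cmod_0; lra.
  - eapply Rle_trans; [apply Cmod_triangle|]. lra.
Qed.

Lemma Re_csum f n : Re (csum f n) = rsum (fun k => Re (f k)) n.
Proof. induction n as [|n IH]; simpl; [easy|]. now rewrite <- IH. Qed.

Lemma Im_csum f n : Im (csum f n) = rsum (fun k => Im (f k)) n.
Proof. induction n as [|n IH]; simpl; [easy|]. now rewrite <- IH. Qed.

Lemma sum_n_csum (f : nat -> C) n : @sum_n C_AbelianMonoid f n = csum f (S n).
Proof.
  induction n as [|n IH].
  - rewrite sum_O; simpl; ring.
  - rewrite sum_Sn, IH. reflexivity.
Qed.

Lemma Cmod_sym a b : Cmod (a - b) = Cmod (b - a).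
Proof. rewrite <- Cmod_opp. f_equal. ring. Qed.

Lemma Cconv_eps u l : Cconv u l <->
  (forall eps, 0 < eps -> exists N, forall n, (N <= n)%nat -> Cmod (u n - l) < eps).
Proof.
  unfold Cconv. rewrite <- is_lim_seq_spec. split.
  - intros H eps He. destruct (H (mkposreal eps He)) as [N HN].
    exists N; intros n Hn. specialize (HN n Hn). simpl in HN.
    rewrite Rminus_0_r, Rabs_pos_eq in HN by apply Cmod_ge_0. exact HN.
  - intros H eps. destruct (H eps (cond_pos eps)) as [N HN].
    exists N; intros n Hn. rewrite Rminus_0_r, Rabs_pos_eq by apply Cmod_ge_0. auto.
Qed.

Lemma is_series_csum (f : nat -> C) (l : C) :
  @is_series C_AbsRing C_NormedModule f l <-> Cconv (csum f) l.
Proof.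
  pose proof (@filterlim_locally_ball_norm C_AbsRing nat C_NormedModule eventually _
    (@sum_n C_AbelianMonoid f) l) as E.
  rewrite Cconv_eps. split.
  - intros H eps He. destruct (proj1 E H (mkposreal eps He)) as [N HN].
    exists (S N). intros [|n] Hn; [lia|].
    rewrite <- sum_n_csum. apply (HN n). lia.
  - intros H. apply (proj2 E). intros eps. destruct (H eps (cond_pos eps)) as [N HN].
    exists N. intros n Hn.
    specialize (HN (S n) ltac:(lia)). rewrite <- sum_n_csum in HN. exact HN.
Qed.

Lemma is_pseries_csum (a : nat -> C) (w l : C) :
  @is_pseries C_AbsRing C_NormedModule a w l <-> Cconv (csum (fun k => a k * w ^ k)%C) l.
Proof.
  unfold is_pseries. rewrite <- is_series_csum.
  assert (E : forall k, @scal C_AbsRing C_NormedModule (@pow_n C_AbsRing w k) (a k)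
                        = (a k * w ^ k)%C).
  { intros k. assert (E : @pow_n C_AbsRing w k = (w ^ k)%C).
    { induction k as [|k IH]; simpl; [easy|]. now rewrite IH. }
    rewrite E. change ((w ^ k * a k)%C = (a k * w ^ k)%C). ring. }
  split; apply is_series_ext; intros k; now rewrite E.
Qed.

Lemma Cconv_ext u v l : (forall n, u n = v n) -> Cconv u l -> Cconv v l.
Proof. intros H. apply is_lim_seq_ext. intros n; now rewrite H. Qed.

Lemma Cconv_squeeze u l (e : nat -> R) :
  (forall n, Cmod (u n - l) <= e n) -> is_lim_seq e 0 -> Cconv u l.
Proof.
  intros H He. apply is_lim_seq_le_le with (fun _ => 0) e; [|apply is_lim_seq_const|easy].
  intros n; split; [apply Cmod_ge_0|apply H].
Qed.

Lemma Cconv_plus u v l m : Cconv u l -> Cconv v m -> Cconv (fun n => u n + v n)%C (l + m)%C.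
Proof.
  intros Hu Hv. apply Cconv_squeeze with (fun n => Cmod (u n - l) + Cmod (v n - m)).
  - intros n. replace (u n + v n - (l + m))%C with ((u n - l) + (v n - m))%C by ring.
    apply Cmod_triangle.
  - replace 0 with (0 + 0) by ring. now apply is_lim_seq_plus'.
Qed.

Lemma Cconv_scal c u l : Cconv u l -> Cconv (fun n => c * u n)%C (c * l)%C.
Proof.
  intros Hu. apply Cconv_squeeze with (fun n => Cmod c * Cmod (u n - l)).
  - intros n. replace (c * u n - c * l)%C with (c * (u n - l))%C by ring.
    rewrite Cmod_mult; lra.
  - replace 0 with (Cmod c * 0) by ring. now apply (is_lim_seq_scal_l _ _ 0).
Qed.

Lemma Cconv_const c : Cconv (fun _ => c) c.
Proof.
  apply Cconv_squeeze with (fun _ => 0); [|apply is_lim_seq_const].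
  intros _. replace (c - c)%C with (RtoC 0) by ring. rewrite Cmod_0; lra.
Qed.

Lemma Cconv_incr u l : Cconv u l <-> Cconv (fun n => u (S n)) l.
Proof. apply (is_lim_seq_incr_1 (fun n => Cmod (u n - l))). Qed.

Lemma Cconv_bound_loc u l M N : Cconv u l -> (forall n, (N <= n)%nat -> Cmod (u n) <= M) -> Cmod l <= M.
Proof.
  intros Hu HM. apply Rnot_lt_le; intros Hlt.
  destruct (proj1 (Cconv_eps u l) Hu (Cmod l - M)) as [N' HN]; [lra|].
  specialize (HN (Nat.max N N') ltac:(lia)). specialize (HM (Nat.max N N') ltac:(lia)).
  pose proof (Cmod_triangle (u (Nat.max N N')) (l - u (Nat.max N N'))) as T.
  replace (u (Nat.max N N') + (l - u (Nat.max N N')))%C with l in T by ring.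
  rewrite Cmod_sym in HN. lra.
Qed.

Lemma Cconv_unique u l m : Cconv u l -> Cconv u m -> l = m.
Proof.
  intros Hl Hm. assert (H : Cconv (fun n => u n + (-(1)) * u n)%C (l + (-(1)) * m)%C)
    by (apply Cconv_plus, Cconv_scal; assumption).
  apply (Cconv_bound_loc _ _ 0 0) in H.
  - assert (E : Cmod (l + - (1) * m) = 0) by (pose proof (Cmod_ge_0 (l + - (1) * m)); lra).
    apply Cmod_eq_0 in E.
    replace l with (l + - (1) * m + m)%C by ring. rewrite E. ring.
  - intros n _. replace (u n + - (1) * u n)%C with (RtoC 0) by ring. rewrite Cmod_0; lra.
Qed.

Lemma Cconv_Re u l : Cconv u l -> is_lim_seq (fun n => Re (u n)) (Re l).
Proof.
  intros H. apply is_lim_seq_spec. intros eps.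
  destruct (proj1 (Cconv_eps u l) H eps (cond_pos eps)) as [N HN].
  exists N; intros n Hn. eapply Rle_lt_trans; [|apply (HN n Hn)].
  eapply Rle_trans; [|apply re_le_Cmod]. right. f_equal.
Qed.

Lemma Cconv_pair u (a b : R) :
  is_lim_seq (fun n => Re (u n)) a -> is_lim_seq (fun n => Im (u n)) b -> Cconv u (a, b).
Proof.
  intros Ha Hb.
  apply Cconv_squeeze with (fun n => sqrt 2 * (Rabs (Re (u n) - a) + Rabs (Im (u n) - b))).
  - intros n. eapply Rle_trans; [apply Cmod_2Rmax|].
    apply Rmult_le_compat_l; [apply sqrt_pos|].
    change (Rmax (Rabs (Re (u n) - a)) (Rabs (Im (u n) - b)) <= Rabs (Re (u n) - a) + Rabs (Im (u n) - b)).
    pose proof (Rabs_pos (Re (u n) - a)). pose proof (Rabs_pos (Im (u n) - b)).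
    unfold Rmax; destruct Rle_dec; lra.
  - assert (H : forall v (l : R), is_lim_seq v l -> is_lim_seq (fun n => Rabs (v n - l)) 0).
    { intros v l Hv. apply (proj1 (is_lim_seq_abs_0 (fun n => v n - l))).
      replace 0 with (l - l) by ring. apply is_lim_seq_minus'; [easy|apply is_lim_seq_const]. }
    replace 0 with (sqrt 2 * (0 + 0)) by ring.
    apply (is_lim_seq_scal_l _ _ (0 + 0)). apply is_lim_seq_plus'; auto.
Qed.

Lemma im_le_Cmod c : Rabs (Im c) <= Cmod c.
Proof. eapply Rle_trans; [|apply Rmax_Cmod]. apply Rmax_r. Qed.

Lemma abs_bounded_ex_series (f : nat -> R) M :
  (forall n, rsum (fun k => Rabs (f k)) n <= M) -> ex_series f.
Proof.
  intros H. apply ex_series_Rabs.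
  destruct (ex_finite_lim_seq_incr (rsum (fun k => Rabs (f k))) M) as [l Hl]; auto.
  - intros n; simpl. pose proof (Rabs_pos (f n)); lra.
  - exists l. now apply is_series_rsum.
Qed.

(** The limit is given explicitly, so that a sum of functions is again a
    definable function of the argument. *)
Lemma csum_abs_conv (f : nat -> C) M :
  (forall n, rsum (fun k => Cmod (f k)) n <= M) ->
  Cconv (csum f) (Series (fun k => Re (f k)), Series (fun k => Im (f k))).
Proof.
  intros H. apply Cconv_pair.
  - apply is_lim_seq_ext with (rsum (fun k => Re (f k))).
    { intros n; now rewrite Re_csum. }
    apply is_series_rsum, Series_correct, (abs_bounded_ex_series _ M).
    intros n; eapply Rle_trans; [|apply (H n)]. apply rsum_le; intros; apply re_le_Cmod.
  - apply is_lim_seq_ext with (rsum (fun k => Im (f k))).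
    { intros n; now rewrite Im_csum. }
    apply is_series_rsum, Series_correct, (abs_bounded_ex_series _ M).
    intros n; eapply Rle_trans; [|apply (H n)]. apply rsum_le; intros; apply im_le_Cmod.
Qed.

(** * Isolated zeros and the identity theorem *)

Lemma analytic_at_alt f z0 : analytic_at f z0 <->
  exists a r, 0 < r /\ forall w, Cmod w < r ->
     Cconv (csum (fun k => a k * w ^ k)%C) (f (z0 + w)%C).
Proof.
  split.
  - intros [a [r H]]. exists a, r. split; [apply cond_pos|].
    intros w Hw. apply is_pseries_csum.
    replace w with (z0 + w - z0)%C at 1 by ring. apply H.
    now replace (z0 + w - z0)%C with w by ring.
  - intros [a [r [Hr H]]]. exists a, (mkposreal r Hr). intros z Hz.
    apply is_pseries_csum. specialize (H _ Hz).
    now replace (z0 + (z - z0))%C with z in H by ring.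
Qed.

Lemma analytic_plus f g z0 : analytic_at f z0 -> analytic_at g z0 ->
  analytic_at (fun z => f z + g z)%C z0.
Proof.
  rewrite !analytic_at_alt. intros [a [r [Hr Ha]]] [b [q [Hq Hb]]].
  exists (fun k => a k + b k)%C, (Rmin r q). split; [now apply Rmin_case|].
  intros w Hw. pose proof (Rmin_l r q). pose proof (Rmin_r r q).
  eapply Cconv_ext; [|apply Cconv_plus; [apply Ha|apply Hb]; lra].
  intros n. simpl. rewrite <- csum_plus. apply csum_ext; intros; ring.
Qed.

Lemma analytic_scal c f z0 : analytic_at f z0 -> analytic_at (fun z => c * f z)%C z0.
Proof.
  rewrite !analytic_at_alt. intros [a [r [Hr Ha]]].
  exists (fun k => c * a k)%C, r. split; [easy|].
  intros w Hw. eapply Cconv_ext; [|apply Cconv_scal, Ha, Hw].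
  intros n. simpl. rewrite <- csum_scal. apply csum_ext; intros; ring.
Qed.

(** The coefficients of z f(z) around z0, from z = z0 + (z - z0). *)
Definition mulX (z0 : C) (a : nat -> C) (k : nat) : C :=
  match k with O => z0 * a O | S j => z0 * a (S j) + a j end%C.

Lemma csum_mulX z0 a w n :
  csum (fun k => mulX z0 a k * w ^ k)%C (S n)
  = (z0 * csum (fun k => a k * w ^ k) (S n) + w * csum (fun k => a k * w ^ k) n)%C.
Proof.
  induction n as [|n IH].
  - simpl. ring.
  - change (csum (fun k => mulX z0 a k * w ^ k)%C (S (S n))) with
      (csum (fun k => mulX z0 a k * w ^ k)%C (S n) + mulX z0 a (S n) * w ^ (S n))%C.
    rewrite IH. simpl. ring.
Qed.

Lemma Cconv_mulX z0 a w l : Cconv (csum (fun k => a k * w ^ k)%C) l ->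
  Cconv (csum (fun k => mulX z0 a k * w ^ k)%C) ((z0 + w) * l)%C.
Proof.
  intros H. apply Cconv_incr.
  apply Cconv_ext with (fun n => z0 * csum (fun k => a k * w ^ k) (S n) + w * csum (fun k => a k * w ^ k) n)%C.
  - intros n; now rewrite csum_mulX.
  - replace ((z0 + w) * l)%C with (z0 * l + w * l)%C by ring.
    apply Cconv_plus; apply Cconv_scal; [|easy].
    now apply (proj1 (Cconv_incr _ _)).
Qed.

Lemma analytic_mulX f z0 : analytic_at f z0 -> analytic_at (fun z => z * f z)%C z0.
Proof.
  rewrite !analytic_at_alt. intros [a [r [Hr Ha]]].
  exists (mulX z0 a), r. split; [easy|].
  intros w Hw. now apply Cconv_mulX, Ha.
Qed.

Lemma analytic_ext f g z0 : (forall z, f z = g z) -> analytic_at f z0 -> analytic_at g z0.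
Proof.
  rewrite !analytic_at_alt. intros E [a [r [Hr Ha]]].
  exists a, r. split; [easy|]. intros w Hw. rewrite <- E. now apply Ha.
Qed.

Lemma rsum_geom q n : 0 <= q <= 1/2 -> rsum (fun k => q ^ k) n <= 2.
Proof.
  intros Hq. assert (E : rsum (fun k => q ^ k) n * (1 - q) = 1 - q ^ n).
  { induction n as [|n IH]; simpl; [ring|]. rewrite Rmult_plus_distr_r, IH. ring. }
  assert (0 <= q ^ n) by (apply pow_le; lra).
  assert (0 <= rsum (fun k => q ^ k) n) by (apply rsum_pos; intros; apply pow_le; lra).
  nra.
Qed.

Definition locally_zero (f : C -> C) (z0 : C) : Prop :=
  exists r, 0 < r /\ forall w, Cmod w < r -> f (z0 + w)%C = 0.

Lemma csum_conv_terms_bounded f l : Cconv (csum f) l -> exists M, 0 <= M /\ forall k, Cmod (f k) <= M.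
Proof.
  intros H.
  assert (H2 : is_lim_seq (fun k => Cmod (f k)) 0).
  { assert (H3 : Cconv (fun n => csum f (S n) + (-(1)) * csum f n)%C (l + (-(1)) * l)%C).
    { apply Cconv_plus; [now apply (proj1 (Cconv_incr _ _))|now apply Cconv_scal]. }
    eapply is_lim_seq_ext; [|exact H3].
    intros n. simpl. f_equal. ring. }
  destruct (filterlim_bounded (fun k => Cmod (f k)) (ex_intro _ 0 H2)) as [M HM].
  exists M. assert (HM' : forall k, Cmod (f k) <= M).
  { intros k. eapply Rle_trans; [|apply (HM k)]. apply Rle_abs. }
  split; [|easy]. eapply Rle_trans; [apply Cmod_ge_0|apply (HM' O)].
Qed.

(** Let a_m be the first nonzero coefficient.  By geometric domination the later
    terms contribute at most a constant times |w|^(m+1), so a zero w other than 0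
    satisfies |w| >= const * |a_m|, and zeros cannot come arbitrarily close. *)
Lemma isolated_zeros f z0 : analytic_at f z0 ->
  (forall eps, 0 < eps -> exists w, w <> RtoC 0 /\ Cmod w < eps /\ f (z0 + w)%C = 0) ->
  locally_zero f z0.
Proof.
  rewrite analytic_at_alt. intros [a [r [Hr Ha]]] Hz.
  assert (A : forall m, a m = RtoC 0).
  { intros m. induction m as [m IH] using (well_founded_induction Nat.lt_wf_0).
    apply NNPP; intros Hm. apply Cmod_gt_0 in Hm.
    set (q := r / 2). assert (Hq : 0 < q) by (unfold q; lra).
    destruct (csum_conv_terms_bounded _ _ (Ha (RtoC q) ltac:(rewrite Cmod_R, Rabs_pos_eq; unfold q; lra)))
      as [M [HM0 HM]].
    assert (HM' : forall k, Cmod (a k) * q ^ k <= M).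
    { intros k. specialize (HM k). rewrite Cmod_mult, Cmod_pow, Cmod_R, Rabs_pos_eq in HM; lra. }
    set (eps := Rmin (q / 2) (Cmod (a m) * q ^ (S m) / (2 * M + 1))).
    assert (Hqm : 0 < q ^ S m) by (apply pow_lt; lra).
    assert (He : 0 < eps).
    { apply Rmin_case; [lra|]. apply Rdiv_lt_0_compat; [|lra]. now apply Rmult_lt_0_compat. }
    destruct (Hz eps He) as [w [Hw0 [Hw Hfw]]].
    assert (Hw1 : Cmod w < q / 2) by (eapply Rlt_le_trans; [apply Hw|apply Rmin_l]).
    assert (Hw2 : Cmod w < Cmod (a m) * q ^ (S m) / (2 * M + 1)) by (eapply Rlt_le_trans; [apply Hw|apply Rmin_r]).
    apply Cmod_gt_0 in Hw0.
    set (x := Cmod w / q).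
    assert (Hx : 0 <= x <= 1/2).
    { unfold x; split; [apply Rlt_le, Rdiv_lt_0_compat; lra|]. apply Rle_div_l; lra. }
    assert (B : Cmod (a m * w ^ m) <= 2 * M * x ^ (S m)).
    { specialize (Ha w ltac:(unfold q in *; lra)). rewrite Hfw in Ha.
      assert (Ha' : Cconv (fun n => csum (fun k => a k * w ^ k)%C n + - (a m * w ^ m))%C (RtoC 0 + - (a m * w ^ m))%C)
        by (apply Cconv_plus; [easy|apply Cconv_const]).
      replace (Cmod (a m * w ^ m)) with (Cmod (RtoC 0 + - (a m * w ^ m))%C)
        by (rewrite <- Cmod_opp; f_equal; ring).
      apply (Cconv_bound_loc _ _ _ (S m) Ha').
      intros n Hn. replace n with (S m + (n - S m))%nat by lia.
      set (p := (n - S m)%nat). rewrite csum_add.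
      assert (E : csum (fun k => a k * w ^ k)%C (S m) = (a m * w ^ m)%C).
      { simpl. replace (csum (fun k => a k * w ^ k)%C m) with (RtoC 0); [ring|].
        assert (Z : forall j, (j <= m)%nat -> csum (fun k => a k * w ^ k)%C j = RtoC 0).
        { induction j as [|j IHj]; simpl; intros Hj; [easy|].
          rewrite IHj, IH by lia. ring. }
        symmetry; now apply Z. }
      rewrite E. match goal with |- Cmod ?t <= _ => replace t with
        (csum (fun k => a (S m + k)%nat * w ^ (S m + k)%nat)%C p) by ring end.
      eapply Rle_trans; [apply Cmod_csum|].
      eapply Rle_trans; [apply (rsum_le _ (fun k => (M * x ^ S m) * x ^ k))|].
      - intros k _. rewrite Cmod_mult, Cmod_pow.
        rewrite Rmult_assoc, <- pow_add.
        replace (Cmod w) with (x * q) by (unfold x; field; lra).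
        rewrite Rpow_mult_distr.
        assert (0 <= x ^ (S m + k)) by (apply pow_le; lra).
        specialize (HM' (S m + k)%nat). nra.
      - rewrite rsum_scal.
        assert (0 <= x ^ S m) by (apply pow_le; lra).
        assert (0 <= M * x ^ S m) by now apply Rmult_le_pos.
        apply Rle_trans with (M * x ^ S m * 2); [|lra].
        apply Rmult_le_compat_l; [easy|now apply rsum_geom]. }
    rewrite Cmod_mult, Cmod_pow in B.
    assert (E : x ^ S m = Cmod w ^ m * Cmod w / q ^ S m).
    { unfold x, Rdiv. rewrite Rpow_mult_distr, pow_inv. simpl. field. split; [apply pow_nonzero|]; lra. }
    rewrite E in B. assert (Hwm : 0 < Cmod w ^ m) by now apply pow_lt.
    assert (B2 : Cmod (a m) * q ^ S m <= 2 * M * Cmod w).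
    { apply Rmult_le_reg_r with (Cmod w ^ m / q ^ S m); [now apply Rdiv_lt_0_compat|].
      replace (Cmod (a m) * q ^ S m * (Cmod w ^ m / q ^ S m)) with (Cmod (a m) * Cmod w ^ m) by (field; lra).
      eapply Rle_trans; [apply B|]. right. field; lra. }
    apply Rlt_div_r in Hw2; [|lra]. nra. }
  exists r. split; [easy|]. intros w Hw.
  apply (Cconv_unique _ _ _ (Ha w Hw)).
  apply Cconv_ext with (fun _ => RtoC 0); [|apply Cconv_const].
  intros n. induction n as [|n IH]; simpl; [easy|]. rewrite <- IH, A. ring.
Qed.

(** The parameters t up to which the function vanishes near every point of the
    segment have a supremum T.  The point of parameter T is a limit of zeros, so
    by [isolated_zeros] the function vanishes around it, which carries the
    vanishing past T unless T = 1. *)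
Lemma identity_segment f p d : d <> RtoC 0 ->
  (forall t, 0 <= t <= 1 -> analytic_at f (p + t * d)%C) ->
  locally_zero f p -> locally_zero f (p + d)%C.
Proof.
  intros Hd Hf H0. apply Cmod_gt_0 in Hd.
  set (E := fun t => 0 <= t <= 1 /\ forall u, 0 <= u <= t -> locally_zero f (p + u * d)%C).
  assert (E0 : E 0).
  { split; [lra|]. intros u Hu. replace u with 0 by lra.
    now replace (p + 0 * d)%C with p by ring. }
  destruct (completeness E) as [T [HT1 HT2]].
  { exists 1. intros t [Ht _]. lra. }
  { now exists 0. }
  assert (HT : 0 <= T <= 1) by (split; [now apply HT1|apply HT2; intros t [Ht _]; lra]).
  assert (below : forall u, 0 <= u < T -> locally_zero f (p + u * d)%C).
  { intros u Hu. destruct (classic (exists t, E t /\ u < t)) as [[t [[_ Ht] Hut]]|Hn].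
    - apply Ht; lra.
    - exfalso. apply (Rlt_not_le T u); [lra|]. apply HT2. intros t Ht.
      apply Rnot_lt_le. intros Hlt. apply Hn. now exists t. }
  assert (HZ : locally_zero f (p + T * d)%C).
  { destruct (Rle_lt_or_eq_dec 0 T (proj1 HT)) as [Hpos|Heq].
    - apply isolated_zeros; [now apply Hf|]. intros eps He.
      set (h := Rmin (T / 2) (eps / (2 * Cmod d))).
      assert (Hh : 0 < h) by (apply Rmin_case; [lra|apply Rdiv_lt_0_compat; lra]).
      assert (Hh1 : h <= T / 2) by apply Rmin_l.
      assert (Hh2 : h <= eps / (2 * Cmod d)) by apply Rmin_r.
      exists (- h * d)%C. repeat split.
      + apply Cmod_gt_0. rewrite Cmod_mult, Cmod_opp, Cmod_R, Rabs_pos_eq by lra.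
        now apply Rmult_lt_0_compat.
      + rewrite Cmod_mult, Cmod_opp, Cmod_R, Rabs_pos_eq by lra.
        apply Rle_div_r in Hh2; [|lra]. lra.
      + destruct (below (T - h)) as [r [Hr Hz]]; [lra|].
        specialize (Hz (RtoC 0)). rewrite Cmod_0 in Hz. rewrite <- Hz by easy.
        f_equal. rewrite RtoC_minus. ring.
    - rewrite <- Heq. now apply E0; split; [apply Rle_refl|lra]. }
  destruct (Req_dec T 1) as [->|HT1'].
  { now replace (p + d)%C with (p + 1 * d)%C by ring. }
  exfalso. destruct HZ as [r [Hr Hz]].
  set (h := Rmin (1 - T) (r / (2 * Cmod d))).
  assert (Hh : 0 < h) by (apply Rmin_case; [lra|apply Rdiv_lt_0_compat; lra]).
  assert (Hh1 : h <= 1 - T) by apply Rmin_l.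
  assert (Hh2 : h <= r / (2 * Cmod d)) by apply Rmin_r.
  apply Rle_div_r in Hh2; [|lra].
  apply (Rlt_not_le (T + h) T); [lra|]. apply HT1. split; [lra|].
  intros u Hu. destruct (Rlt_le_dec u T) as [Hlt|Hge]; [apply below; lra|].
  exists (r / 2). split; [lra|]. intros w Hw.
  replace (p + u * d + w)%C with (p + T * d + ((u - T)%R * d + w))%C by (rewrite RtoC_minus; ring).
  apply Hz. eapply Rle_lt_trans; [apply Cmod_triangle|].
  rewrite Cmod_mult, Cmod_R, Rabs_pos_eq by lra. nra.
Qed.

(** * Absolutely convergent power series on closed discs *)

(** Power series around s0 with sum |a_m| r^m <= M.  These classes are complete
    and M behaves like a norm, so that a series of analytic functions is shown to
    be analytic by summing real bounds, without contour integrals.  Products are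
    only needed with scalars and with the variable. *)
Definition wiener (s0 : C) (r M : R) (f : C -> C) : Prop :=
  exists a : nat -> C,
    (forall n, rsum (fun m => Cmod (a m) * r ^ m) n <= M) /\
    forall w, Cmod w <= r -> Cconv (csum (fun m => a m * w ^ m)%C) (f (s0 + w)%C).

Lemma wiener_analytic s0 r M f : 0 < r -> wiener s0 r M f -> analytic_at f s0.
Proof.
  intros Hr [a [_ Ha]]. apply analytic_at_alt. exists a, r. split; [easy|].
  intros w Hw. apply Ha; lra.
Qed.

Lemma wiener_ext s0 r M f g : (forall s, f s = g s) -> wiener s0 r M f -> wiener s0 r M g.
Proof.
  intros E [a [H1 H2]]. exists a. split; [easy|]. intros w Hw. rewrite <- E; auto.
Qed.

Lemma wiener_le s0 r M M' f : M <= M' -> wiener s0 r M f -> wiener s0 r M' f.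
Proof.
  intros E [a [H1 H2]]. exists a. split; [|easy]. intros n. eapply Rle_trans; [apply H1|easy].
Qed.

Lemma wiener_plus s0 r M N f g : 0 <= r -> wiener s0 r M f -> wiener s0 r N g ->
  wiener s0 r (M + N) (fun s => f s + g s)%C.
Proof.
  intros Hr [a [Ha1 Ha2]] [b [Hb1 Hb2]]. exists (fun m => a m + b m)%C. split.
  - intros n. specialize (Ha1 n). specialize (Hb1 n).
    eapply Rle_trans; [|apply Rplus_le_compat; [apply Ha1|apply Hb1]].
    rewrite <- rsum_plus. apply rsum_le. intros k _. rewrite <- Rmult_plus_distr_r.
    apply Rmult_le_compat_r; [now apply pow_le|apply Cmod_triangle].
  - intros w Hw. eapply Cconv_ext; [|apply Cconv_plus; [apply Ha2|apply Hb2]; easy].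
    intros n. simpl. rewrite <- csum_plus. apply csum_ext; intros; ring.
Qed.

Lemma wiener_scal s0 r M c f : wiener s0 r M f -> wiener s0 r (Cmod c * M) (fun s => c * f s)%C.
Proof.
  intros [a [Ha1 Ha2]]. exists (fun m => c * a m)%C. split.
  - intros n. rewrite (rsum_ext _ (fun m => Cmod c * (Cmod (a m) * r ^ m))).
    + rewrite rsum_scal. apply Rmult_le_compat_l; [apply Cmod_ge_0|apply Ha1].
    + intros k _. rewrite Cmod_mult. ring.
  - intros w Hw. eapply Cconv_ext; [|apply Cconv_scal, Ha2, Hw].
    intros n. simpl. rewrite <- csum_scal. apply csum_ext; intros; ring.
Qed.

Lemma wiener_mulX s0 r M f : 0 <= r -> wiener s0 r M f ->
  wiener s0 r ((Cmod s0 + r) * M) (fun s => s * f s)%C.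
Proof.
  intros Hr [a [Ha1 Ha2]]. exists (mulX s0 a).
  set (b := fun m => Cmod (a m) * r ^ m) in *.
  assert (Hb : forall k, 0 <= b k) by (intros k; apply Rmult_le_pos; [apply Cmod_ge_0|now apply pow_le]).
  split.
  - assert (S1 : forall n, rsum (fun m => Cmod (mulX s0 a m) * r ^ m) (S n)
                  <= Cmod s0 * rsum b (S n) + r * rsum b n).
    { induction n as [|n IH].
      - simpl. unfold b. rewrite Cmod_mult. simpl. lra.
      - change (rsum (fun m => Cmod (mulX s0 a m) * r ^ m) (S (S n))) with
          (rsum (fun m => Cmod (mulX s0 a m) * r ^ m) (S n) + Cmod (mulX s0 a (S n)) * r ^ (S n)).
        change (rsum b (S (S n))) with (rsum b (S n) + b (S n)).
        change (rsum b (S n)) with (rsum b n + b n) at 2.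
        assert (T : Cmod (mulX s0 a (S n)) * r ^ S n <= Cmod s0 * b (S n) + r * b n).
        { simpl mulX. eapply Rle_trans.
          - apply Rmult_le_compat_r; [now apply pow_le|apply Cmod_triangle].
          - rewrite Cmod_mult. unfold b. simpl. lra. }
        lra. }
    intros n.
    assert (HM : 0 <= M) by apply (Ha1 O).
    pose proof (Cmod_ge_0 s0).
    destruct n as [|n]; [simpl; nra|].
    eapply Rle_trans; [apply S1|]. pose proof (Ha1 n). pose proof (Ha1 (S n)). nra.
  - intros w Hw. now apply Cconv_mulX, Ha2.
Qed.

Lemma Cconv_Cmod u l : Cconv u l -> is_lim_seq (fun n => Cmod (u n)) (Cmod l).
Proof.
  intros H. apply is_lim_seq_spec. intros eps.
  destruct (proj1 (Cconv_eps u l) H eps (cond_pos eps)) as [N HN].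
  exists N; intros n Hn. specialize (HN n Hn).
  pose proof (Cmod_triangle (u n - l) l) as T1. pose proof (Cmod_triangle (l - u n) (u n)) as T2.
  replace (u n - l + l)%C with (u n) in T1 by ring. replace (l - u n + u n)%C with l in T2 by ring.
  rewrite (Cmod_sym l) in T2. apply Rabs_lt_between. lra.
Qed.

Lemma Cconv_csum (u : nat -> nat -> C) (l : nat -> C) K :
  (forall k, Cconv (u k) (l k)) -> Cconv (fun n => csum (fun k => u k n) K) (csum l K).
Proof.
  intros H. induction K as [|K IH]; simpl; [apply Cconv_const|]. now apply Cconv_plus.
Qed.

Lemma is_lim_seq_rsum (u : nat -> nat -> R) (l : nat -> R) K :
  (forall k, is_lim_seq (u k) (l k)) -> is_lim_seq (fun n => rsum (fun k => u k n) K) (rsum l K).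
Proof.
  intros H. induction K as [|K IH]; simpl; [apply is_lim_seq_const|]. now apply is_lim_seq_plus'.
Qed.

(** Exchange the two finite sums and let the number of series tend to infinity. *)
Lemma coef_sum_bound (r : R) (A : nat -> nat -> C) (M : nat -> R) (a : nat -> C) L : 0 <= r ->
  (forall k n, rsum (fun m => Cmod (A k m) * r ^ m) n <= M k) ->
  (forall n, rsum M n <= L) ->
  (forall m, Cconv (csum (fun k => A k m)) (a m)) ->
  forall n, rsum (fun m => Cmod (a m) * r ^ m) n <= L.
Proof.
  intros Hr HA HL Ha n.
  assert (Lim : is_lim_seq (fun K => rsum (fun m => Cmod (csum (fun k => A k m) K) * r ^ m) n)
                  (rsum (fun m => Cmod (a m) * r ^ m) n)).
  { apply (is_lim_seq_rsum (fun m K => Cmod (csum (fun k => A k m) K) * r ^ m)). intros m.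
    apply (is_lim_seq_scal_r _ (r ^ m) (Cmod (a m))), Cconv_Cmod, Ha. }
  refine (is_lim_seq_le _ _ _ (Finite L) _ Lim (is_lim_seq_const L)).
  intros K. eapply Rle_trans; [|apply (HL K)].
  eapply Rle_trans; [|apply rsum_le; intros k _; apply (HA k n)].
  rewrite rsum_exchange. apply rsum_le. intros m _.
  rewrite (rsum_ext _ (fun k => r ^ m * Cmod (A k m))) by (intros; ring).
  rewrite rsum_scal, Rmult_comm. apply Rmult_le_compat_l; [now apply pow_le|apply Cmod_csum].
Qed.

(** Completeness: the coefficients are summed termwise.  Applying
    [coef_sum_bound] to the family truncated at K shows that the error made by
    keeping K series is at most the tail of the bounds, uniformly in the number
    of coefficients taken; the rest is an epsilon / 3 argument. *)
Lemma wiener_sum s0 r (M : nat -> R) L (f : nat -> C -> C) F : 0 < r ->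
  (forall k, wiener s0 r (M k) (f k)) -> (forall n, rsum M n <= L) ->
  (forall w, Cmod w <= r -> Cconv (csum (fun k => f k (s0 + w)%C)) (F (s0 + w)%C)) ->
  wiener s0 r L F.
Proof.
  intros Hr Hf HL HF.
  destruct (functional_choice _ Hf) as [A HA].
  assert (HA1 : forall k n, rsum (fun m => Cmod (A k m) * r ^ m) n <= M k) by (intros k; apply (HA k)).
  assert (HM : forall k, 0 <= M k) by (intros k; apply (HA1 k O)).
  assert (Ht : forall k m, Cmod (A k m) * r ^ m <= M k).
  { intros k m. eapply Rle_trans; [|apply (HA1 k (S m))]. simpl.
    assert (0 <= rsum (fun m => Cmod (A k m) * r ^ m) m); [|lra].
    apply rsum_pos; intros; apply Rmult_le_pos; [apply Cmod_ge_0|apply pow_le; lra]. }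
  assert (Ha : forall m, exists am, Cconv (csum (fun k => A k m)) am).
  { intros m. eexists. apply (csum_abs_conv _ (L / r ^ m)). intros n.
    assert (Hrm : 0 < r ^ m) by now apply pow_lt.
    apply Rle_div_r; [easy|]. eapply Rle_trans; [|apply (HL n)].
    rewrite Rmult_comm, <- rsum_scal. apply rsum_le. intros k _. specialize (Ht k m). lra. }
  destruct (functional_choice _ Ha) as [a Ha']. clear Ha. rename Ha' into Ha.
  exists a. split; [now apply (coef_sum_bound r A M a L); [lra| | |]|].
  intros w Hw. apply Cconv_eps. intros eps He.
  destruct (proj1 (Cconv_eps _ _) (HF w Hw) (eps / 3)) as [K1 HK1]; [lra|].
  destruct (ex_finite_lim_seq_incr (rsum M) L) as [l Hl]; [intros n; simpl; specialize (HM n); lra|easy|].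
  assert (Hl' := Hl). apply is_lim_seq_spec in Hl'.
  destruct (Hl' (mkposreal (eps / 3) ltac:(lra))) as [K2 HK2]. simpl in HK2.
  set (K := Nat.max K1 K2).
  assert (T : forall n, rsum (fun m => Cmod (a m - csum (fun k => A k m) K) * r ^ m) n <= eps / 3).
  { apply (coef_sum_bound r (fun k => A (K + k)%nat) (fun k => M (K + k)%nat)); [lra|easy| |].
    - intros n. pose proof (rsum_add M K n) as E.
      pose proof (is_lim_seq_incr_compare _ _ Hl ltac:(intros j; simpl; specialize (HM j); lra) (K + n)).
      specialize (HK2 K ltac:(unfold K; lia)). apply Rabs_lt_between in HK2. lra.
    - intros m. apply Cconv_ext with (fun n => csum (fun k => A k m) (K + n) + - csum (fun k => A k m) K)%C.
      { intros n. rewrite csum_add. ring. }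
      apply Cconv_plus; [|apply Cconv_const].
      apply Cconv_eps. intros e' He'. destruct (proj1 (Cconv_eps _ _) (Ha m) e' He') as [N HN].
      exists N. intros n Hn. apply HN. lia. }
  assert (G : Cconv (csum (fun m => csum (fun k => A k m) K * w ^ m)%C) (csum (fun k => f k (s0 + w)%C) K)).
  { apply Cconv_ext with (fun n => csum (fun k => csum (fun m => A k m * w ^ m)%C n) K).
    - intros n. rewrite csum_exchange. apply csum_ext. intros m _.
      rewrite Cmult_comm, <- csum_scal. apply csum_ext. intros; ring.
    - apply (Cconv_csum (fun k n => csum (fun m => A k m * w ^ m)%C n)).
      intros k. now apply HA. }
  destruct (proj1 (Cconv_eps _ _) G (eps / 3)) as [N HN]; [lra|].
  exists N. intros n Hn. specialize (HN n Hn). specialize (HK1 K ltac:(unfold K; lia)).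
  set (x := csum (fun m => csum (fun k => A k m) K * w ^ m)%C n) in *.
  set (y := csum (fun k => f k (s0 + w)%C) K) in *.
  assert (D : Cmod (csum (fun m => a m * w ^ m)%C n - x) <= eps / 3).
  { eapply Rle_trans; [|apply (T n)].
    replace (csum (fun m => a m * w ^ m)%C n - x)%C with
      (csum (fun m => (a m - csum (fun k => A k m) K) * w ^ m)%C n).
    - eapply Rle_trans; [apply Cmod_csum|]. apply rsum_le. intros m _.
      rewrite Cmod_mult, Cmod_pow. apply Rmult_le_compat_l; [apply Cmod_ge_0|].
      apply pow_incr; split; [apply Cmod_ge_0|easy].
    - unfold x. replace (csum (fun m => csum (fun k => A k m) K * w ^ m)%C n) with
        (- (csum (fun m => - (1) * (csum (fun k => A k m) K * w ^ m))%C n))%C by (rewrite csum_scal; ring).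
      match goal with |- _ = (?u - - ?v)%C => replace (u - - v)%C with (u + v)%C by ring end.
      rewrite <- csum_plus. apply csum_ext; intros; ring. }
  set (z := csum (fun m => a m * w ^ m)%C n) in *.
  replace (z - F (s0 + w))%C with ((z - x) + ((x - y) + (y - F (s0 + w))))%C by ring.
  pose proof (Cmod_triangle (z - x) ((x - y) + (y - F (s0 + w)%C))).
  pose proof (Cmod_triangle (x - y) (y - F (s0 + w)%C)). lra.
Qed.

(** * Power series of the complex exponential *)

Lemma Cexp_plus z w : Cexp (z + w) = (Cexp z * Cexp w)%C.
Proof.
  destruct z as [a b], w as [c d]. unfold Cexp, Cmult, Cplus, Re, Im; simpl. rewrite exp_plus, cos_plus, sin_plus. f_equal; ring.
Qed.

Lemma Cexp_0 : Cexp 0 = RtoC 1.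
Proof. unfold Cexp; simpl. rewrite exp_0, cos_0, sin_0. unfold RtoC; f_equal; ring. Qed.

Lemma Cmod_Cexp z : Cmod (Cexp z) = exp (Re z).
Proof.
  unfold Cexp, Cmod; simpl. replace (_ + _) with (exp (Re z) ^ 2 * (Rsqr (sin (Im z)) + Rsqr (cos (Im z))))
    by (unfold Rsqr, Cexp, Re, Im; simpl; ring).
  rewrite sin2_cos2, Rmult_1_r, sqrt_pow2; [easy|apply Rlt_le, exp_pos].
Qed.

Lemma Cexp_R (x : R) : Cexp x = RtoC (exp x).
Proof. unfold Cexp; simpl. rewrite cos_0, sin_0. unfold RtoC; f_equal; ring. Qed.

Lemma is_derive_Re_Cexp (c u : C) (t : R) :
  is_derive (fun t : R => Re (c * Cexp (t * u))) t (Re (c * u * Cexp (t * u))).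
Proof.
  destruct c as [c1 c2], u as [u1 u2]. unfold Cexp, Cmult, Re, Im; simpl.
  apply (is_derive_ext (fun t => c1 * (exp (t * u1) * cos (t * u2)) - c2 * (exp (t * u1) * sin (t * u2)))).
  - intros x. now replace (x * u1 - 0 * u2) with (x * u1) by ring;
      replace (x * u2 + 0 * u1) with (x * u2) by ring.
  - replace (t * u1 - 0 * u2) with (t * u1) by ring. replace (t * u2 + 0 * u1) with (t * u2) by ring.
    auto_derive; [easy|]. ring.
Qed.

Lemma Derive_n_Re_Cexp (c u : C) (n : nat) (t : R) :
  ex_derive_n (fun t : R => Re (c * Cexp (t * u))) n t /\
  Derive_n (fun t : R => Re (c * Cexp (t * u))) n t = Re (c * u ^ n * Cexp (t * u)).
Proof.
  revert t; induction n as [|n IH]; intros t.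
  - split; [easy|]. change (Re (c * Cexp (t * u)) = Re (c * 1 * Cexp (t * u))).
    now rewrite Cmult_1_r.
  - pose proof (is_derive_Re_Cexp (c * u ^ n) u t) as D.
    assert (H : is_derive (Derive_n (fun t : R => Re (c * Cexp (t * u))) n) t
              (Re (c * u ^ n * u * Cexp (t * u)))).
    { revert D. apply (is_derive_ext (fun t : R => Re (c * u ^ n * Cexp (t * u)))).
      intros x. symmetry; apply IH. }
    split; [eexists; apply H|].
    replace (c * u ^ S n)%C with (c * u ^ n * u)%C by (rewrite Cpow_S; ring).
    exact (is_derive_unique _ _ _ H).
Qed.

(** Along the ray t |-> t u with |u| = 1, every derivative of Re (c exp(t u)) is
    Re (c u^n exp(t u)), which is bounded on bounded sets uniformly in n; Taylor's
    formula then gives the series.  The factor c = -i yields the imaginary part. *)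
Lemma Cexp_series_Re (c w : C) :
  is_lim_seq (fun n => Re (c * csum (fun m => / INR (fact m) * w ^ m)%C n)) (Re (c * Cexp w)).
Proof.
  assert (Hu : exists u (t : R), Cmod u = 1 /\ w = (t * u)%C).
  { destruct (classic (w = RtoC 0)) as [->|Hw].
    - exists (RtoC 1), 0. split; [apply Cmod_1|ring].
    - assert (Hm : Cmod w <> 0) by (apply Cmod_gt_0 in Hw; lra).
      exists (w / Cmod w)%C, (Cmod w). split.
      + rewrite Cmod_div, Cmod_R, Rabs_pos_eq by (try apply Cmod_ge_0; intros E; apply Hm; now injection E).
        now field.
      + field. intros E; apply Hm; now injection E. }
  destruct Hu as [u [t [Hu ->]]].
  pose proof (mk_pseries (fun t : R => Re (c * Cexp (t * u))) (Cmod c * exp (Rabs t + 1)) (Rabs t + 1)) as P.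
  assert (B : forall (n : nat) x, Rabs x < Rabs t + 1 ->
     ex_derive_n (fun t : R => Re (c * Cexp (t * u))) n x /\
     Rabs (Derive_n (fun t : R => Re (c * Cexp (t * u))) n x) <= Cmod c * exp (Rabs t + 1)).
  { intros n x Hx. destruct (Derive_n_Re_Cexp c u n x) as [H1 H2]. split; [easy|]. rewrite H2.
    eapply Rle_trans; [apply re_le_Cmod|]. rewrite !Cmod_mult, Cmod_pow, Hu, pow1, Cmod_Cexp, Rmult_1_r.
    apply Rmult_le_compat_l; [apply Cmod_ge_0|]. apply exp_monotone.
    eapply Rle_trans; [apply Rle_abs|]. eapply Rle_trans; [apply re_le_Cmod|].
    rewrite Cmod_mult, Hu, Cmod_R. lra. }
  specialize (P B t ltac:(simpl; lra)).
  apply is_pseries_R, is_series_rsum in P.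
  eapply is_lim_seq_ext; [|exact P].
  intros n. rewrite <- csum_scal, Re_csum. apply rsum_ext. intros m _.
  rewrite (proj2 (Derive_n_Re_Cexp c u m 0)), Cmult_0_l, Cexp_0, Cmult_1_r, Cpow_mult_l, <- RtoC_pow.
  rewrite <- RtoC_inv by apply INR_fact_neq_0. destruct (c * u ^ m)%C as [x y] eqn:E.
  replace (c * (RtoC (/ INR (fact m)) * (RtoC (t ^ m) * u ^ m)))%C with
    (RtoC (/ INR (fact m) * t ^ m) * (c * u ^ m))%C by (rewrite RtoC_mult; ring).
  rewrite E. unfold Re, RtoC, Cmult; simpl. unfold Rdiv. ring.
Qed.

Lemma Cexp_series w : Cconv (csum (fun m => / INR (fact m) * w ^ m)%C) (Cexp w).
Proof.
  rewrite (surjective_pairing (Cexp w)). apply Cconv_pair.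
  - pose proof (Cexp_series_Re 1 w) as H. rewrite Cmult_1_l in H.
    eapply is_lim_seq_ext; [|exact H]. intros n. cbv beta. now rewrite Cmult_1_l.
  - pose proof (Cexp_series_Re (- Ci) w) as H.
    replace (Re (- Ci * Cexp w)) with (snd (Cexp w)) in H by (unfold Ci, Cmult, Re; simpl; ring).
    eapply is_lim_seq_ext; [|exact H].
    intros n. simpl. unfold Ci, Cmult, Re, Im; simpl. ring.
Qed.

(** The function x^(-s) with L = ln x: its bound is its modulus at the leftmost
    point s0 - r of the disc. *)
Lemma wiener_npow s0 r L : 0 < r -> 0 <= L ->
  wiener s0 r (exp (- (Re s0 - r) * L)) (fun s => Cexp (- s * L)).
Proof.
  intros Hr HL. exists (fun m => Cexp (- s0 * L) * (/ INR (fact m) * (- RtoC L) ^ m))%C. split.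
  - intros n. rewrite (rsum_ext _ (fun m => exp (- Re s0 * L) * (/ INR (fact m) * (r * L) ^ m))).
    + rewrite rsum_scal.
      replace (exp (- (Re s0 - r) * L)) with (exp (- Re s0 * L) * exp (r * L))
        by (rewrite <- exp_plus; f_equal; ring).
      apply Rmult_le_compat_l; [apply Rlt_le, exp_pos|].
      assert (E := is_exp_Reals (r * L)). apply is_pseries_R, is_series_rsum in E.
      apply (is_lim_seq_incr_compare _ _ E). intros k. simpl.
      assert (0 <= / INR (fact k) * (r * L) ^ k); [|lra].
      apply Rmult_le_pos; [apply Rlt_le, Rinv_0_lt_compat, INR_fact_lt_0|apply pow_le; nra].
    + intros k _. rewrite !Cmod_mult, Cmod_Cexp, Cmod_pow, Cmod_opp, Cmod_R, Rabs_pos_eq by easy.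
      rewrite <- RtoC_inv, Cmod_R, Rabs_pos_eq by (try apply INR_fact_neq_0; apply Rlt_le, Rinv_0_lt_compat, INR_fact_lt_0).
      replace (Re (- s0 * L)) with (- Re s0 * L) by (destruct s0; unfold Cmult, Re; simpl; ring).
      rewrite Rpow_mult_distr. ring.
  - intros w _. replace (Cexp (- (s0 + w) * L)) with (Cexp (- s0 * L) * Cexp (- w * L))%C
      by (rewrite <- Cexp_plus; f_equal; ring).
    eapply Cconv_ext; [|apply Cconv_scal, Cexp_series].
    intros n. simpl. rewrite <- csum_scal. apply csum_ext. intros m _.
    replace (- w * L)%C with (- RtoC L * w)%C by ring. rewrite Cpow_mult_l. ring.
Qed.

(** * Logarithmic differences *)

Lemma nonneg_derive_le (f df : R -> R) y : 0 <= y ->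
  (forall t, 0 <= t <= y -> is_derive f t (df t)) -> (forall t, 0 <= t <= y -> 0 <= df t) ->
  f 0 <= f y.
Proof.
  intros Hy Hf Hd. destruct (MVT_gen f 0 y df) as [c [Hc E]].
  - intros t Ht. rewrite Rmin_left, Rmax_right in Ht by easy. apply Hf; lra.
  - intros t Ht. rewrite Rmin_left, Rmax_right in Ht by easy.
    apply continuity_pt_filterlim, @ex_derive_continuous. eexists; apply Hf; lra.
  - rewrite Rmin_left, Rmax_right in Hc by easy. specialize (Hd c Hc). nra.
Qed.

(** Both differences vanish at 0, and their derivatives are 2 t^4 / (1 - t^2) and
    (4/3) t^4 / (1 - t^2)^2. *)
Lemma ln_ratio_bounds y : 0 <= y < 1 ->
  2 * y + 2 / 3 * y ^ 3 <= ln (1 + y) - ln (1 - y) <= 2 * y + 2 / 3 * (y ^ 3 / (1 - y ^ 2)).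
Proof.
  intros Hy.
  assert (H : forall t, 0 <= t <= y -> 0 < 1 - t ^ 2 /\ 0 < 1 - t /\ 0 < 1 + t) by (intros t Ht; repeat split; nra).
  split.
  - pose proof (nonneg_derive_le (fun t => ln (1 + t) - ln (1 - t) - 2 * t - 2 / 3 * t ^ 3)
      (fun t => 2 * t ^ 4 / (1 - t ^ 2)) y (proj1 Hy)) as P.
    simpl in P. rewrite Rplus_0_r, Rminus_0_r, ln_1 in P.
    enough (0 <= ln (1 + y) - ln (1 - y) - 2 * y - 2 / 3 * y ^ 3) by lra.
    eapply Rle_trans; [|apply P].
    + right; ring.
    + intros t Ht. destruct (H t Ht) as [H1 [H2 H3]]. auto_derive; [lra|]. field. nra.
    + intros t Ht. destruct (H t Ht) as [H1 _]. apply Rdiv_le_0_compat; nra.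
  - pose proof (nonneg_derive_le (fun t => 2 * t + 2 / 3 * (t ^ 3 / (1 - t ^ 2)) - (ln (1 + t) - ln (1 - t)))
      (fun t => 4 / 3 * t ^ 4 / (1 - t ^ 2) ^ 2) y (proj1 Hy)) as P.
    simpl in P. rewrite Rplus_0_r, !Rminus_0_r, ln_1 in P.
    enough (0 <= 2 * y + 2 / 3 * (y ^ 3 / (1 - y ^ 2)) - (ln (1 + y) - ln (1 - y))) by lra.
    eapply Rle_trans; [|apply P].
    + right; field.
    + intros t Ht. destruct (H t Ht) as [H1 [H2 H3]]. auto_derive; [nra|]. field. nra.
    + intros t Ht. destruct (H t Ht) as [H1 _]. apply Rdiv_le_0_compat; [|simpl in *; nra].
      apply Rmult_le_pos; [lra|]. apply (pow_le t 4); lra.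
Qed.

(** With y = 1 / (2x + 1), (x + 1)/x = (1 + y)/(1 - y), and the symmetry removes
    the even powers of y.  Both Stirling's formula and the Euler-Maclaurin
    estimate rest on this. *)
Lemma ln_step_trapezoid x : 1 <= x ->
  1 + / (3 * (2 * x + 1) ^ 2) <= (x + 1 / 2) * (ln (x + 1) - ln x) <= 1 + / (12 * x * (x + 1)).
Proof.
  intros Hx. set (y := / (2 * x + 1)).
  assert (Hy : 0 < y) by (apply Rinv_0_lt_compat; lra).
  assert (Hy1 : y < 1) by (unfold y; rewrite <- Rinv_1; apply Rinv_lt_contravar; lra).
  assert (E : ln (x + 1) - ln x = ln (1 + y) - ln (1 - y)).
  { rewrite <- !ln_div by lra. f_equal. unfold y. field. lra. }
  pose proof (ln_ratio_bounds y ltac:(lra)) as [B1 B2]. rewrite <- E in B1, B2.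
  split.
  - apply Rmult_le_compat_l with (r := x + 1 / 2) in B1; [|lra].
    eapply Rle_trans; [|apply B1]. right. unfold y. field. lra.
  - apply Rmult_le_compat_l with (r := x + 1 / 2) in B2; [|lra].
    eapply Rle_trans; [apply B2|]. right. unfold y. field.
    repeat split; nra.
Qed.

Lemma ln_step_bounds x : 0 < x -> / (x + 1) <= ln (x + 1) - ln x <= / x.
Proof.
  intros Hx. assert (Hi : 0 < / x) by now apply Rinv_0_lt_compat.
  assert (Hj : 0 < / (x + 1)) by (apply Rinv_0_lt_compat; lra).
  rewrite <- ln_div by lra. split.
  - apply Ropp_le_cancel. rewrite <- ln_Rinv by (apply Rdiv_lt_0_compat; lra).
    rewrite <- (ln_exp (- / (x + 1))). apply ln_le.
    + apply Rinv_0_lt_compat, Rdiv_lt_0_compat; lra.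
    + eapply Rle_trans; [|apply exp_ineq1_le]. right. field. lra.
  - rewrite <- (ln_exp (/ x)). apply ln_le; [apply Rdiv_lt_0_compat; lra|].
    eapply Rle_trans; [|apply exp_ineq1_le]. right. field. lra.
Qed.

(** * Euler-Maclaurin summation of the zeta series *)

(** (s - 1) times x^(1-s)/(s-1) + x^(-s)/2 + s x^(-s-1)/12, the Euler-Maclaurin
    approximation of the sum of k^(-s) over k = x, x + 1, and so on; the factor
    s - 1 removes the pole. *)
Definition em_tail (x : R) (s : C) : C :=
  ((RtoC x + (s - 1) / 2 + (s * s - s) / (12 * x)) * Cexp (- s * ln x))%C.

(** What is left of (s - 1) x^(-s) once the telescoping part is removed; it has
    order x^(-s-3). *)
Definition em_term (x : R) (s : C) : C :=
  ((s - 1) * Cexp (- s * ln x) - em_tail x s + em_tail (x + 1) s)%C.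

(** After replacing (1 + 1/x)^(-s) = e^(-us) by its cubic Taylor polynomial in s,
    [em_term] becomes x^(-s) times a polynomial in s with these coefficients.
    They are small because u (x + 1/2) = 1 + 1/(12 x (x+1)) + O(x^-4), by
    [ln_step_trapezoid], and u lies between 1/(x+1) and 1/x. *)
Lemma em_coef_bounds x u : 1 <= x -> u = ln (x + 1) - ln x ->
  Rabs (1 + / (12 * x * (x + 1)) - u * (x + 1/2)) <= / x ^ 3 /\
  Rabs (- / (12 * x * (x + 1)) - u / 2 + u / (12 * (x + 1)) + u ^ 2 / 2 * (x + 1 / 2)) <= / x ^ 3 /\
  Rabs (- u / (12 * (x + 1)) + u ^ 2 / 2 * (1 / 2 - / (12 * (x + 1))) - u ^ 3 / 6 * (x + 1 / 2)) <= / x ^ 3 /\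
  Rabs (u ^ 2 / (24 * (x + 1)) - u ^ 3 / 6 * (1 / 2 - / (12 * (x + 1)))) <= / x ^ 3 /\
  Rabs (- u ^ 3 / (72 * (x + 1))) <= / x ^ 3.
Proof.
  intros Hx Hu. pose proof (ln_step_trapezoid x Hx) as [B1 B2].
  pose proof (ln_step_bounds x ltac:(lra)) as [B3 B4]. rewrite <- Hu in *. clear Hu.
  set (v := / x) in *. set (q := / (x + 1)) in *.
  assert (Hv : 0 < v) by (apply Rinv_0_lt_compat; lra).
  assert (Hq : 0 < q) by (apply Rinv_0_lt_compat; lra).
  assert (Hv1 : v <= 1) by (unfold v; rewrite <- Rinv_1; apply Rinv_le_contravar; lra).
  assert (Evq : v - q = v * q) by (unfold v, q; field; lra).
  assert (Hqv : q <= v) by nra.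
  assert (Hvq : v <= 2 * q) by nra.
  replace (/ (12 * x * (x + 1))) with (v * q / 12) in * by (unfold v, q; field; lra).
  replace (/ (12 * (x + 1))) with (q / 12) by (unfold q; field; lra).
  replace (u / (12 * (x + 1))) with (u * q / 12) by (unfold q; field; lra).
  replace (- u / (12 * (x + 1))) with (- u * q / 12) by (unfold q; field; lra).
  replace (u ^ 2 / (24 * (x + 1))) with (u ^ 2 * q / 24) by (unfold q; field; lra).
  replace (- u ^ 3 / (72 * (x + 1))) with (- u ^ 3 * q / 72) by (unfold q; field; lra).
  replace (/ x ^ 3) with (v ^ 3) by (unfold v; field; lra).
  assert (L : v * q / 12 - v ^ 4 / 48 <= / (3 * (2 * x + 1) ^ 2)).
  { replace (/ (3 * (2 * x + 1) ^ 2)) with (v * q / 12 - v * q * / (2 * x + 1) ^ 2 / 12)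
      by (unfold v, q; field; lra).
    assert (/ (2 * x + 1) ^ 2 <= v ^ 2 / 4).
    { replace (v ^ 2 / 4) with (/ (2 * x) ^ 2) by (unfold v; field; lra).
      apply Rinv_le_contravar; nra. }
    assert (0 < v * q) by nra. assert (v * q <= v ^ 2) by nra.
    assert (0 < / (2 * x + 1) ^ 2) by (apply Rinv_0_lt_compat; nra).
    assert (v * q * / (2 * x + 1) ^ 2 <= v ^ 2 * (v ^ 2 / 4)) by (apply Rmult_le_compat; lra).
    lra. }
  set (d := u * (x + 1 / 2) - 1 - v * q / 12).
  assert (Hd : - v ^ 4 / 48 <= d <= 0) by (unfold d; lra).
  assert (Hv3 : 0 < v ^ 3) by now apply pow_lt.
  assert (Hv2 : v ^ 2 <= v) by nra.
  assert (Hv32 : v ^ 3 <= v ^ 2) by (simpl; nra).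
  assert (Hv4 : v ^ 4 <= v ^ 3) by (simpl in *; nra).
  replace (u * (x + 1/2)) with (1 + v * q / 12 + d) by (unfold d; ring).
  assert (Hu0 : 0 < u) by lra.
  assert (P1 : 0 < v * q <= v ^ 2) by (split; nra).
  assert (P2 : 0 <= v - u <= v ^ 2) by nra.
  assert (P3 : 0 <= u - q <= v ^ 2) by nra.
  assert (P4 : 0 < u ^ 2 <= v ^ 2) by (split; [apply pow_lt; lra|apply pow_incr; lra]).
  assert (P5 : 0 < u ^ 3 <= v ^ 3) by (split; [apply pow_lt; lra|apply pow_incr; lra]).
  assert (E3 : v * v ^ 2 = v ^ 3) by ring.
  split; [|split; [|split; [|split]]].
  - apply Rabs_le. lra.
  - replace (- (v * q / 12) - u / 2 + u * q / 12 + u ^ 2 / 2 * (x + 1 / 2)) with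
      (u / 2 * (v * q / 12 + d) - (v - u) * q / 12) by (unfold d; field).
    assert (H1 : Rabs (u / 2 * (v * q / 12 + d)) <= v / 2 * (v ^ 2 / 6)).
    { rewrite Rabs_mult. apply Rmult_le_compat; try apply Rabs_pos; apply Rabs_le; lra. }
    assert (H2 : 0 <= (v - u) * q / 12 <= v ^ 3 / 12) by (split; [|rewrite <- E3]; nra).
    apply Rabs_le_between in H1. apply Rabs_le. lra.
  - replace (- u * q / 12 + u ^ 2 / 2 * (1 / 2 - q / 12) - u ^ 3 / 6 * (x + 1 / 2)) with
      (u / 12 * (u - q) - u ^ 2 * (q / 24) - u ^ 2 / 6 * (v * q / 12 + d)) by (unfold d; field).
    assert (H1 : 0 <= u / 12 * (u - q) <= v / 12 * v ^ 2) by (split; [nra|apply Rmult_le_compat; lra]).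
    assert (H2 : 0 <= u ^ 2 * (q / 24) <= v ^ 2 * (v / 24)) by (split; [nra|apply Rmult_le_compat; lra]).
    assert (H3 : Rabs (u ^ 2 / 6 * (v * q / 12 + d)) <= v ^ 2 / 6 * (v / 6)).
    { rewrite Rabs_mult. apply Rmult_le_compat; try apply Rabs_pos; apply Rabs_le; lra. }
    apply Rabs_le_between in H3. apply Rabs_le. lra.
  - assert (H2 : 0 <= u ^ 2 * q <= v ^ 2 * v) by (split; [nra|apply Rmult_le_compat; lra]).
    assert (H3 : 0 <= u ^ 3 / 6 * (1 / 2 - q / 12) <= v ^ 3 / 6 * 1)
      by (split; [apply Rmult_le_pos; lra|apply Rmult_le_compat; lra]).
    apply Rabs_le. lra.
  - assert (H2 : 0 <= u ^ 3 * q <= v ^ 3 * 1) by (split; [nra|apply Rmult_le_compat; lra]).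
    apply Rabs_le. lra.
Qed.

Lemma wiener_pow s0 r M f j : 0 <= r -> wiener s0 r M f ->
  wiener s0 r ((Cmod s0 + r) ^ j * M) (fun s => s ^ j * f s)%C.
Proof.
  intros Hr Hf. induction j as [|j IH].
  - apply wiener_ext with f; [intros; simpl; ring|]. now rewrite Rmult_1_l.
  - apply wiener_ext with (fun s => s * (s ^ j * f s))%C; [intros; simpl; ring|].
    replace ((Cmod s0 + r) ^ S j * M) with ((Cmod s0 + r) * ((Cmod s0 + r) ^ j * M)) by (simpl; ring).
    now apply wiener_mulX.
Qed.

Lemma Cconv_shift u l k : Cconv u l -> Cconv (fun n => u (k + n)%nat) l.
Proof.
  intros H. induction k as [|k IH]; [easy|]. apply (proj1 (Cconv_incr _ _)) in IH.
  eapply Cconv_ext; [|exact IH]. intros n. simpl. f_equal. lia.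
Qed.

Lemma fact_add4 j : (fact j <= fact (4 + j))%nat.
Proof. apply fact_le. lia. Qed.

(** The Taylor remainder of e^(-us) starts with u^4 s^4 and is dominated by
    (u R)^4 e^(u R), R being the largest modulus on the disc. *)
Lemma wiener_exp_remainder s0 r L u : 0 < r -> 0 <= L -> 0 <= u ->
  wiener s0 r (exp (- (Re s0 - r) * L) * ((u * (Cmod s0 + r)) ^ 4 * exp (u * (Cmod s0 + r))))
    (fun s => Cexp (- s * L) * (Cexp (- s * u) - (1 - u * s + u ^ 2 / 2 * s ^ 2 - u ^ 3 / 6 * s ^ 3)))%C.
Proof.
  intros Hr HL Hu. set (R := Cmod s0 + r). set (K := exp (- (Re s0 - r) * L)).
  assert (HR : 0 <= R) by (unfold R; pose proof (Cmod_ge_0 s0); lra).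
  assert (HK : 0 < K) by apply exp_pos.
  apply wiener_sum with (M := fun j => / INR (fact (4 + j)) * u ^ (4 + j) * (R ^ (4 + j) * K))
    (f := fun j s => ((RtoC (/ INR (fact (4 + j)) * (- u) ^ (4 + j)) * (s ^ (4 + j) * Cexp (- s * L))))%C);
    [easy| | |].
  - intros j. eapply wiener_le; [|apply wiener_scal, wiener_pow, wiener_npow; lra].
    fold K. fold R. right. f_equal. rewrite Cmod_R, Rabs_mult, <- RPow_abs, Rabs_Ropp, Rabs_pos_eq, Rabs_pos_eq; try easy.
    apply Rlt_le, Rinv_0_lt_compat, INR_fact_lt_0.
  - intros n. eapply Rle_trans; [apply (rsum_le _ (fun j => K * (u * R) ^ 4 * (/ INR (fact j) * (u * R) ^ j)))|].
    + intros j _. replace (/ INR (fact (4 + j)) * u ^ (4 + j) * (R ^ (4 + j) * K)) with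
        ((K * (u * R) ^ 4 * (u * R) ^ j) * / INR (fact (4 + j))) by (rewrite !Rpow_mult_distr, !pow_add; ring).
      replace (K * (u * R) ^ 4 * (/ INR (fact j) * (u * R) ^ j)) with ((K * (u * R) ^ 4 * (u * R) ^ j) * / INR (fact j)) by ring.
      assert (0 <= u * R) by nra.
      apply Rmult_le_compat_l; [repeat apply Rmult_le_pos; try apply pow_le; lra|].
      apply Rinv_le_contravar; [apply INR_fact_lt_0|apply le_INR, fact_add4].
    + rewrite rsum_scal, Rmult_assoc. apply Rmult_le_compat_l; [lra|].
      apply Rmult_le_compat_l; [apply pow_le; nra|].
      assert (E := is_exp_Reals (u * R)). apply is_pseries_R, is_series_rsum in E.
      apply (is_lim_seq_incr_compare _ _ E). intros k. simpl.
      assert (0 <= / INR (fact k) * (u * R) ^ k); [|lra].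
      apply Rmult_le_pos; [apply Rlt_le, Rinv_0_lt_compat, INR_fact_lt_0|apply pow_le; nra].
  - intros w _. set (s := (s0 + w)%C).
    pose proof (Cexp_series (- s * u)) as E. apply (Cconv_shift _ _ 4) in E.
    pose proof (Cconv_plus _ _ _ _ E (Cconv_const (- (1 - u * s + u ^ 2 / 2 * s ^ 2 - u ^ 3 / 6 * s ^ 3))%C)) as E2.
    apply (Cconv_scal (Cexp (- s * L))) in E2.
    eapply Cconv_ext; [|exact E2]. intros n. cbv beta.
    rewrite csum_add.
    assert (E4 : csum (fun m => / INR (fact m) * (- s * u) ^ m)%C 4
                 = (1 - u * s + u ^ 2 / 2 * s ^ 2 - u ^ 3 / 6 * s ^ 3)%C).
    { simpl csum. replace (1 + 1 + 1 + 1 + 1 + 1)%R with 6 by ring. replace (1 + 1)%R with 2 by ring.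
      simpl Cpow. field. }
    rewrite E4.
    match goal with |- (_ * (?c + ?b + - ?c))%C = _ => replace (c + b + - c)%C with b by ring end.
    rewrite <- csum_scal. apply csum_ext. intros j _. rewrite RtoC_mult, RtoC_pow, RtoC_inv by apply INR_fact_neq_0.
    rewrite RtoC_opp. replace (- s * u)%C with (- RtoC u * s)%C by ring. rewrite Cpow_mult_l. ring.
Qed.

(** Every summand is a scalar times s^j times a function of known bound, the only
    shape to which the rules for [wiener] apply. *)
Lemma em_term_decomp x s : 1 <= x ->
  let u := ln (x + 1) - ln x in
  let N := fun s : C => Cexp (- s * ln x) in
  let E := fun s : C => (Cexp (- s * ln x) * (Cexp (- s * u) - (1 - u * s + u ^ 2 / 2 * s ^ 2 - u ^ 3 / 6 * s ^ 3)))%C in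
  em_term x s =
   (RtoC (1 + / (12 * x * (x + 1)) - u * (x + 1/2)) * (s ^ 1 * N s) +
    (RtoC (- / (12 * x * (x + 1)) - u / 2 + u / (12 * (x + 1)) + u ^ 2 / 2 * (x + 1 / 2)) * (s ^ 2 * N s) +
    (RtoC (- u / (12 * (x + 1)) + u ^ 2 / 2 * (1 / 2 - / (12 * (x + 1))) - u ^ 3 / 6 * (x + 1 / 2)) * (s ^ 3 * N s) +
    (RtoC (u ^ 2 / (24 * (x + 1)) - u ^ 3 / 6 * (1 / 2 - / (12 * (x + 1)))) * (s ^ 4 * N s) +
    (RtoC (- u ^ 3 / (72 * (x + 1))) * (s ^ 5 * N s) +
    (RtoC (x + 1 / 2) * (s ^ 0 * E s) +
    (RtoC (1 / 2 - / (12 * (x + 1))) * (s ^ 1 * E s) +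
     RtoC (/ (12 * (x + 1))) * (s ^ 2 * E s))))))))%C.
Proof.
  intros Hx u N E. unfold em_term, em_tail, N, E.
  replace (Cexp (- s * ln (x + 1))) with (Cexp (- s * ln x) * Cexp (- s * u))%C
    by (rewrite <- Cexp_plus; f_equal; unfold u; rewrite RtoC_minus; ring).
  clearbody u.
  generalize (Cexp (- s * ln x)) (Cexp (- s * u)). intros n v.
  assert (Ex : RtoC x <> RtoC 0) by (intros H; injection H; lra).
  assert (Ex1 : (RtoC x + 1)%C <> RtoC 0) by (rewrite <- RtoC_plus; intros H; injection H; lra).
  unfold Rdiv.
  repeat first [rewrite RtoC_plus | rewrite RtoC_minus | rewrite RtoC_mult | rewrite RtoC_opp
    | rewrite RtoC_pow | rewrite RtoC_inv by nra].
  simpl Cpow. field.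
  repeat split; try easy; intros H; injection H; lra.
Qed.

Definition em_const (s0 : C) (r : R) : R :=
  let R := Cmod s0 + r in
  (R ^ 1 + R ^ 2 + R ^ 3 + R ^ 4 + R ^ 5) + (2 + R + R ^ 2) * (R ^ 4 * exp R).

Lemma em_term_wiener s0 r x : 0 < r -> 1 <= x ->
  wiener s0 r (em_const s0 r * / x ^ 3 * exp (- (Re s0 - r) * ln x)) (em_term x).
Proof.
  intros Hr Hx. set (u := ln (x + 1) - ln x). set (R := Cmod s0 + r).
  assert (HR : 0 <= R) by (unfold R; pose proof (Cmod_ge_0 s0); lra).
  set (K := exp (- (Re s0 - r) * ln x)). assert (HK : 0 < K) by apply exp_pos.
  assert (HL : 0 <= ln x) by (rewrite <- ln_1; apply ln_le; lra).
  destruct (ln_step_bounds x ltac:(lra)) as [Hu1 Hu2]. fold u in Hu1, Hu2.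
  assert (Hq : 0 < / (x + 1)) by (apply Rinv_0_lt_compat; lra).
  assert (Hv : 0 < / x) by (apply Rinv_0_lt_compat; lra).
  assert (Hv1 : / x <= 1) by (rewrite <- Rinv_1; apply Rinv_le_contravar; lra).
  destruct (em_coef_bounds x u Hx eq_refl) as [C1 [C2 [C3 [C4 C5]]]].
  pose proof (wiener_npow s0 r (ln x) Hr HL) as WN. fold K in WN.
  pose proof (wiener_exp_remainder s0 r (ln x) u Hr HL ltac:(lra)) as WE. fold K in WE. fold R in WE.
  set (v3 := / x ^ 3) in *.
  assert (Ev3 : v3 = (/ x) ^ 3) by (unfold v3; now rewrite pow_inv).
  assert (Hv3 : 0 < v3) by (rewrite Ev3; apply pow_lt; lra).
  set (NE := K * ((u * R) ^ 4 * exp (u * R))) in WE.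
  assert (HNE0 : 0 <= NE) by (unfold NE; repeat apply Rmult_le_pos; try apply pow_le; try apply Rlt_le, exp_pos; nra).
  assert (HNE : NE <= v3 * / x * (R ^ 4 * exp R) * K).
  { unfold NE. replace (v3 * / x * (R ^ 4 * exp R) * K) with (K * (((/ x) * R) ^ 4 * exp R)) by (rewrite Ev3; ring).
    apply Rmult_le_compat_l; [lra|]. apply Rmult_le_compat; [apply pow_le; nra|apply Rlt_le, exp_pos| |].
    - apply pow_incr. split; nra.
    - apply exp_monotone. nra. }
  eapply wiener_ext; [intros s; symmetry; apply (em_term_decomp x s Hx)|].
  fold u.
  assert (Hr' : 0 <= r) by lra.
  assert (step : forall c j, Rabs c <= v3 -> wiener s0 r (v3 * (R ^ j * K)) (fun s => RtoC c * (s ^ j * Cexp (- s * ln x)))%C).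
  { intros c j Hc. eapply wiener_le; [|apply wiener_scal, (wiener_pow _ _ _ _ j Hr' WN)].
    rewrite Cmod_R. fold R. apply Rmult_le_compat_r; [|easy]. apply Rmult_le_pos; [now apply pow_le|lra]. }
  assert (stepE : forall c j b, Rabs c <= b * x ->
     wiener s0 r (b * R ^ j * (v3 * (R ^ 4 * exp R) * K)) (fun s => RtoC c * (s ^ j * (Cexp (- s * ln x) *
       (Cexp (- s * u) - (1 - u * s + u ^ 2 / 2 * s ^ 2 - u ^ 3 / 6 * s ^ 3)))))%C).
  { intros c j b Hc. eapply wiener_le; [|apply wiener_scal, (wiener_pow _ _ _ _ j Hr' WE)].
    rewrite Cmod_R. fold R.
    assert (Hj : 0 <= R ^ j) by now apply pow_le.
    apply Rle_trans with (b * x * (R ^ j * (v3 * / x * (R ^ 4 * exp R) * K))).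
    - apply Rmult_le_compat; [apply Rabs_pos|now apply Rmult_le_pos|easy|]. now apply Rmult_le_compat_l.
    - right. field. lra. }
  eapply wiener_le; [|
    apply wiener_plus; [easy|apply (step _ 1%nat C1)|];
    apply wiener_plus; [easy|apply (step _ 2%nat C2)|];
    apply wiener_plus; [easy|apply (step _ 3%nat C3)|];
    apply wiener_plus; [easy|apply (step _ 4%nat C4)|];
    apply wiener_plus; [easy|apply (step _ 5%nat C5)|];
    apply wiener_plus; [easy|apply (stepE _ 0%nat 2)|];
    [|apply wiener_plus; [easy|apply (stepE _ 1%nat 1)|apply (stepE _ 2%nat 1)]]].
  - unfold em_const. fold R. simpl. right. ring.
  - apply Rabs_le. lra.
  - replace (/ (12 * (x + 1))) with (/ (x + 1) / 12) by (field; lra). apply Rabs_le. lra.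
  - replace (/ (12 * (x + 1))) with (/ (x + 1) / 12) by (field; lra). apply Rabs_le. lra.
Qed.

(** * Analytic continuation of zeta to a neighbourhood of -1 *)

(** The terms are n^(-3/2), and 2/sqrt n - 2/sqrt (n+1) >= (n+1)^(-3/2), whence
    the partial sums are at most 3 - 2/sqrt n. *)
Lemma rsum_three_halves n : rsum (fun k => exp (- (3 / 2) * ln (INR (S k)))) n <= 3.
Proof.
  assert (E : forall x, 0 < x -> exp (- (3 / 2) * ln x) = / (x * sqrt x)).
  { intros x Hx. rewrite <- Rpower_sqrt by easy. unfold Rpower.
    rewrite <- (exp_ln x) at 2 by easy. rewrite <- exp_plus, <- exp_Ropp. f_equal. field. }
  assert (P : forall n, rsum (fun k => exp (- (3 / 2) * ln (INR (S k)))) (S n) <= 3 - 2 / sqrt (INR (S n))).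
  { clear n. induction n as [|n IH].
    - simpl. rewrite ln_1, Rmult_0_r, exp_0, sqrt_1. lra.
    - change (rsum (fun k => exp (- (3 / 2) * ln (INR (S k)))) (S (S n))) with
        (rsum (fun k => exp (- (3 / 2) * ln (INR (S k)))) (S n) + exp (- (3 / 2) * ln (INR (S (S n))))).
      rewrite E by apply INR_S_pos.
      pose proof (INR_S_pos n) as Hn. rewrite (S_INR (S n)).
      set (a := sqrt (INR (S n))) in *. set (b := sqrt (INR (S n) + 1)).
      assert (Ha : 0 < a) by now apply sqrt_lt_R0.
      assert (Ea : a * a = INR (S n)) by (apply sqrt_sqrt; lra).
      assert (Eb : b * b = INR (S n) + 1) by (apply sqrt_sqrt; lra).
      assert (Hb : 0 < b) by (apply sqrt_lt_R0; lra).
      rewrite <- Eb.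
      assert (Hab : a <= b) by (apply sqrt_le_1; lra).
      assert (H1 : (b - a) * (b + a) = 1) by nra.
      enough (/ (b * b * b) <= 2 / a - 2 / b) by lra.
      replace (2 / a - 2 / b) with (2 * (b - a) * b * b * / a * / (b * b * b)) by (field; lra).
      rewrite <- (Rmult_1_l (/ (b * b * b))) at 1.
      apply Rmult_le_compat_r; [apply Rlt_le, Rinv_0_lt_compat; nra|].
      apply Rmult_le_reg_r with a; [easy|]. replace (2 * (b - a) * b * b * / a * a) with (2 * (b - a) * b * b) by (field; lra).
      assert (1 <= (b - a) * (2 * b)) by nra. nra. }
  destruct n as [|n]; [simpl; lra|]. eapply Rle_trans; [apply P|].
  assert (0 < 2 / sqrt (INR (S n))); [|lra].
  apply Rdiv_lt_0_compat; [lra|apply sqrt_lt_R0, INR_S_pos].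
Qed.

Lemma wiener_value s0 r M f w : wiener s0 r M f -> Cmod w <= r -> Cmod (f (s0 + w)%C) <= M.
Proof.
  intros [a [H1 H2]] Hw. apply (Cconv_bound_loc _ _ M O (H2 w Hw)).
  intros n _. eapply Rle_trans; [apply Cmod_csum|]. eapply Rle_trans; [|apply (H1 n)].
  apply rsum_le. intros k _. rewrite Cmod_mult, Cmod_pow.
  apply Rmult_le_compat_l; [apply Cmod_ge_0|]. apply pow_incr; split; [apply Cmod_ge_0|easy].
Qed.

(** On discs of radius 1/2 around points with Re s0 >= -1 one has Re s >= -3/2,
    so that the order x^(-s-3) becomes x^(-3/2), which is summable. *)
Definition em_bound (s0 : C) (k : nat) : R :=
  em_const s0 (1 / 2) * exp (- (3 / 2) * ln (INR (S k))).

Lemma em_const_pos s0 r : 0 < r -> 0 <= em_const s0 r.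
Proof.
  intros Hr. unfold em_const. pose proof (Cmod_ge_0 s0). pose proof (exp_pos (Cmod s0 + r)).
  assert (HR : 0 <= Cmod s0 + r) by lra. set (R := Cmod s0 + r) in *.
  assert (forall n, 0 <= R ^ n) by (intros; now apply pow_le).
  pose proof (H1 1%nat). pose proof (H1 2%nat). pose proof (H1 3%nat). pose proof (H1 4%nat). pose proof (H1 5%nat).
  apply Rplus_le_le_0_compat; [lra|]. apply Rmult_le_pos; [lra|]. apply Rmult_le_pos; lra.
Qed.

Lemma em_term_wiener_half s0 k : -1 <= Re s0 -> wiener s0 (1 / 2) (em_bound s0 k) (em_term (INR (S k))).
Proof.
  intros Hs. eapply wiener_le; [|apply em_term_wiener; [lra|apply INR_S_ge1]].
  unfold em_bound. rewrite Rmult_assoc. apply Rmult_le_compat_l; [apply em_const_pos; lra|].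
  pose proof (INR_S_ge1 k) as Hx. set (x := INR (S k)) in *.
  assert (HL : 0 <= ln x) by (rewrite <- ln_1; apply ln_le; lra).
  replace (/ x ^ 3) with (exp (- 3 * ln x)).
  - rewrite <- exp_plus. apply exp_monotone. nra.
  - rewrite <- (exp_ln x) at 2 by lra. simpl. rewrite Rmult_1_r, <- !exp_plus, <- exp_Ropp. f_equal. ring.
Qed.

Lemma em_bound_sum s0 n : rsum (em_bound s0) n <= em_const s0 (1 / 2) * 3.
Proof.
  unfold em_bound. rewrite rsum_scal. apply Rmult_le_compat_l; [apply em_const_pos; lra|apply rsum_three_halves].
Qed.

Definition em_rest (s : C) : C :=
  (Series (fun k => Re (em_term (INR (S k)) s)), Series (fun k => Im (em_term (INR (S k)) s))).

(** The continuation of (s - 1) zeta(s) to Re s >= -1. *)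
Definition zeta_pole_free (s : C) : C := (em_tail 1 s + em_rest s)%C.

Lemma em_rest_conv s0 w : -1 <= Re s0 -> Cmod w <= 1 / 2 ->
  Cconv (csum (fun k => em_term (INR (S k)) (s0 + w)%C)) (em_rest (s0 + w)%C).
Proof.
  intros Hs Hw. unfold em_rest.
  apply (csum_abs_conv (fun k => em_term (INR (S k)) (s0 + w)%C) (em_const s0 (1 / 2) * 3)).
  intros n. eapply Rle_trans; [|apply (em_bound_sum s0 n)].
  apply rsum_le. intros k _. apply wiener_value with (1 / 2); [now apply em_term_wiener_half|easy].
Qed.

Lemma analytic_const c z0 : analytic_at (fun _ => c) z0.
Proof.
  apply analytic_at_alt. exists (fun k => match k with O => c | _ => RtoC 0 end), 1. split; [lra|].
  intros w _. apply Cconv_incr. apply Cconv_ext with (fun _ => c); [|apply Cconv_const].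
  intros n. rewrite csum_S_l. rewrite (csum_ext _ (fun _ => RtoC 0 * RtoC 0)%C) by (intros; ring).
  rewrite csum_scal. simpl. ring.
Qed.

Lemma zeta_pole_free_analytic s0 : -1 <= Re s0 -> analytic_at zeta_pole_free s0.
Proof.
  intros Hs. apply analytic_plus.
  - assert (X : analytic_at (fun s => s * 1)%C s0) by (apply analytic_mulX, analytic_const).
    apply analytic_ext with (fun s => RtoC (1 / 2) + (RtoC (5 / 12) * (s * 1) + RtoC (1 / 12) * (s * (s * 1))))%C.
    + intros s. unfold em_tail. rewrite ln_1.
      replace (- s * 0)%C with (RtoC 0) by ring. rewrite Cexp_0. rewrite !RtoC_div by lra. field.
    + apply analytic_plus; [apply analytic_const|].
      apply analytic_plus; apply analytic_scal; [easy|now apply analytic_mulX].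
  - apply (wiener_analytic s0 (1 / 2) (em_const s0 (1 / 2) * 3)); [lra|].
    apply wiener_sum with (em_bound s0) (fun k => em_term (INR (S k))); [lra| |apply em_bound_sum|].
    + intros k. now apply em_term_wiener_half.
    + intros w Hw. now apply em_rest_conv.
Qed.

Lemma csum_em_term s n :
  csum (fun k => em_term (INR (S k)) s) n =
  ((s - 1) * csum (fun k => Cexp (- s * ln (INR (S k)))) n - em_tail 1 s + em_tail (INR (S n)) s)%C.
Proof.
  induction n as [|n IH].
  - change (INR 1) with 1. simpl csum. ring.
  - rewrite !csum_Sn, IH. unfold em_term. rewrite <- (S_INR (S n)). ring.
Qed.

Lemma em_tail_vanishes s : 2 <= Re s -> Cconv (fun n => em_tail (INR (S n)) s) 0.
Proof.
  intros Hs. set (c := 1 + (Cmod s + 1) + (Cmod s * Cmod s + Cmod s)).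
  apply Cconv_squeeze with (fun n => c * / INR (S n)).
  - intros n. pose proof (INR_S_ge1 n) as Hx. set (x := INR (S n)) in *.
    replace (em_tail x s - 0)%C with (em_tail x s) by ring. unfold em_tail.
    assert (HL : 0 <= ln x) by (rewrite <- ln_1; apply ln_le; lra).
    rewrite Cmod_mult, Cmod_Cexp.
    replace (Re (- s * ln x)) with (- Re s * ln x) by (destruct s; unfold Cmult, Re; simpl; ring).
    assert (H1 : exp (- Re s * ln x) <= / x * / x).
    { replace (/ x * / x) with (exp (- 2 * ln x)).
      - apply exp_monotone. nra.
      - rewrite <- (exp_ln x) at 2 3 by lra. rewrite <- !exp_Ropp, <- exp_plus. f_equal. ring. }
    assert (H2 : Cmod (x + (s - 1) / 2 + (s * s - s) / (12 * x)) <= c * x).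
    { pose proof (Cmod_ge_0 s) as Hm.
      assert (T1 : Cmod (s - 1) <= Cmod s + 1).
      { eapply Rle_trans; [apply Cmod_triangle|]. rewrite Cmod_opp, Cmod_1. lra. }
      assert (T2 : Cmod (s * s - s) <= Cmod s * Cmod s + Cmod s).
      { eapply Rle_trans; [apply Cmod_triangle|]. rewrite Cmod_opp, Cmod_mult. lra. }
      eapply Rle_trans; [apply Cmod_triangle|].
      eapply Rle_trans; [apply Rplus_le_compat_r, Cmod_triangle|].
      rewrite <- RtoC_mult, !Cmod_div, !Cmod_R, !Rabs_pos_eq by (try lra; intros E; injection E; lra).
      assert (T3 : Cmod (s - 1) / 2 <= (Cmod s + 1) * x).
      { pose proof (Cmod_ge_0 (s - 1)). nra. }
      assert (T4 : Cmod (s * s - s) / (12 * x) <= (Cmod s * Cmod s + Cmod s) * x).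
      { apply Rle_div_l; [lra|]. pose proof (Cmod_ge_0 (s * s - s)).
        assert (0 <= Cmod s * Cmod s) by nra. assert (1 <= x * (12 * x)) by nra. nra. }
      unfold c. lra. }
    apply Rle_trans with (c * x * (/ x * / x)).
    + apply Rmult_le_compat; [apply Cmod_ge_0|apply Rlt_le, exp_pos|easy|easy].
    + right. field. lra.
  - replace 0 with (c * 0) by ring. apply (is_lim_seq_scal_l _ c 0).
    apply (is_lim_seq_incr_1 (fun n => / INR n)).
    apply (is_lim_seq_inv _ p_infty); [apply is_lim_seq_INR|easy].
Qed.

(** The two functions agree for Re s >= 2, where the tail at n tends to 0.  As
    nothing is known about zeta at 1, analyticity leads from 3 to -1 around that
    point: along 3, 3 + 2i, -1 + 2i, -1. *)
Lemma zeta_continuation zeta : is_riemann_zeta zeta ->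
  locally_zero (fun s => (s - 1) * zeta s + - (1) * zeta_pole_free s)%C (RtoC (-1)).
Proof.
  intros [Hd Ha]. set (h := fun s => ((s - 1) * zeta s + - (1) * zeta_pole_free s)%C).
  assert (Hh : forall s, s <> RtoC 1 -> -1 <= Re s -> analytic_at h s).
  { intros s Hs1 Hs2. apply analytic_plus; [|now apply analytic_scal, zeta_pole_free_analytic].
    apply analytic_ext with (fun s => s * zeta s + - (1) * zeta s)%C; [intros; ring|].
    apply analytic_plus; [apply analytic_mulX|apply analytic_scal]; now apply Ha. }
  assert (H0 : locally_zero h (RtoC 3)).
  { exists (1 / 2). split; [lra|]. intros w Hw.
    assert (Hs : 2 <= Re (3 + w)%C).
    { pose proof (re_le_Cmod w) as T. apply Rabs_le_between in T. destruct w as [a b]. simpl in *. lra. }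
    set (s := (3 + w)%C) in *.
    assert (E1 : Cconv (csum (fun k => em_term (INR (S k)) s)) (em_rest s)) by (apply em_rest_conv; simpl; lra).
    assert (E2 : Cconv (csum (fun k => em_term (INR (S k)) s)) ((s - 1) * zeta s + (- em_tail 1 s + 0))%C).
    { apply Cconv_ext with (fun n => (s - 1) * csum (fun k => Cexp (- s * ln (INR (S k)))) n +
        (- em_tail 1 s + em_tail (INR (S n)) s))%C.
      - intros n. rewrite csum_em_term. ring.
      - apply Cconv_plus; [apply Cconv_scal, is_series_csum, Hd; lra|].
        apply Cconv_plus; [apply Cconv_const|now apply em_tail_vanishes]. }
    pose proof (Cconv_unique _ _ _ E1 E2) as E.
    unfold h, zeta_pole_free. rewrite E. ring. }
  assert (H1 : locally_zero h (3 + (0, 2))%C).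
  { apply identity_segment; [intros E; injection E; lra| |easy].
    intros t Ht. apply Hh; [|simpl; lra]. intros E. unfold Cplus, Cmult, RtoC in E; simpl in E. injection E; lra. }
  assert (H2 : locally_zero h (3 + (0, 2) + RtoC (-4))%C).
  { apply identity_segment; [intros E; injection E; lra| |easy].
    intros t Ht. apply Hh; [|simpl; lra]. intros E. unfold Cplus, Cmult, RtoC in E; simpl in E. injection E; lra. }
  assert (H3 : locally_zero h (3 + (0, 2) + RtoC (-4) + (0, -2))%C).
  { apply identity_segment; [intros E; injection E; lra| |easy].
    intros t Ht. apply Hh; [|simpl; lra]. intros E. unfold Cplus, Cmult, RtoC in E; simpl in E. injection E; lra. }
  replace (RtoC (-1)) with (3 + (0, 2) + RtoC (-4) + (0, -2))%C; [easy|].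
  unfold Cplus, RtoC; simpl. f_equal; ring.
Qed.

(** * The derivative of zeta at -1 and the hyperfactorial *)

Definition emr_tail (x s : R) : R := (x + (s - 1) / 2 + (s * s - s) / (12 * x)) * exp (- s * ln x).
Definition emr_term (x s : R) : R := (s - 1) * exp (- s * ln x) - emr_tail x s + emr_tail (x + 1) s.

Lemma em_tail_R x s : 0 < x -> em_tail x (RtoC s) = RtoC (emr_tail x s).
Proof.
  intros Hx. unfold em_tail, emr_tail.
  rewrite <- RtoC_opp, <- (RtoC_mult (- s)), Cexp_R.
  rewrite !RtoC_mult, !RtoC_plus, !RtoC_div by lra. now rewrite !RtoC_minus, !RtoC_mult.
Qed.

Lemma em_term_R x s : 0 < x -> em_term x (RtoC s) = RtoC (emr_term x s).
Proof.
  intros Hx. unfold em_term, emr_term.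
  rewrite !em_tail_R, <- RtoC_opp, <- (RtoC_mult (- s)), Cexp_R by lra.
  now rewrite RtoC_plus, !RtoC_minus, RtoC_mult, RtoC_minus.
Qed.

(** The derivative of [emr_tail x] at s = -1. *)
Definition em_slope (x : R) : R := x / 2 - 1 / 4 - ln x * (x ^ 2 - x + 1 / 6).

Lemma exp_ln_neg1 x : 0 < x -> exp (- -1 * ln x) = x.
Proof. intros Hx. replace (- -1 * ln x) with (ln x) by ring. now apply exp_ln. Qed.

Lemma emr_tail_derive x : 0 < x -> is_derive (emr_tail x) (-1) (em_slope x).
Proof.
  intros Hx. unfold emr_tail, em_slope. auto_derive; [easy|].
  rewrite exp_ln_neg1 by easy. field. lra.
Qed.

Lemma emr_term_derive x : 0 < x ->
  is_derive (emr_term x) (-1) (x + 2 * (x * ln x) - em_slope x + em_slope (x + 1)).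
Proof.
  intros Hx. unfold emr_term.
  apply (is_derive_plus (fun s => (s - 1) * exp (- s * ln x) - emr_tail x s) (emr_tail (x + 1)));
    [|apply emr_tail_derive; lra].
  apply (is_derive_minus (fun s => (s - 1) * exp (- s * ln x)) (emr_tail x)); [|now apply emr_tail_derive].
  auto_derive; [easy|]. rewrite exp_ln_neg1 by easy. ring.
Qed.

Lemma emr_term_neg1 x : 0 < x -> emr_term x (-1) = 0.
Proof. intros Hx. unfold emr_term, emr_tail. rewrite !exp_ln_neg1 by lra. field. lra. Qed.

Lemma is_derive_quadratic (g : R -> R) (x l K r : R) : 0 < r ->
  (forall t, Rabs t <= r -> Rabs (g (x + t) - g x - l * t) <= K * t ^ 2) -> is_derive g x l.
Proof.
  intros Hr H. apply is_derive_Reals. intros eps He.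
  assert (HK : 0 <= K).
  { specialize (H r). rewrite Rabs_pos_eq in H by lra. specialize (H (Rle_refl r)).
    pose proof (Rabs_pos (g (x + r) - g x - l * r)). assert (0 < r ^ 2) by (apply pow_lt; lra). nra. }
  assert (Hd : 0 < Rmin r (eps / (K + 1))) by (apply Rmin_case; [easy|apply Rdiv_lt_0_compat; lra]).
  exists (mkposreal _ Hd). intros h Hh0 Hh. simpl in Hh.
  pose proof (Rmin_l r (eps / (K + 1))). pose proof (Rmin_r r (eps / (K + 1))).
  assert (Hhe : Rabs h * (K + 1) < eps) by (apply Rlt_div_r; lra).
  specialize (H h ltac:(lra)).
  replace ((g (x + h) - g x) / h - l) with ((g (x + h) - g x - l * h) / h) by (field; easy).
  assert (Hh1 : 0 < Rabs h) by now apply Rabs_pos_lt.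
  unfold Rdiv. rewrite Rabs_mult, Rabs_inv.
  apply (Rmult_lt_reg_r (Rabs h)); [easy|].
  rewrite Rmult_assoc, Rinv_l, Rmult_1_r by lra.
  rewrite <- pow2_abs in H. nra.
Qed.

(** A power series with sum |a_m| r^m <= M differs from its linear part by at most
    M |t|^2 / r^2.  Since these errors add up, they allow termwise
    differentiation of a series of such functions. *)
Lemma wiener_real_quadratic s0 r M f (g : R -> R) (l : R) : 0 < r -> wiener (RtoC s0) r M f ->
  (forall t, f (RtoC t) = RtoC (g t)) -> is_derive g s0 l ->
  Rabs l <= M / r /\
  forall t, Rabs t <= r -> Rabs (g (s0 + t) - g s0 - l * t) <= M / r ^ 2 * t ^ 2.
Proof.
  intros Hr [a [Ha1 Ha2]] Hg Hl.
  assert (Hr2 : 0 < r ^ 2) by now apply pow_lt.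
  assert (Q : forall t, Rabs t <= r -> Rabs (g (s0 + t) - Re (a 0%nat) - Re (a 1%nat) * t) <= M / r ^ 2 * t ^ 2).
  { intros t Ht. specialize (Ha2 (RtoC t)). rewrite Cmod_R in Ha2. specialize (Ha2 Ht).
    rewrite <- RtoC_plus, Hg in Ha2.
    assert (C2 : Cconv (fun n => csum (fun m => a m * t ^ m)%C (2 + n) + - (a 0%nat + a 1%nat * t))%C
             (RtoC (g (s0 + t)%R) + - (a 0%nat + a 1%nat * t))%C).
    { apply Cconv_plus; [|apply Cconv_const]. now apply (Cconv_shift (csum (fun m => a m * t ^ m)%C)). }
    apply (Cconv_bound_loc _ _ (M / r ^ 2 * t ^ 2) O) in C2.
    - eapply Rle_trans; [|apply C2]. eapply Rle_trans; [|apply re_le_Cmod].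
      right. f_equal. destruct (a 0%nat), (a 1%nat). unfold Re, Cplus, Cmult, Copp, RtoC; simpl. ring.
    - intros n _. rewrite csum_add.
      replace (csum (fun m => a m * t ^ m)%C 2) with (a 0%nat + a 1%nat * t)%C by (simpl; ring).
      match goal with |- Cmod (?u + ?v + - ?u) <= _ => replace (u + v + - u)%C with v by ring end.
      eapply Rle_trans; [apply Cmod_csum|].
      apply Rle_trans with (t ^ 2 / r ^ 2 * rsum (fun m => Cmod (a m) * r ^ m) (2 + n)).
      + rewrite rsum_add. rewrite Rmult_plus_distr_l.
        assert (P0 : 0 <= t ^ 2 / r ^ 2) by (apply Rdiv_le_0_compat; [apply pow2_ge_0|easy]).
        assert (P1 : 0 <= rsum (fun m => Cmod (a m) * r ^ m) 2)
          by (apply rsum_pos; intros; apply Rmult_le_pos; [apply Cmod_ge_0|apply pow_le; lra]).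
        assert (0 <= t ^ 2 / r ^ 2 * rsum (fun m => Cmod (a m) * r ^ m) 2) by now apply Rmult_le_pos.
        match goal with |- _ <= _ + ?b => enough (rsum (fun k => Cmod (a (2 + k)%nat * t ^ (2 + k)%nat)) n <= b) by lra end.
        rewrite <- rsum_scal. apply rsum_le. intros k _.
        rewrite Cmod_mult, Cmod_pow, Cmod_R, !pow_add, pow2_abs.
        replace (t ^ 2 / r ^ 2 * (Cmod (a (2 + k)%nat) * (r ^ 2 * r ^ k))) with
          (Cmod (a (2 + k)%nat) * (t ^ 2 * r ^ k)) by (field; lra).
        apply Rmult_le_compat_l; [apply Cmod_ge_0|]. apply Rmult_le_compat_l; [apply pow2_ge_0|].
        apply pow_incr. split; [apply Rabs_pos|easy].
      + replace (M / r ^ 2 * t ^ 2) with (t ^ 2 / r ^ 2 * M) by (field; lra).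
        apply Rmult_le_compat_l; [apply Rdiv_le_0_compat; [apply pow2_ge_0|easy]|apply Ha1]. }
  assert (E0 : g s0 = Re (a 0%nat)).
  { specialize (Q 0). rewrite Rabs_R0 in Q. specialize (Q ltac:(lra)).
    rewrite Rplus_0_r, Rmult_0_r in Q. apply Rabs_le_between in Q. lra. }
  assert (D : is_derive g s0 (Re (a 1%nat))).
  { apply is_derive_quadratic with (M / r ^ 2) r; [easy|]. intros t Ht. rewrite E0. now apply Q. }
  apply is_derive_unique in D. apply is_derive_unique in Hl. rewrite Hl in D. subst l.
  split; [|intros t Ht; rewrite E0, D; now apply Q].
  apply Rle_div_r; [easy|]. eapply Rle_trans; [|apply (Ha1 2%nat)]. simpl.
  pose proof (Cmod_ge_0 (a 0%nat)). pose proof (re_le_Cmod (a 1%nat)).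
  rewrite D. nra.
Qed.

(** The logarithm of the hyperfactorial, the product of the k^k. *)
Definition hyperlog (n : nat) : R := rsum (fun k => INR (S k) * ln (INR (S k))) n.

Definition em_slope_term (k : nat) : R :=
  let x := INR (S k) in x + 2 * (x * ln x) - em_slope x + em_slope (x + 1).

Lemma rsum_em_slope n : rsum em_slope_term n =
  INR n * (INR n + 1) / 2 + 2 * hyperlog n - em_slope 1 + em_slope (INR (S n)).
Proof.
  unfold hyperlog. induction n as [|n IH].
  - simpl. field.
  - change (rsum em_slope_term (S n)) with (rsum em_slope_term n + em_slope_term n).
    rewrite IH. unfold em_slope_term.
    change (rsum (fun k => INR (S k) * ln (INR (S k))) (S n)) with
      (rsum (fun k => INR (S k) * ln (INR (S k))) n + INR (S n) * ln (INR (S n))).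
    rewrite <- (S_INR (S n)), (S_INR n). rewrite ?(S_INR (S n)), ?(S_INR n). field.
Qed.

(** At s = -1 the Euler-Maclaurin approximation is exact, every term of the sum
    vanishes, and the value is that of the tail at 1, namely 1/6, in accordance
    with zeta(-1) = -1/12. *)
Lemma zeta_pole_free_derive :
  ex_series em_slope_term /\
  is_derive (fun x : R => Re (zeta_pole_free x)) (-1) (em_slope 1 + Series em_slope_term) /\
  Re (zeta_pole_free (-1)) = 1 / 6.
Proof.
  set (M := em_bound (RtoC (-1))).
  assert (H : forall k, Rabs (em_slope_term k) <= M k / (1 / 2) /\ forall t, Rabs t <= 1 / 2 ->
    Rabs (emr_term (INR (S k)) (-1 + t) - emr_term (INR (S k)) (-1) - em_slope_term k * t) <= M k / (1 / 2) ^ 2 * t ^ 2).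
  { intros k. apply wiener_real_quadratic with (em_term (INR (S k))); [lra| | |].
    - apply em_term_wiener_half. simpl; lra.
    - intros t. apply em_term_R, INR_S_pos.
    - apply emr_term_derive, INR_S_pos. }
  assert (X : ex_series em_slope_term).
  { apply (abs_bounded_ex_series _ (2 * (em_const (-1) (1 / 2) * 3))). intros n.
    apply Rle_trans with (rsum (fun k => 2 * M k) n).
    - apply rsum_le. intros k _. destruct (H k) as [H1 _]. lra.
    - rewrite rsum_scal. apply Rmult_le_compat_l; [lra|apply em_bound_sum]. }
  assert (Lim : forall t, Rabs t <= 1 / 2 ->
     is_lim_seq (rsum (fun k => emr_term (INR (S k)) (-1 + t))) (Re (em_rest (RtoC (-1 + t))))).
  { intros t Ht. rewrite RtoC_plus.
    assert (Ht' : Cmod t <= 1 / 2) by now rewrite Cmod_R.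
    pose proof (em_rest_conv (RtoC (-1)) t ltac:(simpl; lra) Ht') as C1.
    apply Cconv_Re in C1. eapply is_lim_seq_ext; [|exact C1].
    intros n. cbv beta. rewrite Re_csum. apply rsum_ext. intros k _.
    rewrite <- RtoC_plus, em_term_R by apply INR_S_pos. easy. }
  assert (Z0 : Re (em_rest (RtoC (-1))) = 0).
  { specialize (Lim 0). rewrite Rabs_R0, Rplus_0_r in Lim. specialize (Lim ltac:(lra)).
    assert (L0 : is_lim_seq (rsum (fun k => emr_term (INR (S k)) (-1))) 0).
    { apply is_lim_seq_ext with (fun _ => 0); [|apply is_lim_seq_const].
      intros n. rewrite (rsum_ext _ (fun _ => 0 * 0)).
      - rewrite rsum_scal. ring.
      - intros k _. rewrite emr_term_neg1 by apply INR_S_pos. ring. }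
    apply is_lim_seq_unique in Lim. apply is_lim_seq_unique in L0. rewrite Lim in L0. now injection L0. }
  assert (T1 : forall x : R, Re (zeta_pole_free x) = emr_tail 1 x + Re (em_rest x)).
  { intros x. unfold zeta_pole_free. rewrite em_tail_R by lra. easy. }
  split; [easy|]. split.
  - apply is_derive_ext with (fun x : R => emr_tail 1 x + Re (em_rest x)); [intros; now rewrite T1|].
    apply (is_derive_plus (emr_tail 1) (fun x : R => Re (em_rest x))); [apply emr_tail_derive; lra|].
    apply is_derive_quadratic with (em_const (-1) (1 / 2) * 3 * 4) (1 / 2); [lra|].
    intros t Ht. rewrite Z0.
    assert (L1 : is_lim_seq (fun n => Rabs (rsum (fun k => emr_term (INR (S k)) (-1 + t)) n - 0 - rsum em_slope_term n * t))
       (Rabs (Re (em_rest (-1 + t)%R) - 0 - Series em_slope_term * t))).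
    { apply (is_lim_seq_abs _ (Finite (_ - 0 - _))). apply is_lim_seq_minus'.
      - apply is_lim_seq_minus'; [now apply Lim|apply is_lim_seq_const].
      - apply (is_lim_seq_scal_r _ t (Finite _)). now apply is_series_rsum, Series_correct. }
    refine (is_lim_seq_le _ _ _ (Finite _) _ L1 (is_lim_seq_const _)).
    intros n.
    apply Rle_trans with (rsum (fun k => M k / (1 / 2) ^ 2 * t ^ 2) n).
    + clear L1. induction n as [|n IH]; simpl rsum.
      * rewrite Rmult_0_l, !Rminus_0_r, Rabs_R0. lra.
      * destruct (H n) as [_ H2]. specialize (H2 t Ht). rewrite emr_term_neg1 in H2 by apply INR_S_pos.
        match goal with |- Rabs (?a + ?b - 0 - (?c + ?d) * t) <= _ =>
          replace (a + b - 0 - (c + d) * t) with ((a - 0 - c * t) + (b - 0 - d * t)) by ring end.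
        eapply Rle_trans; [apply Rabs_triang|]. now apply Rplus_le_compat.
    + rewrite (rsum_ext _ (fun k => (4 * t ^ 2) * M k)) by (intros; field).
      rewrite rsum_scal. pose proof (em_bound_sum (RtoC (-1)) n) as B. fold M in B.
      replace (em_const (-1) (1 / 2) * 3 * 4 * t ^ 2) with (4 * t ^ 2 * (em_const (-1) (1 / 2) * 3)) by ring.
      apply Rmult_le_compat_l; [|easy]. pose proof (pow2_ge_0 t). lra.
  - rewrite T1, Z0. unfold emr_tail. rewrite exp_ln_neg1 by lra. field.
Qed.

(** The derivative is a limit along the real axis, where zeta(x) = Z(x)/(x - 1);
    the quotient rule applies with Z(-1) = 1/6. *)
Lemma zeta_derive_neg1 zeta : is_riemann_zeta zeta ->
  Re (C_derive zeta (RtoC (-1))) = - (em_slope 1 + Series em_slope_term) / 2 - 1 / 24.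
Proof.
  intros Hz. destruct (zeta_continuation zeta Hz) as [r [Hr H]].
  destruct zeta_pole_free_derive as [_ [D V]].
  set (g := fun x : R => Re (zeta_pole_free x) / (x - 1)).
  assert (E : forall x : R, Rabs (x + 1) < Rmin r 1 -> Re (zeta x) = g x).
  { intros x Hx. pose proof (Rmin_l r 1). pose proof (Rmin_r r 1).
    specialize (H (RtoC (x + 1))). rewrite Cmod_R in H. specialize (H ltac:(lra)).
    rewrite <- RtoC_plus in H. replace (-1 + (x + 1)) with x in H by ring.
    apply (f_equal Re) in H. unfold g.
    assert (Hx1 : x - 1 <> 0) by (apply Rabs_lt_between in Hx; lra).
    apply Rmult_eq_reg_r with (x - 1); [|easy].
    unfold Rdiv. rewrite Rmult_assoc, Rinv_l, Rmult_1_r by easy.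
    destruct (zeta x) as [a b]. destruct (zeta_pole_free x) as [c d].
    unfold Re, Cplus, Cmult, Cminus, Copp, RtoC in *; simpl in *. lra. }
  assert (Dg : is_derive g (-1) (- (em_slope 1 + Series em_slope_term) / 2 - 1 / 24)).
  { unfold g. evar_last.
    - apply (is_derive_div (fun x : R => Re (zeta_pole_free x)) (fun x => x - 1)); [exact D| |lra].
      auto_derive; easy.
    - rewrite V. unfold one; simpl. field. }
  assert (L : is_lim (fun x : R => fst ((zeta (x, 0) - zeta (RtoC (-1))) / ((x, 0) - RtoC (-1)))%C) (-1)
                (- (em_slope 1 + Series em_slope_term) / 2 - 1 / 24)).
  { apply is_derive_Reals in Dg. apply is_lim_spec. intros eps.
    destruct (Dg eps (cond_pos eps)) as [d Hd].
    assert (Hm : 0 < Rmin d (Rmin r 1)) by (apply Rmin_case; [apply cond_pos|apply Rmin_case; lra]).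
    exists (mkposreal _ Hm). refine (fun (x : R) Hx Hx1 => _).
    change (Rabs (x - -1) < Rmin d (Rmin r 1)) in Hx.
    replace (x - -1) with (x + 1) in Hx by ring.
    pose proof (Rmin_l d (Rmin r 1)). pose proof (Rmin_r d (Rmin r 1)).
    specialize (Hd (x + 1) ltac:(lra) ltac:(lra)).
    replace (-1 + (x + 1)) with x in Hd by ring.
    rewrite <- (E x), <- (E (-1)) in Hd by (try lra; replace (-1 + 1) with 0 by ring; rewrite Rabs_R0;
      apply Rmin_case; lra).
    replace (fst ((zeta (x, 0) - zeta (RtoC (-1))) / ((x, 0) - RtoC (-1)))%C) with
      ((Re (zeta x) - Re (zeta (-1))) / (x + 1)); [exact Hd|].
    change (x, 0) with (RtoC x). rewrite <- RtoC_minus.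
    replace (x - -1) with (x + 1) by ring.
    destruct (zeta x) as [a b]. destruct (zeta (-1)) as [a' b'].
    unfold Cdiv. rewrite <- RtoC_inv by lra. simpl. field. lra. }
  unfold C_derive, C_lim. simpl. apply is_lim_unique in L. simpl in L. rewrite L. easy.
Qed.

(** By [rsum_em_slope] the partial sums of the series for Z'(-1) are
    2 H(n) + n (n+1)/2 plus the slope of the tail at n + 1, up to a constant. *)
Lemma hyperlog_limit zeta : is_riemann_zeta zeta ->
  is_lim_seq (fun n => hyperlog n - (INR n ^ 2 / 2 + INR n / 2 + 1 / 12) * ln (INR n) + INR n ^ 2 / 4)
    (ln (glaisher zeta)).
Proof.
  intros Hz. apply is_lim_seq_incr_1. unfold glaisher. rewrite ln_exp, zeta_derive_neg1 by easy.
  destruct zeta_pole_free_derive as [X _]. apply Series_correct, is_series_rsum in X.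
  apply is_lim_seq_ext with (fun n => 1 / 8 + (em_slope 1 + rsum em_slope_term n) / 2).
  - intros n. rewrite rsum_em_slope.
    change (hyperlog (S n)) with (hyperlog n + INR (S n) * ln (INR (S n))).
    unfold em_slope. rewrite ln_1, !S_INR. field.
  - replace (1 / 12 - (- (em_slope 1 + Series em_slope_term) / 2 - 1 / 24)) with
      (1 / 8 + (em_slope 1 + Series em_slope_term) / 2) by field.
    apply is_lim_seq_plus'; [apply is_lim_seq_const|].
    apply (is_lim_seq_scal_r _ (/ 2) (Finite _)). apply is_lim_seq_plus'; [apply is_lim_seq_const|easy].
Qed.

(** * Wallis' product and Stirling's formula *)

Definition wallis_int (m : nat) : R := RInt (fun x => sin x ^ m) 0 (PI / 2).

Lemma ex_RInt_sin_pow m a b : ex_RInt (fun x => sin x ^ m) a b.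
Proof.
  apply (ex_RInt_continuous (V := R_CompleteNormedModule)). intros x _. apply @ex_derive_continuous. auto_derive. easy.
Qed.

(** The difference of both sides is the integral of the derivative of
    cos x * sin^(m+1) x, which vanishes at both ends. *)
Lemma wallis_int_rec m : INR (m + 2) * wallis_int (m + 2) = INR (m + 1) * wallis_int m.
Proof.
  assert (H : is_RInt (fun x => INR (m + 1) * sin x ^ m - INR (m + 2) * sin x ^ (m + 2)) 0 (PI / 2)
     (cos (PI / 2) * sin (PI / 2) ^ (m + 1) - cos 0 * sin 0 ^ (m + 1))).
  { apply (is_RInt_derive (fun x => cos x * sin x ^ (m + 1))).
    - intros x _. auto_derive; [easy|].
      replace (pred (m + 1)) with m by lia.
      replace (sin x ^ (m + 2)) with (sin x ^ m * Rsqr (sin x)) by (rewrite pow_add; unfold Rsqr; ring).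
      replace (sin x ^ (m + 1)) with (sin x ^ m * sin x) by (rewrite pow_add; ring).
      assert (E : cos x * cos x = 1 - Rsqr (sin x)) by (rewrite <- cos2; reflexivity).
      transitivity (- (sin x ^ m * Rsqr (sin x)) + INR (m + 1) * sin x ^ m * (cos x * cos x)).
      + unfold Rsqr; ring.
      + rewrite E, !plus_INR. simpl. ring.
    - intros x _. apply @ex_derive_continuous. auto_derive. easy. }
  apply (is_RInt_unique (V := R_CompleteNormedModule)) in H. rewrite cos_PI2, sin_0, pow_i in H by lia.
  pose proof (RInt_correct (V := R_CompleteNormedModule) _ _ _ (ex_RInt_sin_pow m 0 (PI / 2))) as H1.
  pose proof (RInt_correct (V := R_CompleteNormedModule) _ _ _ (ex_RInt_sin_pow (m + 2) 0 (PI / 2))) as H2.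
  apply (is_RInt_scal _ _ _ (INR (m + 1))) in H1. apply (is_RInt_scal _ _ _ (INR (m + 2))) in H2.
  pose proof (is_RInt_unique (V := R_CompleteNormedModule) _ _ _ _ (is_RInt_minus _ _ _ _ _ _ H1 H2)) as E.
  unfold wallis_int.
  change (RInt (fun x => INR (m + 1) * sin x ^ m - INR (m + 2) * sin x ^ (m + 2)) 0 (PI / 2) =
    INR (m + 1) * RInt (fun x => sin x ^ m) 0 (PI / 2) - INR (m + 2) * RInt (fun x => sin x ^ (m + 2)) 0 (PI / 2)) in E.
  rewrite E in H. lra.
Qed.

Lemma wallis_int_decr m : wallis_int (S m) <= wallis_int m.
Proof.
  unfold wallis_int. pose proof PI_RGT_0.
  apply RInt_le; [lra|apply ex_RInt_sin_pow|apply ex_RInt_sin_pow|].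
  intros x Hx. assert (0 <= sin x) by (apply sin_ge_0; lra). pose proof (SIN_bound x).
  simpl. assert (0 <= sin x ^ m) by now apply pow_le. nra.
Qed.

Definition central_ratio (n : nat) : R := 4 ^ n * INR (fact n) ^ 2 / INR (fact (2 * n)).

Lemma central_ratio_S n :
  central_ratio (S n) = central_ratio n * (2 * INR n + 2) / (2 * INR n + 1).
Proof.
  unfold central_ratio. replace (2 * S n)%nat with (S (S (2 * n))) by lia.
  rewrite (fact_simpl n), (fact_simpl (S (2 * n))), (fact_simpl (2 * n)), !mult_INR, !S_INR, mult_INR.
  change (INR 2) with (1 + 1). pose proof (INR_fact_neq_0 n). pose proof (INR_fact_neq_0 (2 * n)).
  pose proof (pos_INR n). simpl pow. field. repeat split; try easy; lra.
Qed.

Lemma central_ratio_pos n : 0 < central_ratio n.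
Proof.
  unfold central_ratio. apply Rdiv_lt_0_compat; [|apply INR_fact_lt_0].
  apply Rmult_lt_0_compat; apply pow_lt; [lra|apply INR_fact_lt_0].
Qed.

Lemma wallis_int_values n :
  wallis_int (2 * n) * central_ratio n = PI / 2 /\ wallis_int (2 * n + 1) * (2 * INR n + 1) = central_ratio n.
Proof.
  induction n as [|n [IH1 IH2]].
  - split.
    + unfold wallis_int, central_ratio. simpl.
      rewrite (RInt_const (V := R_CompleteNormedModule)). unfold scal; simpl; unfold mult; simpl. field.
    + assert (H : is_RInt (fun x => sin x ^ 1) 0 (PI / 2) (- cos (PI / 2) - - cos 0)).
      { apply (is_RInt_derive (fun x => - cos x)).
        - intros x _. auto_derive; [easy|]. ring.
        - intros x _. apply @ex_derive_continuous. auto_derive. easy. }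
      unfold wallis_int. change (2 * 0 + 1)%nat with 1%nat. rewrite (is_RInt_unique (V := R_CompleteNormedModule) _ _ _ _ H), cos_PI2, cos_0.
      unfold central_ratio. simpl. field.
  - pose proof (pos_INR n). rewrite central_ratio_S, !S_INR. split.
    + pose proof (wallis_int_rec (2 * n)) as R. replace (2 * S n)%nat with (2 * n + 2)%nat by lia.
      rewrite !plus_INR, mult_INR in R. change (INR 2) with (1 + 1) in R. change (INR 1) with 1 in R.
      replace (wallis_int (2 * n + 2)) with ((2 * INR n + 1) * wallis_int (2 * n) / (2 * INR n + 2)).
      * rewrite <- IH1. field. lra.
      * replace ((2 * INR n + 1) * wallis_int (2 * n)) with ((2 * INR n + 2) * wallis_int (2 * n + 2)) by lra.
        field. lra.
    + pose proof (wallis_int_rec (2 * n + 1)) as R. replace (2 * S n + 1)%nat with (2 * n + 1 + 2)%nat by lia.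
      rewrite !plus_INR, mult_INR in R. change (INR 2) with (1 + 1) in R. change (INR 1) with 1 in R.
      rewrite <- IH2.
      replace (2 * (INR n + 1) + 1) with (2 * INR n + 3) by ring.
      replace (wallis_int (2 * n + 1 + 2) * (2 * INR n + 3)) with ((2 * INR n + 2) * wallis_int (2 * n + 1)) by lra.
      field. lra.
Qed.

(** Monotonicity of the integrals at 2n - 1, 2n, 2n + 1. *)
Lemma wallis_bounds n : (1 <= n)%nat -> PI * INR n <= central_ratio n ^ 2 <= PI * (INR n + 1 / 2).
Proof.
  intros Hn. destruct n as [|n]; [lia|]. clear Hn.
  destruct (wallis_int_values (S n)) as [E1 E2]. destruct (wallis_int_values n) as [_ E3].
  pose proof (wallis_int_decr (2 * S n)) as D1. pose proof (wallis_int_decr (2 * n + 1)) as D2.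
  replace (S (2 * S n)) with (2 * S n + 1)%nat in D1 by lia.
  replace (S (2 * n + 1)) with (2 * S n)%nat in D2 by lia.
  pose proof (central_ratio_pos (S n)) as P. pose proof (central_ratio_S n) as R.
  pose proof (pos_INR n). rewrite S_INR in *.
  set (a := central_ratio (S n)) in *.
  assert (E4 : wallis_int (2 * n + 1) * (2 * (INR n + 1)) = a).
  { rewrite R, <- E3. field. lra. }
  clearbody a.
  apply (Rmult_le_compat_r a) in D1; [|lra]. apply (Rmult_le_compat_r a) in D2; [|lra].
  rewrite E1 in D1, D2. simpl pow. rewrite Rmult_1_r. split.
  - apply (Rmult_le_compat_r (2 * (INR n + 1))) in D2; [|lra].
    replace (wallis_int (2 * n + 1) * a * (2 * (INR n + 1))) with
      (a * (wallis_int (2 * n + 1) * (2 * (INR n + 1)))) in D2 by ring.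
    rewrite E4 in D2. lra.
  - apply (Rmult_le_compat_r (2 * (INR n + 1) + 1)) in D1; [|lra].
    replace (wallis_int (2 * S n + 1) * a * (2 * (INR n + 1) + 1)) with
      (a * (wallis_int (2 * S n + 1) * (2 * (INR n + 1) + 1))) in D1 by ring.
    rewrite E2 in D1. lra.
Qed.

(** The remainder in Stirling's formula; its limit is ln (2 pi) / 2. *)
Definition stirling_rem (n : nat) : R := ln (INR (fact n)) - (INR n + 1 / 2) * ln (INR n) + INR n.

Lemma stirling_rem_step n : (1 <= n)%nat ->
  / (3 * (2 * INR n + 1) ^ 2) <= stirling_rem n - stirling_rem (S n) <= / (12 * INR n * (INR n + 1)).
Proof.
  intros Hn. assert (H1 : 1 <= INR n) by (apply (le_INR 1); easy).
  pose proof (ln_step_trapezoid (INR n) H1).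
  unfold stirling_rem. rewrite fact_simpl, mult_INR, ln_mult, S_INR by (try apply INR_fact_lt_0; apply lt_0_INR; lia).
  lra.
Qed.

(** By [stirling_rem_step], subtracting 1/(12 n) makes the remainder increasing
    and subtracting 1/(12 n + 1) makes it decreasing, so that both sequences are
    adjacent. *)
Lemma stirling_limit_exists : exists c, forall n, (1 <= n)%nat ->
  c + / (12 * INR n + 1) <= stirling_rem n <= c + / (12 * INR n).
Proof.
  set (u := fun n => stirling_rem (S n) - / (12 * INR (S n))).
  set (v := fun n => stirling_rem (S n) - / (12 * INR (S n) + 1)).
  assert (Hu : forall n, u n <= u (S n)).
  { intros n. unfold u. pose proof (stirling_rem_step (S n) ltac:(lia)) as [_ B].
    rewrite (S_INR (S n)). assert (H1 : 1 <= INR (S n)) by (apply (le_INR 1); lia).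
    set (x := INR (S n)) in *.
    replace (/ (12 * x * (x + 1))) with (/ (12 * x) - / (12 * (x + 1))) in B by (field; lra). lra. }
  assert (Hv : forall n, v (S n) <= v n).
  { intros n. unfold v. pose proof (stirling_rem_step (S n) ltac:(lia)) as [B _].
    rewrite (S_INR (S n)). assert (H1 : 1 <= INR (S n)) by (apply (le_INR 1); lia).
    set (x := INR (S n)) in *.
    enough (/ (12 * x + 1) - / (12 * (x + 1) + 1) <= / (3 * (2 * x + 1) ^ 2)) by lra.
    replace (/ (12 * x + 1) - / (12 * (x + 1) + 1)) with (/ ((12 * x + 1) * (12 * x + 13) / 12)) by (field; lra).
    apply Rinv_le_contravar; [apply Rmult_lt_0_compat; [lra|apply pow_lt; lra]|]. nra. }
  assert (Hl : is_lim_seq (fun n => v n - u n) 0).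
  { apply is_lim_seq_le_le with (fun _ => 0) (fun n => / INR (S n)).
    - intros n. unfold u, v. assert (H1 : 1 <= INR (S n)) by (apply (le_INR 1); lia).
      set (x := INR (S n)) in *.
      assert (/ (12 * x + 1) <= / (12 * x)) by (apply Rinv_le_contravar; lra).
      assert (/ (12 * x) <= / x) by (apply Rinv_le_contravar; lra).
      assert (0 < / (12 * x + 1)) by (apply Rinv_0_lt_compat; lra). lra.
    - apply is_lim_seq_const.
    - apply (is_lim_seq_incr_1 (fun n => / INR n)). apply (is_lim_seq_inv _ p_infty); [apply is_lim_seq_INR|easy]. }
  destruct (ex_lim_seq_adj u v Hu Hv Hl) as [[c Hc] [[c' Hc'] E]].
  rewrite (is_lim_seq_unique _ _ Hc), (is_lim_seq_unique _ _ Hc') in E. injection E as E. subst c'.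
  exists c. intros [|n] Hn; [lia|].
  pose proof (is_lim_seq_incr_compare _ _ Hc Hu n). pose proof (is_lim_seq_decr_compare _ _ Hc' Hv n).
  unfold u, v in *. lra.
Qed.

Lemma central_ratio_stirling n : (1 <= n)%nat ->
  ln (central_ratio n ^ 2 / INR n) = 2 * (2 * stirling_rem n - stirling_rem (2 * n)) - ln 2.
Proof.
  intros Hn. assert (H1 : 0 < INR n) by (apply lt_0_INR; lia).
  pose proof (central_ratio_pos n) as P.
  rewrite ln_div by (try apply pow_lt; easy). rewrite ln_pow by easy.
  unfold central_ratio, stirling_rem.
  pose proof (INR_fact_lt_0 n). pose proof (INR_fact_lt_0 (2 * n)).
  rewrite ln_div, ln_mult, !ln_pow by (try apply Rmult_lt_0_compat; try apply pow_lt; lra).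
  replace 4 with (2 * 2) by ring. rewrite mult_INR, !ln_mult by (simpl; lra).
  change (INR 2) with (1 + 1). replace (1 + 1) with 2 by ring. field.
Qed.

(** With c the limit, (4^n n!^2 / (2n)!)^2 / n tends to e^(2c) / 2 by
    [central_ratio_stirling] and to pi by [wallis_bounds]. *)
Lemma stirling_bounds n : (1 <= n)%nat ->
  ln (2 * PI) / 2 + / (12 * INR n + 1) <= stirling_rem n <= ln (2 * PI) / 2 + / (12 * INR n).
Proof.
  destruct stirling_limit_exists as [c Hc].
  enough (E : c = ln (2 * PI) / 2) by (rewrite <- E; apply Hc).
  assert (L : is_lim_seq stirling_rem c).
  { apply is_lim_seq_le_le_loc with (fun _ => c) (fun n => c + / INR n).
    - exists 1%nat. intros m Hm. destruct (Hc m Hm).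
      assert (H1 : 1 <= INR m) by (apply (le_INR 1); easy).
      assert (0 < / (12 * INR m + 1)) by (apply Rinv_0_lt_compat; lra).
      assert (/ (12 * INR m) <= / INR m) by (apply Rinv_le_contravar; lra). lra.
    - apply is_lim_seq_const.
    - replace c with (c + 0) at 1 by ring. apply is_lim_seq_plus'; [apply is_lim_seq_const|apply is_lim_seq_inv_INR]. }
  assert (L2 : is_lim_seq (fun n => stirling_rem (2 * n)) c).
  { apply (is_lim_seq_subseq stirling_rem c (fun n => (2 * n)%nat)); [|easy].
    apply eventually_subseq. intros; lia. }
  assert (L3 : is_lim_seq (fun n => 2 * (2 * stirling_rem n - stirling_rem (2 * n)) - ln 2) (2 * (2 * c - c) - ln 2)).
  { apply is_lim_seq_minus'; [|apply is_lim_seq_const].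
    apply (is_lim_seq_scal_l _ 2 (Finite _)). apply is_lim_seq_minus'; [|easy].
    now apply (is_lim_seq_scal_l _ 2 (Finite _)). }
  assert (L4 : is_lim_seq (fun n => 2 * (2 * stirling_rem n - stirling_rem (2 * n)) - ln 2) (ln PI)).
  { pose proof PI_RGT_0 as HP.
    apply is_lim_seq_le_le_loc with (fun _ => ln PI) (fun n => ln PI + / INR n).
    - exists 1%nat. intros m Hm. rewrite <- central_ratio_stirling by easy.
      assert (H1 : 1 <= INR m) by (apply (le_INR 1); easy).
      destruct (wallis_bounds m Hm) as [W1 W2]. split.
      + apply ln_le; [easy|]. apply (Rle_div_r PI); [lra|exact W1].
      + rewrite <- (ln_exp (/ INR m)), <- ln_mult by (try apply exp_pos; easy).
        apply ln_le; [apply Rdiv_lt_0_compat; [apply pow_lt, central_ratio_pos|lra]|].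
        apply Rle_div_l; [lra|]. eapply Rle_trans; [apply W2|].
        rewrite Rmult_assoc. apply Rmult_le_compat_l; [lra|].
        pose proof (exp_ineq1_le (/ INR m)).
        apply Rle_trans with ((1 + / INR m) * INR m); [|apply Rmult_le_compat_r; lra].
        rewrite Rmult_plus_distr_r, Rinv_l; lra.
    - apply is_lim_seq_const.
    - replace (ln PI) with (ln PI + 0) at 1 by ring. apply is_lim_seq_plus'; [apply is_lim_seq_const|apply is_lim_seq_inv_INR]. }
  apply is_lim_seq_unique in L3. apply is_lim_seq_unique in L4. rewrite L3 in L4. injection L4 as E.
  rewrite ln_mult by (try apply PI_RGT_0; lra). lra.
Qed.

(** * Partial fractions of the cotangent *)

Lemma is_lim_seq_abs_le (u : nat -> R) (l : R) (e : nat -> R) N :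
  (forall n, (N <= n)%nat -> Rabs (u n - l) <= e n) -> is_lim_seq e 0 -> is_lim_seq u l.
Proof.
  intros H He. apply is_lim_seq_le_le_loc with (fun n => l - e n) (fun n => l + e n).
  - exists N. intros n Hn. specialize (H n Hn). apply Rabs_le_between in H. lra.
  - replace l with (l - 0) at 1 by ring. apply is_lim_seq_minus'; [apply is_lim_seq_const|easy].
  - replace l with (l + 0) at 1 by ring. apply is_lim_seq_plus'; [apply is_lim_seq_const|easy].
Qed.

(** Dominated convergence for sums whose length grows with n. *)
Lemma tannery (f : nat -> nat -> R) (g b : nat -> R) (m : nat -> nat) L :
  (forall k, is_lim_seq (fun n => f n k) (g k)) ->
  (forall n k, (k < m n)%nat -> Rabs (f n k) <= b k) ->
  (forall n, rsum b n <= L) ->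
  (forall k, 0 <= b k) ->
  (forall n, (n <= m n)%nat) ->
  ex_series g /\ is_lim_seq (fun n => rsum (f n) (m n)) (Series g).
Proof.
  intros Hg Hb HL Hb0 Hm.
  assert (Hgb : forall k, Rabs (g k) <= b k).
  { intros k. refine (is_lim_seq_le_loc _ _ (Finite _) (Finite _) _ (is_lim_seq_abs _ _ (Hg k)) (is_lim_seq_const (b k))).
    exists (S k). intros n Hn. apply Hb. specialize (Hm n). lia. }
  assert (X : ex_series g).
  { apply (abs_bounded_ex_series _ L). intros n. eapply Rle_trans; [|apply (HL n)].
    apply rsum_le; intros; apply Hgb. }
  split; [easy|].
  destruct (ex_finite_lim_seq_incr (rsum b) L) as [l Hl]; [intros n; simpl; specialize (Hb0 n); lra|easy|].
  assert (Hl1 : forall n, rsum b n <= l).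
  { apply (is_lim_seq_incr_compare _ _ Hl). intros n; simpl; specialize (Hb0 n); lra. }
  assert (Hs : is_lim_seq (rsum g) (Series g)) by now apply is_series_rsum, Series_correct.
  apply is_lim_seq_spec. intros eps. pose proof (cond_pos eps) as He.
  apply is_lim_seq_spec in Hl. apply is_lim_seq_spec in Hs.
  destruct (Hl (mkposreal (eps / 4) ltac:(lra))) as [K1 HK1]. simpl in HK1.
  destruct (Hs (mkposreal (eps / 4) ltac:(lra))) as [K2 HK2]. simpl in HK2.
  set (K := Nat.max K1 K2).
  specialize (HK1 K ltac:(lia)). specialize (HK2 K ltac:(lia)).
  pose proof (is_lim_seq_rsum (fun k n => f n k) g K Hg) as Hf. cbv beta in Hf.
  apply is_lim_seq_spec in Hf.
  destruct (Hf (mkposreal (eps / 4) ltac:(lra))) as [N HN]. simpl in HN.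
  exists (Nat.max N K). intros n Hn. specialize (HN n ltac:(lia)).
  change (rsum (fun k => f n k) K) with (rsum (f n) K) in HN. specialize (Hm n).
  replace (m n) with (K + (m n - K))%nat by lia. rewrite rsum_add.
  set (p := (m n - K)%nat).
  assert (T : Rabs (rsum (fun k => f n (K + k)%nat) p) <= rsum (fun k => b (K + k)%nat) p).
  { assert (Hp : forall j, (j <= p)%nat -> Rabs (rsum (fun k => f n (K + k)%nat) j) <= rsum (fun k => b (K + k)%nat) j).
    { induction j as [|j IH]; intros Hj; simpl; [rewrite Rabs_R0; lra|].
      eapply Rle_trans; [apply Rabs_triang|]. apply Rplus_le_compat; [apply IH; lia|]. apply Hb. lia. }
    now apply Hp. }
  pose proof (rsum_add b K p) as E. pose proof (Hl1 (K + p)%nat) as B.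
  apply Rabs_lt_between in HK1. apply Rabs_lt_between in HK2. apply Rabs_lt_between in HN.
  apply Rabs_le_between in T. apply Rabs_lt_between. lra.
Qed.

Lemma rsum_inv_sq n : rsum (fun k => / INR (S k) ^ 2) n <= 2.
Proof.
  assert (P : forall n, rsum (fun k => / INR (S k) ^ 2) (S n) <= 2 - / INR (S n)).
  { clear n. induction n as [|n IH]; [simpl; lra|].
    change (rsum (fun k => / INR (S k) ^ 2) (S (S n))) with
      (rsum (fun k => / INR (S k) ^ 2) (S n) + / INR (S (S n)) ^ 2).
    rewrite (S_INR (S n)). assert (Hx : 0 < INR (S n)) by (apply lt_0_INR; lia).
    set (x := INR (S n)) in *.
    enough (/ (x + 1) ^ 2 <= / x - / (x + 1)) by lra.
    replace (/ x - / (x + 1)) with (/ (x * (x + 1))) by (field; lra).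
    apply Rinv_le_contravar; nra. }
  destruct n as [|n]; [simpl; lra|]. eapply Rle_trans; [apply P|].
  assert (0 < / INR (S n)) by (apply Rinv_0_lt_compat, lt_0_INR; lia). lra.
Qed.

Lemma rsum_rev f n : rsum f n = rsum (fun k => f (n - 1 - k)%nat) n.
Proof.
  revert f. induction n as [|n IH]; intros f; [easy|].
  rewrite rsum_S_l, (IH (fun k => f (S k))). simpl rsum.
  rewrite Rplus_comm. f_equal.
  - apply rsum_ext. intros k Hk. f_equal. lia.
  - f_equal. lia.
Qed.

Definition cot (x : R) : R := cos x / sin x.

Lemma cot_double h : sin (2 * h) <> 0 -> cot h + cot (h + PI / 2) = 2 * cot (2 * h).
Proof.
  intros H. unfold cot. rewrite cos_plus, sin_plus, cos_PI2, sin_PI2.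
  rewrite sin_2a in *. rewrite cos_2a. field.
  split; intros E; apply H; rewrite E; ring.
Qed.

Lemma cot_half y : sin y <> 0 -> cot (y / 2) + cot ((y + PI) / 2) = 2 * cot y.
Proof.
  intros H. replace ((y + PI) / 2) with (y / 2 + PI / 2) by field.
  replace y with (2 * (y / 2)) in H by field. rewrite (cot_double _ H). f_equal. f_equal. field.
Qed.

Lemma sin_half_neq0 y : sin y <> 0 -> sin (y / 2) <> 0.
Proof.
  intros H E. apply H. replace y with (2 * (y / 2)) by field. rewrite sin_2a, E. ring.
Qed.

Lemma sin_shift_neq0 x k : sin x <> 0 -> sin (x + INR k * PI) <> 0.
Proof.
  intros H. induction k as [|k IH].
  - simpl. now rewrite Rmult_0_l, Rplus_0_r.
  - rewrite S_INR. replace (x + (INR k + 1) * PI) with (x + INR k * PI + PI) by ring.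
    rewrite neg_sin. lra.
Qed.

Lemma sin_grid_neq0 x n k : sin x <> 0 -> sin ((x + INR k * PI) / 2 ^ n) <> 0.
Proof.
  intros H. induction n as [|n IH].
  - simpl. rewrite Rdiv_1_r. now apply sin_shift_neq0.
  - replace ((x + INR k * PI) / 2 ^ S n) with ((x + INR k * PI) / 2 ^ n / 2)
      by (simpl; field; apply pow_nonzero; lra).
    now apply sin_half_neq0.
Qed.

(** Iterating [cot_half] n times splits cot x into 2^n equally spaced values. *)
Lemma cot_grid_sum x n : sin x <> 0 ->
  rsum (fun k => cot ((x + INR k * PI) / 2 ^ n)) (2 ^ n) = 2 ^ n * cot x.
Proof.
  intros H. assert (P2 : forall n, 2 ^ n <> 0) by (intros; apply pow_nonzero; lra).
  induction n as [|n IH].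
  - simpl. rewrite Rmult_0_l, Rplus_0_r, Rdiv_1_r. ring.
  - replace (2 ^ S n)%nat with (2 ^ n + 2 ^ n)%nat by (simpl; lia).
    rewrite rsum_add, <- rsum_plus.
    rewrite (rsum_ext _ (fun k => 2 * cot ((x + INR k * PI) / 2 ^ n))).
    + rewrite rsum_scal, IH. simpl. ring.
    + intros k _. rewrite <- cot_half by now apply sin_grid_neq0.
      f_equal; f_equal.
      * simpl. field. apply P2.
      * rewrite plus_INR, pow_INR. simpl INR. replace (1 + 1) with 2 by ring. simpl. field. apply P2.
Qed.

Lemma cot_sub_PI y : cot (y - PI) = cot y.
Proof.
  unfold cot. replace y with (y - PI + PI) at 3 4 by ring. rewrite neg_cos, neg_sin.
  destruct (Req_dec (sin (y - PI)) 0) as [E|E]; [|field; lra].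
  rewrite E, Ropp_0. unfold Rdiv. rewrite Rinv_0. ring.
Qed.

(** The upper half of the grid is moved by the period pi to negative indices.
    Each k is paired with -k, since only the sum of the two values decays like
    1/k^2. *)
Lemma cot_grid_fold x n : sin x <> 0 ->
  let c := fun t : R => cot ((x + t * PI) / 2 ^ S n) in
  2 ^ S n * cot x = c 0 + c (- 2 ^ n) + rsum (fun k => c (INR (S k)) + c (- INR (S k))) (2 ^ n - 1).
Proof.
  intros H c. rewrite <- cot_grid_sum by easy.
  assert (P2 : forall n, 2 ^ n <> 0) by (intros; apply pow_nonzero; lra).
  assert (E2 : INR (2 ^ n) = 2 ^ n) by (rewrite pow_INR; simpl INR; now replace (1 + 1) with 2 by ring).
  change (rsum (fun k => cot ((x + INR k * PI) / 2 ^ S n)) (2 ^ S n)) with (rsum (fun k => c (INR k)) (2 ^ S n)).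
  replace (2 ^ S n)%nat with (2 ^ n + 2 ^ n)%nat by (simpl; lia).
  rewrite rsum_add.
  rewrite (rsum_rev (fun k => c (INR (2 ^ n + k)))).
  assert (Hp : (1 <= 2 ^ n)%nat) by (pose proof (Nat.pow_nonzero 2 n); lia).
  rewrite (rsum_ext (fun k => c (INR (2 ^ n + (2 ^ n - 1 - k)))) (fun k => c (- INR (S k)))).
  - assert (E3 : rsum (fun k => c (- INR (S k))) (2 ^ n) = rsum (fun k => c (- INR (S k))) (2 ^ n - 1) + c (- 2 ^ n)).
    { rewrite <- E2. replace (2 ^ n)%nat with (S (2 ^ n - 1)) at 1 3 by lia. reflexivity. }
    rewrite E3. replace (2 ^ n)%nat with (S (2 ^ n - 1)) at 1 by lia.
    rewrite rsum_S_l, rsum_plus. change (INR 0) with 0. ring.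
  - intros k Hk. unfold c. rewrite <- (cot_sub_PI (_ / _)). f_equal.
    rewrite plus_INR, !minus_INR by lia. rewrite E2, (S_INR k). change (INR 1) with 1. simpl pow. field. apply P2.
Qed.

Lemma cot_pair a b : sin a ^ 2 <> sin b ^ 2 ->
  cot (a + b) + cot (a - b) = 2 * sin a * cos a / (sin a ^ 2 - sin b ^ 2).
Proof.
  intros H. unfold cot.
  assert (E : sin (a + b) * sin (a - b) = sin a ^ 2 - sin b ^ 2).
  { rewrite sin_plus, sin_minus. pose proof (sin2_cos2 a) as A. pose proof (sin2_cos2 b) as B. unfold Rsqr in *.
    replace ((sin a * cos b + cos a * sin b) * (sin a * cos b - cos a * sin b)) with
      (sin a * sin a * (cos b * cos b) - cos a * cos a * (sin b * sin b)) by ring.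
    replace (cos b * cos b) with (1 - sin b * sin b) by lra. replace (cos a * cos a) with (1 - sin a * sin a) by lra. ring. }
  assert (H1 : sin (a + b) <> 0) by (intros Z; rewrite Z in E; lra).
  assert (H2 : sin (a - b) <> 0) by (intros Z; rewrite Z in E; lra).
  rewrite <- E. rewrite <- sin_2a. replace (2 * a) with ((a + b) + (a - b)) by ring.
  rewrite (sin_plus (a + b) (a - b)). field. easy.
Qed.

Lemma sin_ge_third b : 0 <= b <= PI / 2 -> b / 3 <= sin b.
Proof.
  intros Hb. pose proof PI_RGT_0. pose proof PI_4.
  destruct (SIN b ltac:(lra) ltac:(lra)) as [B _].
  eapply Rle_trans; [|apply B]. unfold sin_lb, sin_approx, sin_term. simpl.
  assert (Hq : 0 <= b * b <= 4) by nra. set (q := b * b) in *.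
  enough (0 <= b * (2 / 3 - q / 6 + q * q / 120 - q * q * q / 5040)).
  { unfold q in *. lra. }
  apply Rmult_le_pos; [lra|]. nra.
Qed.

Lemma is_lim_seq_sq (u : nat -> R) (l : R) : is_lim_seq u l -> is_lim_seq (fun n => u n ^ 2) (l ^ 2).
Proof.
  intros H. apply is_lim_seq_ext with (fun n => u n * u n); [intros; ring|].
  replace (l ^ 2) with (l * l) by ring. now apply is_lim_seq_mult'.
Qed.

(** By [cot_pair], the pair of index k in the grid of step pi / N is
    2 sin a cos a / (sin^2 a - sin^2 b) with a = x/N and b = k pi/N.  Divided by N
    it tends to 2x/(x^2 - k^2 pi^2), and sin b >= b/3 bounds it by 2/k^2. *)
Lemma cot_partial_fractions x : 0 < x <= 1 / 2 ->
  let g := fun k => x / ((INR (S k) * PI) ^ 2 - x ^ 2) in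
  ex_series g /\ cot x = / x - 2 * Series g.
Proof.
  intros Hx g. pose proof PI2_3_2 as Hpi. pose proof PI_4 as Hpi4.
  assert (Hs : sin x <> 0) by (apply Rgt_not_eq, sin_gt_0; lra).
  set (N := fun n => 2 ^ S n).
  assert (HN : forall n, 0 < N n) by (intros; apply pow_lt; lra).
  set (f := fun n k => 2 * (sin (x / N n) * N n) * cos (x / N n) /
              ((sin (x / N n) * N n) ^ 2 - (sin (INR (S k) * PI / N n) * N n) ^ 2)).
  assert (Hinv : is_lim_seq (fun n => / N n) 0).
  { apply is_lim_seq_ext with (fun n => (/ 2) ^ S n); [intros; unfold N; now rewrite pow_inv|].
    apply (is_lim_seq_incr_1 (fun n => (/ 2) ^ n)). apply is_lim_seq_geom. rewrite Rabs_pos_eq; lra. }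
  assert (Hsin : forall t, is_lim_seq (fun n => sin (t / N n) * N n) t).
  { intros t. destruct (Req_dec t 0) as [->|Ht].
    - apply is_lim_seq_ext with (fun _ => 0); [|apply is_lim_seq_const].
      intros n. unfold Rdiv. rewrite Rmult_0_l, sin_0. ring.
    - assert (D : derivable_pt_lim sin 0 1) by (rewrite <- cos_0; apply derivable_pt_lim_sin).
      apply is_lim_seq_ext with (fun n => t * (sin (t / N n) / (t / N n))).
      { intros n. field. specialize (HN n). split; lra. }
      replace t with (t * 1) at 1 by ring. apply (is_lim_seq_scal_l _ t 1).
      apply is_lim_seq_spec. intros eps. destruct (D eps (cond_pos eps)) as [d Hd].
      assert (Ht' : is_lim_seq (fun n => t * / N n) (t * 0)) by now apply (is_lim_seq_scal_l _ t 0).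
      rewrite Rmult_0_r in Ht'. apply is_lim_seq_spec in Ht'. destruct (Ht' d) as [n0 Hn0].
      exists n0. intros n Hn. specialize (Hn0 n Hn). rewrite Rminus_0_r in Hn0.
      assert (Hz : t / N n <> 0).
      { apply Rmult_integral_contrapositive_currified; [easy|]. apply Rinv_neq_0_compat. specialize (HN n). lra. }
      specialize (Hd (t / N n) Hz Hn0). now rewrite Rplus_0_l, sin_0, Rminus_0_r in Hd. }
  assert (Hcos : forall t, is_lim_seq (fun n => cos (t / N n)) 1).
  { intros t. rewrite <- cos_0. apply (is_lim_seq_continuous cos (fun n => t / N n) 0); [apply continuity_cos|].
    replace 0 with (t * 0) by ring. now apply (is_lim_seq_scal_l _ t 0). }
  assert (Hg : forall k, is_lim_seq (fun n => f n k) (2 * x * 1 / (x ^ 2 - (INR (S k) * PI) ^ 2))).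
  { intros k. unfold f. apply is_lim_seq_div'.
    - apply is_lim_seq_mult'; [|apply Hcos]. now apply (is_lim_seq_scal_l _ 2 (Finite _)).
    - apply is_lim_seq_minus'; now apply is_lim_seq_sq.
    - assert (1 <= INR (S k)) by (apply (le_INR 1); lia). assert (3 <= INR (S k) * PI) by nra. apply Rlt_not_eq. nra. }
  assert (Hfb : forall n k, (k < 2 ^ n - 1)%nat -> Rabs (f n k) <= 2 * / INR (S k) ^ 2 /\
      cot ((x + INR (S k) * PI) / 2 ^ S n) + cot ((x + - INR (S k) * PI) / 2 ^ S n) = N n * f n k).
  { intros n k Hk.
    assert (Hk1 : 1 <= INR (S k)) by (apply (le_INR 1); lia).
    assert (Hk2 : INR (S k) <= 2 ^ n).
    { replace (2 ^ n) with (INR (2 ^ n)) by (rewrite pow_INR; simpl INR; now replace (1 + 1) with 2 by ring). apply le_INR. lia. }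
    pose proof (HN n) as HNn.
    assert (HN1 : 1 <= N n) by (unfold N; apply pow_R1_Rle; lra).
    set (a := x / N n). set (b := INR (S k) * PI / N n).
    assert (Ha : 0 < a <= x).
    { unfold a. split; [apply Rdiv_lt_0_compat; lra|]. apply Rle_div_l; [lra|]. rewrite <- (Rmult_1_r x) at 1. apply Rmult_le_compat_l; lra. }
    assert (Hb : 0 <= b <= PI / 2).
    { unfold b. split; [apply Rdiv_le_0_compat; [nra|easy]|]. apply Rle_div_l; [easy|]. replace (PI / 2 * N n) with (2 ^ n * PI) by (unfold N; simpl; field). apply Rmult_le_compat_r; lra. }
    pose proof (sin_ge_third b Hb) as S1.
    assert (S2 : 0 < sin a) by (apply sin_gt_0; lra).
    assert (S3 : sin a < a) by (apply sin_lt_x; lra).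
    assert (Ea : a * N n = x) by (unfold a; field; lra).
    assert (Eb : b * N n = INR (S k) * PI) by (unfold b; field; lra).
    assert (A1 : 0 < sin a * N n <= x) by (split; [nra|]; rewrite <- Ea; apply Rmult_le_compat_r; lra).
    assert (B1 : INR (S k) <= sin b * N n).
    { apply Rle_trans with (b / 3 * N n); [|apply Rmult_le_compat_r; lra].
      replace (b / 3 * N n) with (INR (S k) * PI / 3) by (rewrite <- Eb; field). nra. }
    assert (Q : 3 / 4 * INR (S k) ^ 2 <= (sin b * N n) ^ 2 - (sin a * N n) ^ 2).
    { assert (Q1 : (sin a * N n) ^ 2 <= (1 / 2) ^ 2) by (apply pow_incr; lra).
      assert (Q2 : INR (S k) ^ 2 <= (sin b * N n) ^ 2) by (apply pow_incr; lra).
      assert (Q3 : 1 ^ 2 <= INR (S k) ^ 2) by (apply pow_incr; lra). lra. }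
    assert (Hk3 : 0 < INR (S k) ^ 2) by (apply pow_lt; lra).
    split.
    - unfold f. fold a. fold b.
      set (u := sin a * N n) in *. set (v := sin b * N n) in *.
      replace (2 * u * cos a / (u ^ 2 - v ^ 2)) with (- (2 * u * cos a / (v ^ 2 - u ^ 2))) by (field; lra).
      rewrite Rabs_Ropp. unfold Rdiv. rewrite Rabs_mult, (Rabs_pos_eq (/ _)) by (apply Rlt_le, Rinv_0_lt_compat; lra).
      assert (C1 : Rabs (2 * u * cos a) <= 1).
      { rewrite Rabs_mult, Rabs_pos_eq by lra. pose proof (COS_bound a). assert (Rabs (cos a) <= 1) by (apply Rabs_le; lra).
        pose proof (Rabs_pos (cos a)). nra. }
      apply Rle_trans with (1 * / (v ^ 2 - u ^ 2)).
      + apply Rmult_le_compat_r; [apply Rlt_le, Rinv_0_lt_compat; lra|easy].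
      + rewrite Rmult_1_l. replace (2 * / INR (S k) ^ 2) with (/ (1 / 2 * INR (S k) ^ 2)) by (field; lra).
        apply Rinv_le_contravar; lra.
    - fold (N n). replace ((x + INR (S k) * PI) / N n) with (a + b) by (unfold a, b; field; lra).
      replace ((x + - INR (S k) * PI) / N n) with (a - b) by (unfold a, b; field; lra).
      assert (Hab : sin a ^ 2 <> sin b ^ 2).
      { intros E. rewrite !Rpow_mult_distr, E in Q. lra. }
      rewrite cot_pair by easy. unfold f. fold a. fold b. field.
      split; [intros E; apply Hab; lra|lra]. }
  destruct (tannery f (fun k => 2 * x * 1 / (x ^ 2 - (INR (S k) * PI) ^ 2)) (fun k => 2 * / INR (S k) ^ 2) (fun n => 2 ^ n - 1)%nat 4)
    as [X L]; [easy| | | | |].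
  - intros n k Hk. now apply Hfb.
  - intros n. rewrite rsum_scal. pose proof (rsum_inv_sq n). lra.
  - intros k. apply Rmult_le_pos; [lra|]. apply Rlt_le, Rinv_0_lt_compat, pow_lt, lt_0_INR. lia.
  - intros n. pose proof (Nat.pow_gt_lin_r 2 n). lia.
  - assert (EG : forall k, -2 * g k = 2 * x * 1 / (x ^ 2 - (INR (S k) * PI) ^ 2)).
    { intros k. unfold g. assert (1 <= INR (S k)) by (apply (le_INR 1); lia).
      assert (3 <= INR (S k) * PI) by nra. assert (0 < (INR (S k) * PI) ^ 2 - x ^ 2) by nra. field. lra. }
    assert (Xg : ex_series g).
    { assert (EG2 : forall k, - / 2 * (2 * x * 1 / (x ^ 2 - (INR (S k) * PI) ^ 2)) = g k)
        by (intros k; rewrite <- EG; field).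
      apply (ex_series_ext _ _ EG2). now apply (ex_series_scal (K := R_AbsRing) (V := R_NormedModule) (- / 2)). }
    split; [easy|].
    rewrite <- (Series_ext _ _ EG), Series_scal_l in L.
    assert (L2 : is_lim_seq (fun _ : nat => cot x) (1 / x + - (x / 1) * (0 * 0) + -2 * Series g)).
    { apply is_lim_seq_ext with (fun n => cos (x / N n) / (sin (x / N n) * N n)
          + - ((sin (x / N n) * N n) / cos (x / N n)) * (/ N n * / N n) + rsum (f n) (2 ^ n - 1)).
      - intros n. pose proof (HN n) as HNn. apply Rmult_eq_reg_l with (N n); [|lra].
        assert (HN1 : 1 <= N n) by (unfold N; apply pow_R1_Rle; lra).
        assert (Ha : 0 < x / N n <= x).
        { split; [apply Rdiv_lt_0_compat; lra|]. apply Rle_div_l; [lra|]. rewrite <- (Rmult_1_r x) at 1. apply Rmult_le_compat_l; lra. }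
        assert (Hsa : 0 < sin (x / N n)) by (apply sin_gt_0; lra).
        assert (Hca : 0 < cos (x / N n)) by (apply cos_gt_0; lra).
        change (N n * cot x) with (2 ^ S n * cot x). rewrite cot_grid_fold by easy. cbv zeta.
        rewrite (rsum_ext (fun k => cot ((x + INR (S k) * PI) / 2 ^ S n) + cot ((x + - INR (S k) * PI) / 2 ^ S n))
           (fun k => N n * f n k)) by (intros k Hk; now apply Hfb).
        rewrite rsum_scal, !Rmult_plus_distr_l. f_equal.
        fold (N n). replace ((x + 0 * PI) / N n) with (x / N n) by (field; lra).
        replace ((x + - 2 ^ n * PI) / N n) with (- (PI / 2 - x / N n))
          by (unfold N; simpl; field; apply pow_nonzero; lra).
        unfold cot. rewrite cos_neg, sin_neg, cos_shift, sin_shift. field. lra.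
      - apply is_lim_seq_plus'; [|exact L]. apply is_lim_seq_plus'.
        + apply is_lim_seq_div'; [apply Hcos|apply Hsin|lra].
        + apply is_lim_seq_mult'; [|now apply is_lim_seq_mult'].
          apply (is_lim_seq_opp _ (Finite (x / 1))).
          apply is_lim_seq_div'; [apply Hsin|apply Hcos|lra]. }
    apply is_lim_seq_unique in L2. rewrite Lim_seq_const in L2. injection L2 as L2. rewrite L2. field. lra.
Qed.

(** * Euler's formula for the Bernoulli numbers *)

Definition zeta_even (j : nat) : R := Series (fun k => / INR (S k) ^ (2 * j)).

Lemma ex_zeta_even j : (1 <= j)%nat -> ex_series (fun k => / INR (S k) ^ (2 * j)).
Proof.
  intros Hj. apply (abs_bounded_ex_series _ 2). intros n.
  eapply Rle_trans; [|apply (rsum_inv_sq n)]. apply rsum_le. intros k _.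
  assert (1 <= INR (S k)) by (apply (le_INR 1); lia).
  rewrite Rabs_pos_eq by (apply Rlt_le, Rinv_0_lt_compat, pow_lt; lra).
  apply Rinv_le_contravar; [apply pow_lt; lra|]. apply Rle_pow; [easy|lia].
Qed.

Definition cot_coef (j : nat) : R :=
  match j with O => 1 | S _ => -2 * zeta_even j / PI ^ (2 * j) end.

(** Each partial fraction is a geometric series in q_k = x^2 / (k pi)^2.  Stopping
    all of them after J terms leaves the sum of the q_k^(J+1) / (1 - q_k), which is
    at most 4^(-J) times the sum for J = 0; no exchange of infinite sums occurs. *)
Lemma cot_pseries x : 0 < x <= 1 / 2 -> is_pseries cot_coef (x ^ 2) (x * cot x).
Proof.
  intros Hx. destruct (cot_partial_fractions x Hx) as [X E].
  pose proof PI2_3_2 as Hpi.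
  set (q := fun k => x ^ 2 / (INR (S k) * PI) ^ 2).
  assert (Hk : forall k, 3 <= INR (S k) * PI).
  { intros k. assert (1 <= INR (S k)) by (apply (le_INR 1); lia). nra. }
  assert (Hq : forall k, 0 < q k <= x ^ 2).
  { intros k. specialize (Hk k). assert (1 ^ 2 <= (INR (S k) * PI) ^ 2) by (apply pow_incr; lra).
    assert (0 < x ^ 2) by (apply pow_lt; lra).
    unfold q. split; [apply Rdiv_lt_0_compat; lra|]. apply Rle_div_l; [lra|]. nra. }
  assert (Hx2 : 0 < x ^ 2 <= 1 / 4) by nra.
  set (g := fun k => x / ((INR (S k) * PI) ^ 2 - x ^ 2)) in *.
  assert (Eg : forall k, x * g k = q k / (1 - q k)).
  { intros k. specialize (Hk k). unfold g, q. assert (0 < (INR (S k) * PI) ^ 2 - x ^ 2) by nra. field.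
    split; [lra|]. split; [|nra]. assert (1 <= INR (S k)) by (apply (le_INR 1); lia). nra. }
  assert (R0 : is_series (fun k => q k / (1 - q k)) (x * Series g)).
  { apply (is_series_ext _ _ _ Eg). apply (is_series_scal (K := R_AbsRing) (V := R_NormedModule) x). now apply Series_correct. }
  set (S0 := x * Series g) in *.
  assert (Zj : forall j, (1 <= j)%nat -> is_series (fun k => q k ^ j) ((x ^ 2) ^ j * (zeta_even j / PI ^ (2 * j)))).
  { intros j Hj. pose proof (Series_correct _ (ex_zeta_even j Hj)) as Z.
    apply (is_series_scal (K := R_AbsRing) (V := R_NormedModule) ((x ^ 2) ^ j / PI ^ (2 * j))) in Z.
    assert (HP : PI ^ (2 * j) <> 0) by (apply pow_nonzero; lra).
    replace ((x ^ 2) ^ j * (zeta_even j / PI ^ (2 * j))) with ((x ^ 2) ^ j / PI ^ (2 * j) * zeta_even j) by (field; easy).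
    assert (Eq : forall k, (x ^ 2) ^ j / PI ^ (2 * j) * / INR (S k) ^ (2 * j) = q k ^ j).
    { intros k. unfold q, Rdiv. assert (INR (S k) <> 0) by (apply not_0_INR; lia).
      rewrite (Rpow_mult_distr (x ^ 2)), pow_inv, <- (pow_mult (INR (S k) * PI)), Rpow_mult_distr.
      field. split; first [exact HP | now apply pow_nonzero]. }
    exact (is_series_ext _ _ _ Eq Z). }
  assert (Rem : forall J, is_series (fun k => q k ^ S J / (1 - q k))
            (S0 - rsum (fun j => (x ^ 2) ^ S j * (zeta_even (S j) / PI ^ (2 * S j))) J)).
  { induction J as [|J IH].
    - simpl rsum. rewrite Rminus_0_r. refine (is_series_ext _ _ _ _ R0). intros k. simpl. now rewrite Rmult_1_r.
    - simpl rsum. rewrite Rminus_plus_distr.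
      pose proof (is_series_minus _ _ _ _ IH (Zj (S J) ltac:(lia))) as M.
      refine (is_series_ext _ _ _ _ M). intros k. specialize (Hq k).
      change (q k ^ S J / (1 - q k) - q k ^ S J = q k ^ S (S J) / (1 - q k)). simpl. field. lra. }
  assert (Bd : forall J, Rabs (rsum (fun j => (x ^ 2) ^ S j * (zeta_even (S j) / PI ^ (2 * S j))) J - S0) <= (1 / 4) ^ J * S0).
  { intros J. specialize (Rem J).
    assert (E1 : Series (fun k => q k ^ S J / (1 - q k)) = S0 - rsum (fun j => (x ^ 2) ^ S j * (zeta_even (S j) / PI ^ (2 * S j))) J)
      by now apply is_series_unique.
    rewrite Rabs_minus_sym, <- E1.
    assert (N1 : forall k, 0 <= q k ^ S J / (1 - q k) <= (1 / 4) ^ J * (q k / (1 - q k))).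
    { intros k. specialize (Hq k). assert (Hqq : 0 <= q k / (1 - q k)) by (apply Rdiv_le_0_compat; lra).
      assert (0 <= q k ^ J <= (1 / 4) ^ J) by (split; [apply pow_le; lra|apply pow_incr; lra]).
      replace (q k ^ S J / (1 - q k)) with (q k ^ J * (q k / (1 - q k))) by (simpl; field; lra).
      split; [now apply Rmult_le_pos|]. now apply Rmult_le_compat_r. }
    assert (E2 : Series (fun k => (1 / 4) ^ J * (q k / (1 - q k))) = (1 / 4) ^ J * S0).
    { rewrite Series_scal_l. f_equal. now apply is_series_unique. }
    rewrite <- E2. rewrite Rabs_pos_eq.
    - apply Series_le; [easy|]. apply (ex_series_scal (K := R_AbsRing) (V := R_NormedModule)). now exists S0.
    - replace 0 with (0 * Series (fun k => q k ^ S J / (1 - q k))) by ring. rewrite <- Series_scal_l.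
      apply Series_le; [|now eexists; apply Rem]. intros k. specialize (N1 k). lra. }
  apply is_pseries_R, is_series_rsum, is_lim_seq_incr_1.
  replace (x * cot x) with (1 + -2 * S0) by (rewrite E; unfold S0; field; lra).
  apply is_lim_seq_ext with (fun J => 1 + -2 * rsum (fun j => (x ^ 2) ^ S j * (zeta_even (S j) / PI ^ (2 * S j))) J).
  - intros J. rewrite rsum_S_l. f_equal; [simpl; ring|]. rewrite <- rsum_scal. apply rsum_ext. intros j _.
    unfold cot_coef. field. apply pow_nonzero; lra.
  - apply is_lim_seq_plus'; [apply is_lim_seq_const|]. apply (is_lim_seq_scal_l _ (-2) S0).
    apply (is_lim_seq_abs_le _ _ (fun J => (1 / 4) ^ J * S0) O); [intros; apply Bd|].
    replace 0 with (0 * S0) by ring. apply (is_lim_seq_scal_r _ S0 0), is_lim_seq_geom. rewrite Rabs_pos_eq; lra.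
Qed.

Lemma CV_radius_gt a (w w' : R) : ex_pseries a w' -> Rabs w < Rabs w' -> Rbar_lt (Rabs w) (CV_radius a).
Proof.
  intros [l H] Hw. apply Rbar_not_le_lt. intros Hle.
  apply (CV_disk_outside a w').
  - eapply Rbar_le_lt_trans; [apply Hle|]. exact Hw.
  - apply ex_series_lim_0. exists l. now apply is_pseries_R.
Qed.

(** Continuity at 0 kills the constant coefficient; then divide by the variable.
    One side of 0 suffices, which matters because series in x^2 are only known at
    nonnegative arguments. *)
Lemma pseries_zero_right (a : nat -> R) rho : 0 < rho ->
  (forall w, 0 < w < rho -> is_pseries a w 0) -> forall n, a n = 0.
Proof.
  intros Hr H n. revert a H.
  assert (Z : forall a : nat -> R, (forall w, 0 < w < rho -> is_pseries a w 0) -> a O = 0).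
  { intros a H.
    assert (C0 : continuity_pt (PSeries a) 0).
    { apply PSeries_continuity. apply CV_radius_gt with (rho / 2); [eexists; apply H; lra|].
      rewrite Rabs_R0, Rabs_pos_eq; lra. }
    assert (L1 : is_lim_seq (fun n => rho / 2 * / INR (S n)) (rho / 2 * 0)).
    { apply (is_lim_seq_scal_l _ (rho / 2) 0). apply (is_lim_seq_incr_1 (fun n => / INR n)), is_lim_seq_inv_INR. }
    rewrite Rmult_0_r in L1.
    pose proof (is_lim_seq_continuous _ _ _ C0 L1) as L2.
    assert (L3 : is_lim_seq (fun n => PSeries a (rho / 2 * / INR (S n))) 0).
    { apply is_lim_seq_ext with (fun _ => 0); [|apply is_lim_seq_const]. intros m. symmetry.
      apply is_pseries_unique, H.
      assert (1 <= INR (S m)) by (apply (le_INR 1); lia).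
      assert (0 < / INR (S m) <= 1) by (split; [apply Rinv_0_lt_compat; lra|rewrite <- Rinv_1; apply Rinv_le_contravar; lra]).
      split; [apply Rmult_lt_0_compat; lra|nra]. }
    apply is_lim_seq_unique in L2. apply is_lim_seq_unique in L3. rewrite L2 in L3. injection L3 as E.
    rewrite PSeries_0 in E. exact E. }
  induction n as [|n IH]; intros a H; [now apply Z|].
  apply (IH (PS_decr_1 a)). intros w Hw.
  pose proof (is_pseries_decr_1 a w (/ w) 0) as D.
  rewrite (Z a H) in D. specialize (D ltac:(apply Rinv_l; lra) (H w Hw)).
  change (is_pseries (PS_decr_1 a) w (/ w * (0 + - 0))) in D.
  replace (/ w * (0 + - 0)) with 0 in D by ring. exact D.
Qed.

(** The Cauchy product with b is triangular with diagonal entries b 0. *)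
Lemma PS_mult_inj_l (a a' b : nat -> R) : b O <> 0 -> (forall n, PS_mult a b n = PS_mult a' b n) ->
  forall n, a n = a' n.
Proof.
  intros Hb H n. induction n as [n IH] using (well_founded_induction Nat.lt_wf_0).
  specialize (H n). unfold PS_mult in H. destruct n as [|n].
  - simpl in H. now apply Rmult_eq_reg_r in H.
  - simpl in H. rewrite Nat.sub_diag in H.
    rewrite (sum_eq _ (fun k => a' k * b (match k with O => S n | S l => (n - l)%nat end))) in H.
    + apply Rmult_eq_reg_r with (b O); [|easy]. lra.
    + intros k Hk. rewrite IH by lia. easy.
Qed.

Lemma pseries_even_part (a : nat -> R) x l1 l2 : is_pseries a x l1 -> is_pseries a (- x) l2 ->
  is_pseries (fun n => a (2 * n)%nat) (x ^ 2) ((l1 + l2) / 2).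
Proof.
  rewrite !is_pseries_R, !is_series_rsum. intros H1 H2.
  apply is_lim_seq_ext with (fun n => (rsum (fun m => a m * x ^ m) (2 * n) + rsum (fun m => a m * (- x) ^ m) (2 * n)) / 2).
  - intros n. induction n as [|n IH]; [simpl; field|].
    replace (2 * S n)%nat with (S (S (2 * n))) by lia. rewrite !rsum_Sn, <- IH, <- pow_mult.
    replace (S (2 * n)) with (2 * n + 1)%nat by lia. rewrite !pow_add, (pow_mult (- x)), (pow_mult x).
    replace ((- x) ^ 2) with (x ^ 2) by ring. field.
  - apply (is_lim_seq_scal_r _ (/ 2) (Finite _)).
    apply is_lim_seq_plus'; [apply (is_lim_seq_subseq _ _ (fun n => (2 * n)%nat) ltac:(apply eventually_subseq; intros; lia) H1)|
      apply (is_lim_seq_subseq _ _ (fun n => (2 * n)%nat) ltac:(apply eventually_subseq; intros; lia) H2)].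
Qed.

Lemma pseries_odd_part (a : nat -> R) x l1 l2 : x <> 0 -> is_pseries a x l1 -> is_pseries a (- x) l2 ->
  is_pseries (fun n => a (2 * n + 1)%nat) (x ^ 2) ((l1 - l2) / (2 * x)).
Proof.
  rewrite !is_pseries_R, !is_series_rsum. intros Hx H1 H2.
  apply is_lim_seq_ext with (fun n => (rsum (fun m => a m * x ^ m) (2 * n) - rsum (fun m => a m * (- x) ^ m) (2 * n)) / (2 * x)).
  - intros n. induction n as [|n IH]; [simpl; field; easy|].
    replace (2 * S n)%nat with (S (S (2 * n))) by lia. rewrite !rsum_Sn, <- IH, <- pow_mult.
    replace (S (2 * n)) with (2 * n + 1)%nat by lia. rewrite !pow_add, (pow_mult (- x)), (pow_mult x).
    replace ((- x) ^ 2) with (x ^ 2) by ring. field. easy.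
  - apply (is_lim_seq_scal_r _ (/ (2 * x)) (Finite _)).
    apply is_lim_seq_minus'; [apply (is_lim_seq_subseq _ _ (fun n => (2 * n)%nat) ltac:(apply eventually_subseq; intros; lia) H1)|
      apply (is_lim_seq_subseq _ _ (fun n => (2 * n)%nat) ltac:(apply eventually_subseq; intros; lia) H2)].
Qed.

Lemma cos_pseries x : is_pseries cos_n (x ^ 2) (cos x).
Proof.
  apply is_pseries_Reals. unfold cos. destruct (exist_cos (Rsqr x)) as [l Hl].
  unfold cos_in in Hl. unfold Pser. now replace (x ^ 2) with (Rsqr x) by (unfold Rsqr; ring).
Qed.

Lemma sin_pseries x : x <> 0 -> is_pseries sin_n (x ^ 2) (sin x / x).
Proof.
  intros Hx. apply is_pseries_Reals. unfold sin. destruct (exist_sin (Rsqr x)) as [l Hl].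
  unfold sin_in in Hl. unfold Pser. replace (x * l / x) with l by (field; easy).
  now replace (x ^ 2) with (Rsqr x) by (unfold Rsqr; ring).
Qed.

Lemma cauchy_coefs (a b c : nat -> R) rho (A Bf Cf : R -> R) : 0 < rho ->
  (forall x, 0 < x < rho -> is_pseries a (x ^ 2) (A x)) ->
  (forall x, 0 < x < rho -> is_pseries b (x ^ 2) (Bf x)) ->
  (forall x, 0 < x < rho -> is_pseries c (x ^ 2) (Cf x)) ->
  (forall x, 0 < x < rho -> A x * Bf x = Cf x) ->
  forall n, PS_mult a b n = c n.
Proof.
  intros Hr Ha Hb Hc E n.
  enough (PS_minus (PS_mult a b) c n = 0) as Z by (unfold PS_minus, PS_plus, PS_opp, plus, opp in Z; simpl in Z; lra).
  revert n. apply pseries_zero_right with ((rho / 2) ^ 2); [apply pow_lt; lra|]. intros w Hw.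
  set (x := sqrt w). assert (Ex : x ^ 2 = w) by (apply pow2_sqrt; lra).
  assert (Hx : 0 < x) by (apply sqrt_lt_R0; lra).
  assert (Hx2 : x < rho / 2) by nra.
  rewrite <- Ex. replace 0 with (Cf x + - Cf x) by ring. rewrite <- (E x) at 1 by lra.
  assert (Hlt : Rabs (x ^ 2) < Rabs ((rho / 2) ^ 2)) by (rewrite !Rabs_pos_eq; nra).
  apply (is_pseries_minus (K := R_AbsRing) (V := R_NormedModule)); [|apply Hc; lra].
  apply is_pseries_mult; [apply Ha; lra|apply Hb; lra| |]; (eapply CV_radius_gt; [|apply Hlt]); eexists; [apply Ha|apply Hb]; lra.
Qed.

Lemma cot_coef_rec n : PS_mult cot_coef sin_n n = cos_n n.
Proof.
  apply (cauchy_coefs cot_coef sin_n cos_n (1 / 2) (fun x => x * cot x) (fun x => sin x / x) cos); [lra| | | |].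
  - intros x Hx. apply cot_pseries; lra.
  - intros x Hx. apply sin_pseries; lra.
  - intros x Hx. apply cos_pseries.
  - intros x Hx. unfold cot. field. split; [lra|]. apply Rgt_not_eq, sin_gt_0; pose proof PI2_3_2; lra.
Qed.

(** The coefficients of y coth y in powers of y^2: y coth y is the even part of
    z / (e^z - 1) for z = 2y. *)
Definition coth_coef (B : nat -> R) (n : nat) : R := B (2 * n)%nat / INR (fact (2 * n)) * 4 ^ n.

Lemma coth_coef_rec B n : is_bernoulli B ->
  PS_mult (coth_coef B) (fun n => / INR (fact (2 * n + 1))) n = / INR (fact (2 * n)).
Proof.
  intros [r H].
  pose proof (cond_pos r) as Hr.
  apply (cauchy_coefs (coth_coef B) (fun n => / INR (fact (2 * n + 1))) (fun n => / INR (fact (2 * n))) (r / 2)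
     (fun y => y * (exp y + exp (- y)) / (exp y - exp (- y))) (fun y => (exp y - exp (- y)) / (2 * y))
     (fun y => (exp y + exp (- y)) / 2)); [lra| | | |].
  - intros y Hy.
    assert (Hlt : exp (- y) < exp y) by (apply exp_increasing; lra).
    pose proof (exp_pos y) as Py. pose proof (exp_pos (- y)) as Pn.
    assert (Epn : exp y * exp (- y) = 1) by (rewrite <- exp_plus, Rplus_opp_r; apply exp_0).
    pose proof (pseries_even_part _ _ _ _
      (H (2 * y) ltac:(lra) ltac:(rewrite Rabs_pos_eq; lra)) (H (- (2 * y)) ltac:(lra) ltac:(rewrite Rabs_Ropp, Rabs_pos_eq; lra))) as E.
    apply is_pseries_R. apply is_pseries_R in E.
    replace (y * (exp y + exp (- y)) / (exp y - exp (- y))) with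
      ((2 * y / (exp (2 * y) - 1) + - (2 * y) / (exp (- (2 * y)) - 1)) / 2).
    + refine (is_series_ext _ _ _ _ E). intros k. unfold coth_coef.
      replace ((2 * y) ^ 2) with (4 * y ^ 2) by ring. rewrite Rpow_mult_distr. simpl. ring.
    + replace (exp (2 * y)) with (exp y * exp y) by (rewrite <- exp_plus; f_equal; ring).
      replace (exp (- (2 * y))) with (exp (- y) * exp (- y)) by (rewrite <- exp_plus; f_equal; ring).
      assert (1 < exp y) by nra.
      set (u := exp y) in *. set (v := exp (- y)) in *.
      replace v with (/ u) in * by (apply (Rmult_eq_reg_l u); [rewrite Rinv_r; lra|lra]). field.
      repeat split; nra.
  - intros y Hy. apply (pseries_odd_part (fun n => / INR (fact n))); [lra|apply is_exp_Reals|apply is_exp_Reals].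
  - intros y Hy. apply (pseries_even_part (fun n => / INR (fact n))); apply is_exp_Reals.
  - intros y Hy. assert (Hlt : exp (- y) < exp y) by (apply exp_increasing; lra). field. lra.
Qed.

(** x cot x * (sin x / x) = cos x and y coth y * (sinh y / y) = cosh y have, up to
    the signs (-1)^n, the same coefficients in x^2 and y^2; hence so do x cot x and
    y coth y. *)
Lemma bernoulli_zeta B n : is_bernoulli B -> (1 <= n)%nat ->
  Rabs (B (2 * n)%nat) = 2 * INR (fact (2 * n)) * zeta_even n / (2 * PI) ^ (2 * n).
Proof.
  intros HB Hn.
  assert (E : forall n, (-1) ^ n * coth_coef B n = cot_coef n).
  { apply (PS_mult_inj_l _ _ sin_n); [unfold sin_n; simpl; lra|]. clear n Hn. intros n.
    rewrite cot_coef_rec. unfold cos_n, Rdiv. rewrite <- (coth_coef_rec B n HB). unfold PS_mult.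
    rewrite scal_sum. apply sum_eq. intros k Hk. unfold sin_n.
    replace ((-1) ^ n) with ((-1) ^ k * (-1) ^ (n - k)) by (rewrite <- pow_add; f_equal; lia).
    unfold Rdiv. ring. }
  specialize (E n). destruct n as [|n]; [lia|]. set (m := S n) in *.
  apply (f_equal Rabs) in E. unfold coth_coef in E. change (cot_coef m) with (-2 * zeta_even m / PI ^ (2 * m)) in E.
  pose proof (INR_fact_lt_0 (2 * m)) as Hf. pose proof PI_RGT_0 as HP.
  assert (Hp : 0 < PI ^ (2 * m)) by now apply pow_lt.
  assert (H4 : 0 < 4 ^ m) by (apply pow_lt; lra).
  assert (Hz : 0 <= zeta_even m).
  { unfold zeta_even. replace 0 with (0 * Series (fun k => / INR (S k) ^ (2 * m))) by ring. rewrite <- Series_scal_l.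
    apply Series_le; [|now apply ex_zeta_even]. intros k. assert (0 < / INR (S k) ^ (2 * m)) by (apply Rinv_0_lt_compat, pow_lt, lt_0_INR; lia). lra. }
  rewrite !Rabs_mult, pow_1_abs, Rmult_1_l in E.
  replace (-2 * zeta_even m / PI ^ (2 * m)) with (- (2 * zeta_even m / PI ^ (2 * m))) in E by (field; lra).
  rewrite Rabs_Ropp, (Rabs_pos_eq (4 ^ m)), (Rabs_pos_eq (2 * zeta_even m / _)) in E
    by (try apply Rdiv_le_0_compat; lra).
  unfold Rdiv in E at 1. rewrite Rabs_mult, (Rabs_pos_eq (/ _)) in E by (apply Rlt_le, Rinv_0_lt_compat; lra).
  rewrite Rpow_mult_distr, (pow_mult 2). replace (2 ^ 2) with 4 by ring.
  apply Rmult_eq_reg_r with (/ INR (fact (2 * m)) * 4 ^ m); [|apply Rgt_not_eq, Rmult_lt_0_compat; [now apply Rinv_0_lt_compat|easy]].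
  rewrite <- Rmult_assoc, E. field. repeat split; lra.
Qed.

(** * The three products *)

Lemma zeta_even_value zeta j : is_riemann_zeta zeta -> (1 <= j)%nat ->
  Re (zeta (RtoC (INR (2 * j)))) = zeta_even j.
Proof.
  intros [Hd _] Hj. assert (H2 : 2 <= INR (2 * j)) by (apply (le_INR 2); lia).
  specialize (Hd (RtoC (INR (2 * j))) ltac:(change (1 < INR (2 * j)); lra)).
  apply is_series_csum, Cconv_Re in Hd.
  assert (Z : is_series (fun k => / INR (S k) ^ (2 * j)) (zeta_even j)) by (apply Series_correct, ex_zeta_even, Hj).
  apply is_series_rsum in Z.
  assert (E : is_lim_seq (rsum (fun k => / INR (S k) ^ (2 * j))) (Re (zeta (RtoC (INR (2 * j)))))).
  { eapply is_lim_seq_ext; [|exact Hd]. intros n. cbv beta. rewrite Re_csum. apply rsum_ext. intros k _.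
    pose proof (INR_S_pos k) as Hk.
    rewrite <- RtoC_opp, <- RtoC_mult, Cexp_R. change (exp (- INR (2 * j) * ln (INR (S k))) = / INR (S k) ^ (2 * j)).
    rewrite <- Rpower_pow by easy. unfold Rpower. rewrite <- exp_Ropp. f_equal. ring. }
  apply is_lim_seq_unique in Z. apply is_lim_seq_unique in E. rewrite Z in E. now injection E.
Qed.

Lemma zeta_even_bounds j : (1 <= j)%nat -> 1 <= zeta_even j <= 1 + 2 * (1 / 4) ^ (j - 1).
Proof.
  intros Hj. pose proof (Series_correct _ (ex_zeta_even j Hj)) as Z. fold (zeta_even j) in Z.
  apply is_series_rsum in Z.
  assert (P : forall k, 0 < / INR (S k) ^ (2 * j)) by (intros k; apply Rinv_0_lt_compat, pow_lt, INR_S_pos).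
  split.
  - pose proof (is_lim_seq_incr_compare _ _ Z ltac:(intros n; rewrite rsum_Sn; specialize (P n); lra) 1%nat) as Q.
    simpl in Q. rewrite pow1, Rinv_1 in Q. lra.
  - apply is_lim_seq_incr_1 in Z.
    refine (is_lim_seq_le _ _ (Finite _) (Finite _) _ Z (is_lim_seq_const _)). intros n.
    rewrite rsum_S_l. change (INR 1) with 1. rewrite pow1, Rinv_1. apply Rplus_le_compat_l.
    apply Rle_trans with (rsum (fun k => (1 / 4) ^ (j - 1) * / INR (S k) ^ 2) n).
    + apply rsum_le. intros k _. pose proof (INR_S_pos k) as Hk.
      assert (H2 : 2 <= INR (S (S k))) by (apply (le_INR 2); lia).
      replace (2 * j)%nat with (2 * (j - 1) + 2)%nat by lia. rewrite pow_add, Rinv_mult.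
      assert (Hle : INR (S k) <= INR (S (S k))) by (apply le_INR; lia).
      apply Rmult_le_compat; try (apply Rlt_le, Rinv_0_lt_compat, pow_lt; lra).
      * replace ((1 / 4) ^ (j - 1)) with (/ 2 ^ (2 * (j - 1))).
        -- apply Rinv_le_contravar; [apply pow_lt; lra|]. apply pow_incr; lra.
        -- rewrite pow_mult, <- pow_inv. f_equal. field.
      * apply Rinv_le_contravar; [now apply pow_lt|]. apply pow_incr; lra.
    + rewrite rsum_scal, Rmult_comm. apply Rmult_le_compat_r; [apply pow_le; lra|apply rsum_inv_sq].
Qed.

Lemma prod1_ext f g n : (forall v, (1 <= v)%nat -> f v = g v) -> prod1 f n = prod1 g n.
Proof. intros H. induction n as [|n IH]; simpl; [easy|]. rewrite IH, H; [easy|lia]. Qed.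

Lemma prod1_pos f n : (forall v, (1 <= v)%nat -> 0 < f v) -> 0 < prod1 f n.
Proof. intros H. induction n as [|n IH]; simpl; [lra|]. apply Rmult_lt_0_compat; [easy|apply H; lia]. Qed.

(** The factors are between 1 and exp (2 * 4^(1-v)), so the partial products
    increase and stay below exp 4. *)
Lemma C_2_limit zeta : is_riemann_zeta zeta -> is_lim_seq (prod1 zeta_even) (C_2 zeta) /\ 1 <= C_2 zeta.
Proof.
  intros Hz.
  assert (B : forall n, prod1 zeta_even n <= exp (2 * rsum (fun k => (1 / 4) ^ k) n)).
  { induction n as [|n IH]; [simpl; rewrite Rmult_0_r, exp_0; lra|].
    simpl prod1. rewrite rsum_Sn, Rmult_plus_distr_l, exp_plus.
    destruct (zeta_even_bounds (S n) ltac:(lia)) as [Z1 Z2]. replace (S n - 1)%nat with n in Z2 by lia.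
    apply Rmult_le_compat; [|lra|easy|].
    - apply Rlt_le, prod1_pos. intros v Hv. pose proof (zeta_even_bounds v Hv). lra.
    - eapply Rle_trans; [apply Z2|]. apply exp_ineq1_le. }
  assert (I : forall n, prod1 zeta_even n <= prod1 zeta_even (S n)).
  { intros n. simpl. pose proof (zeta_even_bounds (S n) ltac:(lia)).
    assert (0 < prod1 zeta_even n) by (apply prod1_pos; intros v Hv; pose proof (zeta_even_bounds v Hv); lra). nra. }
  destruct (ex_finite_lim_seq_incr (prod1 zeta_even) (exp 4)) as [l Hl]; [easy| |].
  { intros n. eapply Rle_trans; [apply B|]. apply exp_monotone. pose proof (rsum_geom (1 / 4) n ltac:(lra)). lra. }
  assert (E : C_2 zeta = l).
  { unfold C_2. rewrite (Lim_seq_ext _ (prod1 zeta_even)).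
    - now rewrite (is_lim_seq_unique _ _ Hl).
    - intros n. apply prod1_ext. intros v Hv. now apply zeta_even_value. }
  rewrite E. split; [easy|]. exact (is_lim_seq_incr_compare _ _ Hl I O).
Qed.

Lemma prod_bernoulli B n : is_bernoulli B ->
  prod1 (fun v => Rabs (B (2 * v)%nat)) n =
  prod1 (fun v => INR (fact (2 * v))) n * prod1 zeta_even n * (2 ^ n / (2 * PI) ^ (n * (n + 1))).
Proof.
  intros HB. pose proof PI_RGT_0.
  assert (P : forall m, (2 * PI) ^ m <> 0) by (intros; apply pow_nonzero; lra).
  rewrite (prod1_ext _ (fun v => 2 * INR (fact (2 * v)) * zeta_even v / (2 * PI) ^ (2 * v)))
    by (intros; now apply bernoulli_zeta).
  induction n as [|n IH]; [simpl; field|].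
  cbn [prod1]. rewrite IH. replace (S n * (S n + 1))%nat with (n * (n + 1) + 2 * S n)%nat by ring.
  rewrite (pow_add (2 * PI)). change (2 ^ S n) with (2 * 2 ^ n). field. split; apply P.
Qed.

Lemma prod_div_even (f : nat -> R) n :
  prod1 (fun v => f v / INR (2 * v)) n = prod1 f n / (2 ^ n * INR (fact n)).
Proof.
  induction n as [|n IH]; [simpl; field|].
  cbn [prod1]. rewrite IH, fact_simpl, !mult_INR. change (2 ^ S n) with (2 * 2 ^ n). change (INR 2) with (1 + 1).
  field. repeat split; first [apply INR_fact_neq_0 | apply pow_nonzero; lra | apply not_0_INR; lia].
Qed.

Lemma Rpower_4_half n : Rpower 4 (INR n / 2) = 2 ^ n.
Proof.
  replace 4 with (Rpower 2 (INR 2)) by (rewrite Rpower_pow by lra; ring). change (INR 2) with (1 + 1).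
  rewrite Rpower_mult, <- Rpower_pow by lra. f_equal. field.
Qed.

(** In the product of the (2v)!, v <= n, the integer k <= 2n occurs n + 1 - k/2
    times if k is even and n + 1/2 - k/2 times if k is odd; the product of the even
    ones is 2^n n!. *)
Lemma ln_prod_even_fact n :
  ln (prod1 (fun v => INR (fact (2 * v))) n) =
  (INR n + 1 / 2) * ln (INR (fact (2 * n))) - hyperlog (2 * n) / 2 + (INR n * ln 2 + ln (INR (fact n))) / 2.
Proof.
  induction n as [|n IH].
  - simpl. rewrite ln_1. unfold hyperlog; simpl. field.
  - cbn [prod1]. rewrite ln_mult by (try apply prod1_pos; intros; apply INR_fact_lt_0).
    rewrite IH. replace (2 * S n)%nat with (S (S (2 * n))) by lia.
    change (hyperlog (S (S (2 * n)))) with (hyperlog (2 * n) + INR (S (2 * n)) * ln (INR (S (2 * n)))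
      + INR (S (S (2 * n))) * ln (INR (S (S (2 * n))))).
    rewrite (fact_simpl (S (2 * n))), (fact_simpl (2 * n)), (fact_simpl n), !mult_INR.
    repeat rewrite ln_mult by (try apply Rmult_lt_0_compat; try apply INR_fact_lt_0; apply INR_S_pos).
    replace (INR (S (S (2 * n)))) with (2 * INR (S n)) by (rewrite !S_INR, mult_INR; simpl; ring).
    rewrite ln_mult by (try apply INR_S_pos; lra).
    replace (INR (S (2 * n))) with (2 * INR n + 1) by (rewrite S_INR, mult_INR; simpl; ring).
    rewrite (S_INR n). field.
Qed.

(** * The constant F_2 and the asymptotic formulas *)

Ltac positivity := repeat match goal with
  | |- 0 < _ * _ => apply Rmult_lt_0_compat
  | |- 0 < _ / _ => apply Rdiv_lt_0_compat
  | |- 0 < _ ^ _ => apply pow_lt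
  | |- 0 < exp _ => apply exp_pos
  | |- 0 < INR (fact _) => apply INR_fact_lt_0
  end; try assumption; try lra.

(** The comparison function in the definition of F_2, without the factor F_2. *)
Definition even_fact_model (A : R) (n : nat) : R :=
  A ^ 2 * Rpower (2 * PI) (1 / 4) * (2 * INR n / exp (3 / 2)) ^ (n * (n + 1))
  * Rpower (4 * PI * INR n) (INR n / 2) * Rpower (INR n) (11 / 24).

Lemma even_fact_model_pos A n : 0 < A -> (1 <= n)%nat -> 0 < even_fact_model A n.
Proof.
  intros HA Hn. assert (H1 : 0 < INR n) by (apply lt_0_INR; lia).
  unfold even_fact_model, Rpower.
  positivity.
Qed.

Lemma ln_even_fact_model A n : 0 < A -> (1 <= n)%nat ->
  ln (even_fact_model A n) =
  2 * ln A + 1 / 4 * ln (2 * PI) + INR n * (INR n + 1) * (ln 2 + ln (INR n) - 3 / 2)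
  + INR n / 2 * (ln 2 + ln (2 * PI) + ln (INR n)) + 11 / 24 * ln (INR n).
Proof.
  intros HA Hn. assert (H1 : 0 < INR n) by (apply lt_0_INR; lia). pose proof PI_RGT_0.
  unfold even_fact_model, Rpower.
  assert (H2 : 0 < 2 * INR n / exp (3 / 2)) by positivity.
  repeat (rewrite ln_mult by positivity).
  rewrite !ln_exp, !ln_pow by easy.
  rewrite ln_div by (try apply exp_pos; lra). rewrite ln_exp, mult_INR, plus_INR.
  assert (E4 : ln 4 = ln 2 + ln 2) by (replace 4 with (2 * 2) by ring; apply ln_mult; lra).
  repeat (rewrite ln_mult by positivity). rewrite E4.
  change (INR 2) with (1 + 1). change (INR 1) with 1. field.
Qed.

Lemma stirling_rem_limit : is_lim_seq stirling_rem (ln (2 * PI) / 2).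
Proof.
  apply (is_lim_seq_abs_le _ _ (fun n => / INR n) 1); [|apply is_lim_seq_inv_INR].
  intros n Hn. destruct (stirling_bounds n Hn) as [B1 B2].
  assert (H1 : 1 <= INR n) by (apply (le_INR 1); easy).
  assert (0 < / (12 * INR n + 1)) by (apply Rinv_0_lt_compat; lra).
  assert (/ (12 * INR n) <= / INR n) by (apply Rinv_le_contravar; lra).
  apply Rabs_le. lra.
Qed.

(** After inserting Stirling's formula and the asymptotics of [hyperlog], all
    growing terms cancel.  The term 1/24 is the limit of (n + 1/2) / (12 * 2n). *)
Lemma even_fact_constant A :
  0 < A ->
  is_lim_seq (fun n => hyperlog n - (INR n ^ 2 / 2 + INR n / 2 + 1 / 12) * ln (INR n) + INR n ^ 2 / 4) (ln A) ->
  is_lim_seq (fun n => ln (prod1 (fun v => INR (fact (2 * v))) n) - ln (even_fact_model A n))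
    (1 / 24 - 1 / 2 * ln A + (1 / 4 * ln (2 * PI) + 5 / 24 * ln 2 - 2 * ln A)).
Proof.
  intros HA HL. set (c := ln (2 * PI) / 2).
  set (h := fun n => hyperlog n - (INR n ^ 2 / 2 + INR n / 2 + 1 / 12) * ln (INR n) + INR n ^ 2 / 4) in *.
  assert (L1 : is_lim_seq (fun n => (INR n + 1 / 2) * (stirling_rem (2 * n) - c)) (1 / 24)).
  { apply is_lim_seq_le_le_loc with (fun _ => 1 / 24) (fun n => 1 / 24 + 1 / 48 * / INR n).
    - exists 1%nat. intros n Hn. assert (H1 : 1 <= INR n) by (apply (le_INR 1); easy).
      destruct (stirling_bounds (2 * n) ltac:(lia)) as [B1 B2]. fold c in B1, B2.
      rewrite mult_INR in B1, B2. change (INR 2) with (1 + 1) in B1, B2.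
      set (x := INR n) in *. split.
      + apply Rle_trans with ((x + 1 / 2) * / (12 * ((1 + 1) * x) + 1)); [|apply Rmult_le_compat_l; lra].
        apply (Rle_div_r (1 / 24)); lra.
      + apply Rle_trans with ((x + 1 / 2) * / (12 * ((1 + 1) * x))); [apply Rmult_le_compat_l; lra|].
        right. field. lra.
    - apply is_lim_seq_const.
    - replace (1 / 24) with (1 / 24 + 1 / 48 * 0) at 1 by field.
      apply is_lim_seq_plus'; [apply is_lim_seq_const|]. apply (is_lim_seq_scal_l _ (1 / 48) 0), is_lim_seq_inv_INR. }
  assert (L2 : is_lim_seq (fun n => stirling_rem n - c) (c - c))
    by (apply is_lim_seq_minus'; [apply stirling_rem_limit|apply is_lim_seq_const]).
  rewrite Rminus_diag in L2.
  assert (L3 : is_lim_seq (fun n => h (2 * n)%nat) (ln A)).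
  { apply (is_lim_seq_subseq h (ln A) (fun n => (2 * n)%nat)); [apply eventually_subseq; intros; lia|easy]. }
  apply is_lim_seq_ext_loc with (fun n => (INR n + 1 / 2) * (stirling_rem (2 * n) - c) - 1 / 2 * h (2 * n)%nat
     + (1 / 2 * (stirling_rem n - c) + (1 / 4 * ln (2 * PI) + 5 / 24 * ln 2 - 2 * ln A))).
  - exists 1%nat. intros n Hn. rewrite ln_prod_even_fact, ln_even_fact_model by easy.
    unfold stirling_rem, h, c. assert (H1 : 0 < INR n) by (apply lt_0_INR; lia).
    rewrite mult_INR. change (INR 2) with (1 + 1). replace (1 + 1) with 2 by ring.
    rewrite (ln_mult 2 (INR n)) by lra. field.
  - replace (1 / 24 - 1 / 2 * ln A + (1 / 4 * ln (2 * PI) + 5 / 24 * ln 2 - 2 * ln A)) with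
      (1 / 24 - 1 / 2 * ln A + (1 / 2 * 0 + (1 / 4 * ln (2 * PI) + 5 / 24 * ln 2 - 2 * ln A))) by ring.
    apply is_lim_seq_plus'.
    + apply is_lim_seq_minus'; [easy|]. now apply (is_lim_seq_scal_l _ (1 / 2) (Finite _)).
    + apply is_lim_seq_plus'; [|apply is_lim_seq_const]. now apply (is_lim_seq_scal_l _ (1 / 2) (Finite _)).
Qed.

Lemma F_2_value zeta F_2 : is_riemann_zeta zeta -> is_F_2 zeta F_2 ->
  F_2 = exp (1 / 24 - 1 / 2 * ln (glaisher zeta) + (1 / 4 * ln (2 * PI) + 5 / 24 * ln 2 - 2 * ln (glaisher zeta))).
Proof.
  intros Hz [HF Hs]. set (A := glaisher zeta) in *. assert (HA : 0 < A) by apply exp_pos.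
  pose proof (even_fact_constant A HA (hyperlog_limit zeta Hz)) as L1.
  assert (L2 : is_lim_seq (fun n => ln (prod1 (fun v => INR (fact (2 * v))) n) - ln (even_fact_model A n)) (ln 1 + ln F_2)).
  { pose proof (is_lim_seq_continuous ln _ 1 ltac:(apply derivable_continuous_pt; exists (/ 1); apply derivable_pt_lim_ln; lra) Hs) as C1.
    apply is_lim_seq_ext_loc with (fun n => ln (prod1 (fun v => INR (fact (2 * v))) n / (F_2 * even_fact_model A n)) + ln F_2).
    - exists 1%nat. intros n Hn. pose proof (even_fact_model_pos A n HA Hn).
      rewrite ln_div by (positivity; apply prod1_pos; intros; positivity).
      rewrite ln_mult by easy. ring.
    - apply is_lim_seq_plus'; [|apply is_lim_seq_const].
      eapply is_lim_seq_ext; [|exact C1]. intros n. cbv beta. unfold even_fact_model. f_equal. f_equal. fold A. ring. }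
  apply is_lim_seq_unique in L1. apply is_lim_seq_unique in L2. rewrite L1 in L2. injection L2 as E.
  rewrite E, ln_1, Rplus_0_l, exp_ln; easy.
Qed.

Lemma sim_mult_limit f g u v (F : nat -> R) (l : R) : l <> 0 ->
  sim f F -> is_lim_seq u l ->
  (forall n, (1 <= n)%nat -> v n <> 0) -> (forall n, (1 <= n)%nat -> F n <> 0) ->
  (forall n, (1 <= n)%nat -> g n = l * F n * v n) ->
  sim (fun n => f n * u n * v n) g.
Proof.
  intros Hl Hs Hu Hv HF Hg. unfold sim in *.
  apply is_lim_seq_ext_loc with (fun n => (f n / F n) * (u n / l)).
  - exists 1%nat. intros n Hn. rewrite Hg by easy. field. repeat split; auto.
  - replace 1 with (1 * (l / l)) by (field; easy). apply is_lim_seq_mult'; [easy|].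
    apply (is_lim_seq_scal_r _ (/ l) (Finite _)). easy.
Qed.

Theorem theorem4p1 (zeta : C -> C) (B : nat -> R) (F_2 : R)
    (Hzeta : is_riemann_zeta zeta) (HB : is_bernoulli B)
    (HF_2 : is_F_2 zeta F_2) :
  let A := glaisher zeta in
  let B_1 := C_2 zeta * F_2 * A ^ 2 * Rpower (2 * PI) (1 / 4) in
  let B_2 := C_2 zeta * F_2 * A ^ 2 * Rpower (2 * PI) (- (1 / 4)) in
  sim (prod1 (fun v => Rabs (B (2 * v)%nat)))
      (fun n => B_1 * (INR n / (PI * exp (3 / 2))) ^ (n * (n + 1))
                * Rpower (16 * PI * INR n) (INR n / 2)
                * Rpower (INR n) (11 / 24)) /\
  sim (prod1 (fun v => Rabs (B (2 * v)%nat) / INR (2 * v)))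
      (fun n => B_2 * (INR n / (PI * exp (3 / 2))) ^ (n ^ 2)
                * Rpower (4 * INR n / (PI * exp 1)) (INR n / 2)
                * Rpower (INR n) (- (1 / 24))) /\
  B_1 = C_2 zeta * Rpower (2 * PI) (1 / 2) * Rpower 2 (5 / 24)
        * exp (1 / 24) * Rpower A (- (1 / 2)) /\
  B_2 = C_2 zeta * Rpower 2 (5 / 24) * exp (1 / 24) * Rpower A (- (1 / 2)).
Proof.
  intros A B_1 B_2.
  assert (HA : 0 < A) by apply exp_pos.
  destruct (C_2_limit zeta Hzeta) as [LC HC].
  pose proof (F_2_value zeta F_2 Hzeta HF_2) as EF. fold A in EF.
  destruct HF_2 as [HF Hs].
  pose proof PI_RGT_0 as HP. pose proof (exp_pos (3 / 2)) as He.
  assert (EA : A ^ 2 = exp (2 * ln A)).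
  { rewrite <- (exp_ln A) at 1 by easy. simpl. rewrite Rmult_1_r, <- exp_plus. f_equal. ring. }
  set (F := even_fact_model A).
  assert (HFpos : forall n, (1 <= n)%nat -> 0 < F n) by (intros; now apply even_fact_model_pos).
  set (g1 := fun n => B_1 * (INR n / (PI * exp (3 / 2))) ^ (n * (n + 1))
                * Rpower (16 * PI * INR n) (INR n / 2) * Rpower (INR n) (11 / 24)).
  set (g2 := fun n => B_2 * (INR n / (PI * exp (3 / 2))) ^ (n ^ 2)
                * Rpower (4 * INR n / (PI * exp 1)) (INR n / 2) * Rpower (INR n) (- (1 / 24))).
  assert (S1 : sim (prod1 (fun v => Rabs (B (2 * v)%nat))) g1).
  { assert (S0 : sim (fun n => prod1 (fun v => INR (fact (2 * v))) n * prod1 zeta_even n * (2 ^ n / (2 * PI) ^ (n * (n + 1)))) g1).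
    { apply sim_mult_limit with (fun n => F_2 * F n) (C_2 zeta); [lra| |easy| | |].
      - eapply is_lim_seq_ext; [|exact Hs]. intros n. cbv beta. f_equal. unfold F, even_fact_model, A. ring.
      - intros n _. apply Rmult_integral_contrapositive_currified; [|apply Rinv_neq_0_compat]; apply pow_nonzero; lra.
      - intros n Hn. apply Rmult_integral_contrapositive_currified; [lra|]. specialize (HFpos n Hn). lra.
      - intros n Hn. assert (H1 : 0 < INR n) by (apply lt_0_INR; lia).
        unfold g1, B_1, F, even_fact_model.
        replace (16 * PI * INR n) with (4 * (4 * PI * INR n)) by ring.
        rewrite <- (Rpower_mult_distr 4 (4 * PI * INR n)) by nra.
        rewrite Rpower_4_half.
        replace (2 * INR n / exp (3 / 2)) with (INR n / (PI * exp (3 / 2)) * (2 * PI)) by (field; lra).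
        rewrite (Rpow_mult_distr _ (2 * PI)). field. apply pow_nonzero; lra. }
    eapply is_lim_seq_ext; [|exact S0]. intros n. cbv beta. now rewrite prod_bernoulli. }
  split; [easy|]. split; [|split].
  - unfold sim. fold g2.
    assert (P1 : forall n, (1 <= n)%nat -> 0 < g1 n).
    { intros n Hn. assert (H1 : 0 < INR n) by (apply lt_0_INR; lia). unfold g1, B_1, Rpower.
      positivity. }
    assert (P2 : forall n, (1 <= n)%nat -> 0 < g2 n).
    { intros n Hn. assert (H1 : 0 < INR n) by (apply lt_0_INR; lia). unfold g2, B_2, Rpower.
      positivity. }
    (* The two comparison functions differ by the Stirling approximation of n!. *)
    assert (K : forall n, (1 <= n)%nat -> g1 n / (2 ^ n * INR (fact n)) / g2 n = exp (ln (2 * PI) / 2 - stirling_rem n)).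
    { intros n Hn. assert (H1 : 0 < INR n) by (apply lt_0_INR; lia).
      pose proof (P1 n Hn) as Q1. pose proof (P2 n Hn) as Q2. pose proof (INR_fact_lt_0 n) as Q3.
      assert (Q4 : 0 < 2 ^ n) by (apply pow_lt; lra).
      assert (Q5 : 0 < 2 ^ n * INR (fact n)) by now apply Rmult_lt_0_compat.
      assert (Q6 : 0 < g1 n / (2 ^ n * INR (fact n))) by now apply Rdiv_lt_0_compat.
      rewrite <- (exp_ln (g1 n / (2 ^ n * INR (fact n)) / g2 n)) by now apply Rdiv_lt_0_compat.
      f_equal. rewrite ln_div, ln_div, (ln_mult (2 ^ n)), ln_pow by (easy || lra).
      assert (Q7 : 0 < INR n / (PI * exp (3 / 2))) by positivity.
      assert (Q8 : forall c a b d, 0 < a -> ln (C_2 zeta * F_2 * A ^ 2 * exp c * a * exp b * exp d) =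
         ln (C_2 zeta * F_2 * A ^ 2) + c + ln a + b + d).
      { intros c a b d Ha. assert (0 < C_2 zeta * F_2 * A ^ 2) by positivity.
        repeat (rewrite ln_mult by positivity).
        rewrite !ln_exp. ring. }
      unfold g1, g2, B_1, B_2, Rpower. rewrite !Q8 by now apply pow_lt.
      rewrite !ln_pow by easy. pose proof (exp_pos 1).
      rewrite !ln_div by positivity.
      assert (E4 : ln 4 = ln 2 + ln 2) by (replace 4 with (2 * 2) by ring; apply ln_mult; lra).
      assert (E16 : ln 16 = ln 4 + ln 4) by (replace 16 with (4 * 4) by ring; apply ln_mult; lra).
      rewrite !(ln_mult _ (INR n)), !(ln_mult _ PI), !(ln_mult PI), !ln_exp, E16, E4 by positivity.
      unfold stirling_rem. replace (n ^ 2)%nat with (n * n)%nat by (simpl; lia).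
      rewrite !mult_INR, plus_INR. change (INR 1) with 1. field. }
    apply is_lim_seq_ext_loc with (fun n => prod1 (fun v => Rabs (B (2 * v)%nat)) n / g1 n * exp (ln (2 * PI) / 2 - stirling_rem n)).
    + exists 1%nat. intros n Hn. rewrite prod_div_even, <- K by easy.
      specialize (P1 n Hn). specialize (P2 n Hn). pose proof (INR_fact_lt_0 n).
      assert (0 < 2 ^ n) by (apply pow_lt; lra). field. lra.
    + replace 1 with (1 * exp (ln (2 * PI) / 2 - ln (2 * PI) / 2)) by (rewrite Rminus_diag, exp_0; ring).
      apply is_lim_seq_mult'; [exact S1|].
      apply (is_lim_seq_continuous exp (fun n => ln (2 * PI) / 2 - stirling_rem n)).
      * apply derivable_continuous_pt, derivable_pt_exp.
      * apply is_lim_seq_minus'; [apply is_lim_seq_const|apply stirling_rem_limit].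
  - unfold B_1, Rpower. rewrite EF, EA.
    rewrite !Rmult_assoc. f_equal. rewrite <- !exp_plus. f_equal. field.
  - unfold B_2, Rpower. rewrite EF, EA.
    rewrite !Rmult_assoc. f_equal. rewrite <- !exp_plus. f_equal. field.
Qed.
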